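(* Let $G$ be a connected simple graph, and let $H$ be a connected subgraph of $G$ with $|H|=|G|-k$ for some $k>0$, where $|\cdot|$ denotes the number of vertices. Let $(M_G,\omega_G)$ and $(M_H,\omega_H)$ be the symplectic toric manifolds determined by the graph associahedra of $G$ and $H$. Then for every integer $m\ge 0$, no embedding $$M_G\times\mathbb{R}^{2m}\hookrightarrow M_H\times\mathbb{R}^{2k+2m}$$ is symplectic, where both sides carry the product symplectic forms with the standard symplectic form on the Euclidean factors.
   Context: All graphs are finite, with nonempty vertex set. Graph associahedron: for a connected simple graph $G$ on $[n+1]=\{1,\dots,n+1\}$ (label the vertices arbitrarily) let $\mathcal{B}(G)$ be the set of nonempty $I\subset[n+1]$ such that the induced subgraph $G|_I$ is connected. For $I\subset[n+1]$ let $\Delta_I=\mathrm{conv}\{e_i : i\in I\}\subset\mathbb{R}^{n+1}$, with $e_i$ the standard coordinate vectors. The graph associahedron is the Minkowski sum $P_{\mathcal{B}(G)}=\sum_{I\in\mathcal{B}(G)}\Delta_I\subset\mathbb{R}^{n+1}$. It has dimension $n$, lies in the hyperplane $\sum_i x_i=|\mathcal{B}(G)|$, and is regarded as a Delzant polytope in $\mathbb{R}^n$ via the projection $(x_1,\dots,x_{n+1})\mapsto(x_1,\dots,x_n)$, which identifies the integer points of this hyperplane with $\mathbb{Z}^n$. Symplectic toric manifold: a $d$-dimensional Delzant polytope $P\subset\mathbb{R}^d$ is a convex polytope such that at each vertex the primitive outward normal vectors of the facets containing it form a basis of $\mathbb{Z}^d$. By Delzant's theorem it determines, uniquely up to equivariant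 symplectomorphism, a compact connected symplectic manifold of dimension $2d$ with an effective Hamiltonian action of $T^d$ and moment map image $P$ (a point if $d=0$). Normalization: $T^d=\mathbb{R}^d/\mathbb{Z}^d$, so that $\mathbb{P}^1$ with moment polytope an interval of length $\ell$ has symplectic area $\ell$. *)

(* Defs.v *)
From HB Require Import structures.
From mathcomp Require Import all_boot all_order all_algebra.
From mathcomp Require Import all_classical all_reals all_analysis.

Set Implicit Arguments.
Unset Strict Implicit.
Unset Printing Implicit Defensive.

Import Order.TTheory GRing.Theory Num.Theory.
Import numFieldNormedType.Exports.

Local Open Scope classical_set_scope.
Local Open Scope ring_scope.

(** * Graphs *)

(* A finite simple graph whose vertices form a subset of an ambient type, so
   that "H is a subgraph of G" is literal inclusion. *)
Record sgraph (T : finType) := SGraph {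
  vset : {set T};
  adj : rel T;
  adj_sym : symmetric adj;
  adj_irrefl : irreflexive adj;
  adj_vset : forall x y, adj x y -> x \in vset
}.

Section Graphs.
Variable T : finType.
Implicit Types (G H : sgraph T) (A : {set T}).

Definition subgraph H G : Prop :=
  (vset H \subset vset G) /\ (forall x y, adj H x y -> adj G x y).

Definition graph_connected G : bool :=
  (vset G != finset.set0) &&
  [forall x in vset G, forall y in vset G, connect (adj G) x y].

Definition induced_adj G A : rel T :=
  [rel x y | [&& x \in A, y \in A & adj G x y]].

Lemma induced_adj_sym G A : symmetric (induced_adj G A).
Proof. by move=> x y; rewrite /induced_adj /= (adj_sym G) andbCA. Qed.

Lemma induced_adj_irrefl G A : irreflexive (induced_adj G A).
Proof. by move=> x; rewrite /induced_adj /= (adj_irrefl G) !andbF. Qed.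

Lemma induced_adj_vset G A x y :
  induced_adj G A x y -> x \in A :&: vset G.
Proof. by move=> /and3P[xA _ /adj_vset xG]; rewrite inE xA. Qed.

Definition induced_subgraph G A : sgraph T :=
  SGraph (@induced_adj_sym G A) (@induced_adj_irrefl G A)
         (@induced_adj_vset G A).

(* The labels 1, ..., n+1 are the elements of 'I_n.+1. *)
Definition labelling n G (lab : 'I_n.+1 -> T) : Prop :=
  injective lab /\ [set lab i | i : 'I_n.+1]%SET = vset G.

Definition building_set n G (lab : 'I_n.+1 -> T) : {set {set 'I_n.+1}} :=
  [set I : {set 'I_n.+1} |
     graph_connected (induced_subgraph G [set lab i | i in I])]%SET.

End Graphs.

(** * Graph associahedra *)

Section Associahedron.
Variable R : realType.

(* conv {e_i : i in I} *)
Definition simplex N (I : {set 'I_N}) : set 'rV[R]_N :=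
  [set x | exists c : 'I_N -> R,
     [/\ forall i, 0 <= c i, \sum_(i in I) c i = 1 &
         x = \sum_(i in I) c i *: delta_mx 0 i]].

Definition minkowski_sum N (B : {set {set 'I_N}})
    (P : {set 'I_N} -> set 'rV[R]_N) : set 'rV[R]_N :=
  [set x | exists y : {set 'I_N} -> 'rV[R]_N,
     (forall I, I \in B -> P I (y I)) /\ x = \sum_(I in B) y I].

Definition drop_last n (x : 'rV[R]_n.+1) : 'rV[R]_n :=
  \row_j x 0 (widen_ord (leqnSn n) j).

Definition graph_associahedron (T : finType) n (G : sgraph T)
    (lab : 'I_n.+1 -> T) : set 'rV[R]_n :=
  @drop_last n @` minkowski_sum (building_set G lab) (@simplex n.+1).

End Associahedron.
Arguments graph_associahedron R {T n} G lab.

(** * Smooth manifolds *)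

Section Smoothness.
Variables (R : realType) (V W : normedModType R).

Fixpoint Ck (k : nat) (U : set V) (f : V -> W) : Prop :=
  (forall x, U x -> {for x, continuous f}) /\
  (if k is k'.+1 then
     forall v, (forall x, U x -> derivable f x v) /\ Ck k' U ('D_v f)
   else True).

(* C^oo on U; only meaningful for open U. *)
Definition smooth_on (U : set V) (f : V -> W) : Prop := forall k, Ck k U f.

End Smoothness.

(* Outside [cdom] (resp. its image) the values of [cmap] (resp. [cinv]) are
   irrelevant. *)
Record chart (R : realType) (d : nat) (M : topologicalType) := Chart {
  cdom : set M;
  cmap : M -> 'rV[R]_d;
  cinv : 'rV[R]_d -> M
}.

Definition is_chart (R : realType) d (M : topologicalType)
    (c : chart R d M) : Prop :=
  [/\ open (cdom c) /\ open (cmap c @` cdom c),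
      forall p, cdom c p -> cinv c (cmap c p) = p,
      forall p, cdom c p -> {for p, continuous (cmap c)} &
      forall x, (cmap c @` cdom c) x -> {for x, continuous (cinv c)}].

(* The data of a d-dimensional manifold: a space with a (not necessarily
   maximal) family of charts; the axioms are in [is_manifold]. *)
Record mfd (R : realType) (d : nat) := Mfd {
  carrier :> topologicalType;
  chart_index : Type;
  chart_at : chart_index -> chart R d carrier
}.

Section Maps.
Variables (R : realType) (d d' : nat) (M : mfd R d) (N : mfd R d').
Implicit Types (f : M -> N) (i : chart_index M) (j : chart_index N).

Definition local_rep f i j : 'rV[R]_d -> 'rV[R]_d' :=
  cmap (chart_at j) \o f \o cinv (chart_at i).

Definition local_dom f i j : set 'rV[R]_d :=
  cmap (chart_at i) @` (cdom (chart_at i) `&` f @^-1` cdom (chart_at j)).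

Definition smooth_map f : Prop :=
  continuous f /\ forall i j, smooth_on (local_dom f i j) (local_rep f i j).

Definition immersive f : Prop :=
  forall i j x, local_dom f i j x ->
    forall v, 'D_v (local_rep f i j) x = 0 -> v = 0.

(* The last clause says that f is open onto its image, so that together with
   continuity and injectivity f is a homeomorphism onto its image. *)
Definition smooth_embedding f : Prop :=
  [/\ smooth_map f, immersive f, injective f &
      forall U : set M, open U -> exists2 V : set N, open V & U = f @^-1` V].

End Maps.

(* The smoothness of the identity, read in two charts, is the smoothness of
   the transition map between them. *)
Definition is_manifold (R : realType) d (M : mfd R d) : Prop :=
  [/\ hausdorff_space M, @second_countable M,
      forall i, is_chart (@chart_at R d M i),
      forall p : M, exists i, cdom (@chart_at R d M i) p &
      @smooth_map R d d M M idfun].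

Definition euclid (R : realType) n : mfd R n :=
  @Mfd R n 'rV[R]_n unit (fun _ => Chart setT id id).

Section Product.
Variables (R : realType) (d e : nat) (M : mfd R d) (N : mfd R e).

Definition prod_chart (ij : chart_index M * chart_index N) :
    chart R (d + e) (M * N)%type :=
  Chart (cdom (chart_at ij.1) `*` cdom (chart_at ij.2))
        (fun p => row_mx (cmap (chart_at ij.1) p.1) (cmap (chart_at ij.2) p.2))
        (fun x => (cinv (chart_at ij.1) (lsubmx x),
                   cinv (chart_at ij.2) (rsubmx x))).

Definition prod_mfd : mfd R (d + e) :=
  @Mfd R (d + e) (M * N)%type (chart_index M * chart_index N)%type prod_chart.

End Product.

(** * Symplectic forms *)

(* A 2-form, given by its matrix in each chart, as a function of the
   coordinates; the axioms are in [symplectic_form]. *)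
Definition form2 (R : realType) d (M : mfd R d) :=
  chart_index M -> 'rV[R]_d -> 'M[R]_d.

Definition bform (R : realType) d (A : 'M[R]_d) (u v : 'rV[R]_d) : R :=
  (u *m A *m v^T) 0 0.

(* f^* w' = w *)
Definition pulls_back (R : realType) d d' (M : mfd R d) (N : mfd R d')
    (f : M -> N) (w' : form2 N) (w : form2 M) : Prop :=
  forall i j x, local_dom f i j x -> forall u v,
    bform (w' j (local_rep f i j x))
          ('D_u (local_rep f i j) x) ('D_v (local_rep f i j) x)
    = bform (w i x) u v.

(* The second clause, for the identity map, is the compatibility of the local
   matrices under changes of charts; the last one is dw = 0. *)
Definition symplectic_form (R : realType) d (M : mfd R d) (w : form2 M) : Prop :=
  [/\ is_manifold M,
      pulls_back (idfun : M -> M) w w,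
      forall i, smooth_on (cmap (chart_at i) @` cdom (chart_at i)) (w i),
      forall i x, (cmap (chart_at i) @` cdom (chart_at i)) x ->
        (w i x)^T = - w i x /\ w i x \in unitmx &
      forall i x, (cmap (chart_at i) @` cdom (chart_at i)) x ->
        forall a b c,
          'D_(delta_mx 0 a) (fun y => w i y b c) x
          + 'D_(delta_mx 0 b) (fun y => w i y c a) x
          + 'D_(delta_mx 0 c) (fun y => w i y a b) x = 0].

(* sum_i dx_i /\ dy_i in the coordinates (x_1, ..., x_m, y_1, ..., y_m) *)
Definition std_form (R : realType) m : form2 (euclid R (m + m)) :=
  fun _ _ => block_mx 0 1%:M (- 1%:M) 0.
Arguments std_form : clear implicits.

Definition prod_form (R : realType) d e (M : mfd R d) (N : mfd R e)
    (w : form2 M) (w' : form2 N) : form2 (prod_mfd M N) :=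
  fun ij x => block_mx (w ij.1 (lsubmx x)) 0 0 (w' ij.2 (rsubmx x)).

(** * Symplectic toric manifolds *)

Definition integral_vector (R : realType) n (t : 'rV[R]_n) : Prop :=
  forall j, t 0 j \is a Num.int.

Section Toric.
Variables (R : realType) (n d : nat) (M : mfd R d) (w : form2 M).

(* An action of T^n = R^n / Z^n is an action of R^n that is trivial on Z^n. *)
Definition torus_action (rho : 'rV[R]_n -> M -> M) : Prop :=
  [/\ forall p, rho 0 p = p,
      forall s t p, rho (s + t) p = rho s (rho t p),
      forall t, integral_vector t -> forall p, rho t p = p &
      smooth_map (fun tp : prod_mfd (euclid R n) M => rho tp.1 tp.2)].

Definition effective_action (rho : 'rV[R]_n -> M -> M) : Prop :=
  forall t, (forall p, rho t p = p) -> integral_vector t.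

(* The vector at p of the infinitesimal action of xi, in the chart i. *)
Definition generator (rho : 'rV[R]_n -> M -> M) (xi : 'rV[R]_n)
    (i : chart_index M) (p : M) : 'rV[R]_d :=
  'D_xi (fun t => cmap (chart_at i) (rho t p)) 0.

(* d<mu, xi> = w(X_xi, -). Without a factor 2 pi, since exp has kernel Z^n: a
   2-sphere whose moment image has length l has area l. The opposite sign
   convention amounts to replacing rho t by rho (- t). *)
Definition moment_map (rho : 'rV[R]_n -> M -> M) (mu : M -> 'rV[R]_n) : Prop :=
  [/\ @smooth_map R d n M (euclid R n) mu,
      forall t p, mu (rho t p) = mu p &
      forall i p, cdom (chart_at i) p -> forall xi v,
        'D_v (fun x => (mu (cinv (chart_at i) x) *m xi^T) 0 0)
             (cmap (chart_at i) p)
        = bform (w i (cmap (chart_at i) p)) (generator rho xi i p) v].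

End Toric.

(* (M, w) is the symplectic toric manifold of the Delzant polytope P: by
   Delzant's theorem these properties determine it uniquely. *)
Definition symplectic_toric_manifold (R : realType) n (P : set 'rV[R]_n)
    (M : mfd R (n + n)) (w : form2 M) : Prop :=
  [/\ symplectic_form w, compact [set: M], connected [set: M] &
      exists (rho : 'rV[R]_n -> M -> M) (mu : M -> 'rV[R]_n),
        [/\ torus_action rho, forall t, pulls_back (rho t) w w,
            effective_action rho, moment_map w rho mu & range mu = P]].

(* Main.v *)
(** Restrict f to M_G x {0} and let psi be its R^(2k+2m)-component.  Then
    w_G - psi^* w_std is the pullback of w_H along a map into a manifold of
    smaller dimension 2h < 2g, so its g-th power vanishes.  But w_G differs from
    it by sums of dx /\ dy with x, y functions on M_G, so w_G^g is exact, which
    is impossible on the compact M_G since w_G^g is a volume form.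

    No integral over a manifold is needed: "the integral of F is zero" means that
    the Riemann sums of F over finer and finer cubic lattices tend to 0.  For
    compactly supported F this holds if F is a partial derivative, fails if F >= 0
    is not 0, and is compatible with changes of variables: a local diffeomorphism
    is deformed to its linearization, and an invertible matrix, through its LU
    decomposition, to symmetries of the lattice. *)

From HB Require Import structures.
From mathcomp Require Import all_boot all_order all_algebra all_fingroup.
From mathcomp Require Import all_classical all_reals all_analysis.
From mathcomp Require Import ring lra.
Require Import Defs.

Set Implicit Arguments.
Unset Strict Implicit.
Unset Printing Implicit Defensive.

Import Order.TTheory GRing.Theory Num.Theory.
Import numFieldNormedType.Exports.

Local Open Scope classical_set_scope.
Local Open Scope ring_scope.

(** * Functions of class C^k *)

(** Let a be the difference of the form of M_G and the pulled-back standard form, and w the form of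
    M_G. Then w^g - a^g telescopes into terms w^i /\ (dx /\ dy) /\ a^(g-1-i). Charts come with no
    orientation, so a top-degree form is integrated only through its quotient by w^g, a genuine
    function on M_G, against the absolute value of the volume coefficient. A cutoff rho is put
    inside the differential, dx /\ d(rho y): the pieces remain exact, they still add up to dx /\ dy
    because the rho add up to 1, and each lives in a single chart, where it is a divergence. The
    quotients add up to the constant 1, whose integral cannot vanish. Class C^2 suffices for x, y
    and rho, so piecewise cubic cutoffs replace the usual exponential ones. Lattice sums are only
    ever asked to tend to 0: no limit of a general lattice sum is shown to exist, and equality of
    two integrals is expressed by nullity of a difference. *)

Section CkGeneral.
Variables (R : realType) (V W : normedModType R).
Implicit Types (f g : V -> W) (U : set V).

Lemma Ck_continuous k U f x : Ck k U f -> U x -> {for x, continuous f}.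
Proof. by case: k => [|k] [+ _] => /[apply]. Qed.
Arguments Ck_continuous [k U f x] _ _.

Lemma Ck_derivable k U f x v : Ck k.+1 U f -> U x -> derivable f x v.
Proof. by move=> [_ /(_ v)[+ _]] => /[apply]. Qed.
Arguments Ck_derivable [k U f x] v _ _.

Lemma Ck_derive k U f v : Ck k.+1 U f -> Ck k U ('D_v f).
Proof. by move=> [_ /(_ v)[]]. Qed.

Lemma CkW k U f : Ck k.+1 U f -> Ck k U f.
Proof.
elim: k f => [|k IH] f [cf df]; first by split.
by split=> // v; have [? ?] := df v; split=> //; exact: IH.
Qed.

(** [Ck] requires continuity and derivability in the ambient space at each point of the set, so it
    is a pointwise condition and glues along arbitrary sets. *)
Lemma Ck_local k U f :
  (forall x, U x -> exists2 A, A x & Ck k A f) -> Ck k U f.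
Proof.
elim: k f => [|k IH] f H.
  by split=> // x /H [A Ax [cf _]]; exact: cf.
split=> [x /H [A Ax [cf _]]|v]; first exact: cf.
split=> [x /H [A Ax] CA|]; first exact: Ck_derivable CA Ax.
by apply: IH => x /H [A Ax] CA; exists A => //; exact: Ck_derive.
Qed.

Lemma Ck_sub k U O f : O `<=` U -> Ck k U f -> Ck k O f.
Proof. by move=> OU CU; apply: Ck_local => x /OU Ux; exists U. Qed.

Lemma near_open U (P : V -> Prop) x :
  open U -> U x -> (forall y, U y -> P y) -> \forall y \near x, P y.
Proof.
move=> oU Ux H; apply: filterS (open_nbhs_nbhs _); first exact: H.
by split.
Qed.

Lemma Ck_eq k U f g : open U -> (forall x, U x -> f x = g x) ->
  Ck k U f -> Ck k U g.
Proof.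
move=> oU; elim: k f g => [|k IH] f g fg [cf df].
  split=> // x Ux; rewrite /prop_for/continuous_at -fg //.
  by apply: cvg_trans (cf _ Ux); apply: near_eq_cvg; exact: near_open oU Ux _.
split=> [x Ux|v].
  rewrite /prop_for/continuous_at -fg //.
  by apply: cvg_trans (cf _ Ux); apply: near_eq_cvg; exact: near_open oU Ux _.
have [dfv Cfv] := df v; split.
  move=> x Ux; apply: near_eq_derivable (dfv x Ux).
  exact: near_open oU Ux _.
apply: IH Cfv => x Ux; apply: near_eq_derive; exact: near_open oU Ux _.
Qed.

Lemma Ck_cst k U (a : W) : Ck k U (fun=> a).
Proof.
elim: k a => [|k IH] a; first by split => // x _; exact: cvg_cst.
split=> [x _|v]; first exact: cvg_cst.
split=> [x _|]; first exact: derivable_cst.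
rewrite (_ : 'D_v _ = fun=> 0); first exact: IH.
by apply/funext => x; rewrite derive_cst.
Qed.

Lemma Ck_add k U f g : open U -> Ck k U f -> Ck k U g ->
  Ck k U (fun x => f x + g x).
Proof.
move=> oU; elim: k f g => [|k IH] f g Cf Cg.
  split=> // x Ux; apply: cvgD; [exact: (Ck_continuous Cf Ux)|exact: (Ck_continuous Cg Ux)].
split=> [x Ux|v].
  apply: cvgD; [exact: (Ck_continuous Cf Ux)|exact: (Ck_continuous Cg Ux)].
split=> [x Ux|].
  by apply: (@derivableD _ _ _ f g); [exact: (Ck_derivable _ Cf Ux)|
    exact: (Ck_derivable _ Cg Ux)].
apply: (Ck_eq oU) (IH _ _ (Ck_derive v Cf) (Ck_derive v Cg)) => x Ux.
by rewrite (@deriveD _ _ _ f g)//; [exact: (Ck_derivable _ Cf Ux)|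
    exact: (Ck_derivable _ Cg Ux)].
Qed.

Lemma Ck_sum k U (I : Type) (r : seq I) (P : pred I) (f : I -> V -> W) :
  open U -> (forall i, P i -> Ck k U (f i)) ->
  Ck k U (fun x => \sum_(i <- r | P i) f i x).
Proof.
move=> oU H; elim: r => [|i r IH].
  by apply: (Ck_eq oU) (Ck_cst k U 0) => x _; rewrite big_nil.
apply: (Ck_eq (f := fun x => (if P i then f i x else 0) +
    \sum_(j <- r | P j) f j x) oU).
  by move=> x _; rewrite big_cons; case: (P i); rewrite ?add0r.
by apply: Ck_add => //; case: (boolP (P i)) => [/H//|_]; exact: Ck_cst.
Qed.

Lemma Ck_scale k U (a : R) f : open U -> Ck k U f -> Ck k U (fun x => a *: f x).
Proof.
move=> oU; elim: k f => [|k IH] f Cf.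
  split=> // x Ux; apply: (cvgZl_tmp (k := a)); exact: (Ck_continuous Cf Ux).
split=> [x Ux|v]; first by apply: (cvgZl_tmp (k := a)); exact: (Ck_continuous Cf Ux).
split=> [x Ux|]; first by apply: (@derivableZ _ _ _ f); exact: (Ck_derivable _ Cf Ux).
apply: (Ck_eq oU) (IH _ (Ck_derive v Cf)) => x Ux.
by rewrite (@deriveZ _ _ _ f)//; exact: (Ck_derivable _ Cf Ux).
Qed.

End CkGeneral.
Arguments Ck_continuous [R V W k U f x] _ _.
Arguments Ck_derivable [R V W k U f x] v _ _.

Section CkScalar.
Variables (R : realType) (V : normedModType R).
Implicit Types (f g : V -> R) (U : set V).

Lemma Ck_opp k U f : open U -> Ck k U f -> Ck k U (fun x => - f x).
Proof.
move=> oU Cf; apply: (Ck_eq oU) (Ck_scale (-1) oU Cf) => x _.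
by rewrite scaleN1r.
Qed.

Lemma Ck_sub_fun k U f g : open U -> Ck k U f -> Ck k U g ->
  Ck k U (fun x => f x - g x).
Proof. by move=> oU Cf Cg; apply: Ck_add => //; exact: Ck_opp. Qed.

Lemma Ck_mul k U f g : open U -> Ck k U f -> Ck k U g ->
  Ck k U (fun x => f x * g x).
Proof.
move=> oU; elim: k f g => [|k IH] f g Cf Cg.
  split=> // x Ux; apply: cvgM; [exact: (Ck_continuous Cf Ux)|exact: (Ck_continuous Cg Ux)].
split=> [x Ux|v].
  apply: cvgM; [exact: (Ck_continuous Cf Ux)|exact: (Ck_continuous Cg Ux)].
split=> [x Ux|].
  by apply: (@derivableM _ _ f g); [exact: (Ck_derivable _ Cf Ux)|
    exact: (Ck_derivable _ Cg Ux)].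
apply: (Ck_eq (W := R) (f := fun x => f x * 'D_v g x + g x * 'D_v f x) oU).
  move=> x Ux; rewrite [in RHS](@deriveM _ _ f g)//; [exact: (Ck_derivable _ Cf Ux)|
    exact: (Ck_derivable _ Cg Ux)].
apply: Ck_add => //; apply: IH; try exact: CkW; exact: Ck_derive.
Qed.

Lemma Ck_prod k U (I : Type) (r : seq I) (P : pred I) (f : I -> V -> R) :
  open U -> (forall i, P i -> Ck k U (f i)) ->
  Ck k U (fun x => \prod_(i <- r | P i) f i x).
Proof.
move=> oU H; elim: r => [|i r IH].
  by apply: (Ck_eq (W := R) (f := fun=> 1 : R) oU) => [x _|]; rewrite ?big_nil//; exact: Ck_cst.
apply: (Ck_eq (W := R) (f := fun x => (if P i then f i x else 1) *
    \prod_(j <- r | P j) f j x) oU).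
  by move=> x _; rewrite big_cons; case: (P i); rewrite ?mul1r.
by apply: Ck_mul => //; case: (boolP (P i)) => [/H//|_]; exact: Ck_cst.
Qed.

Lemma Ck_inv k U f : open U -> (forall x, U x -> f x != 0) -> Ck k U f ->
  Ck k U (fun x => (f x)^-1).
Proof.
move=> oU f0; elim: k => [|k IH] Cf.
  by split=> // x Ux; apply: cvgV; [exact: f0|exact: (Ck_continuous Cf Ux)].
split=> [x Ux|v].
  by apply: cvgV; [exact: f0|exact: (Ck_continuous Cf Ux)].
split=> [x Ux|]; first by apply: (@derivableV _ _ f); [exact: f0|exact: (Ck_derivable _ Cf Ux)].
have CV := IH (CkW Cf).
apply: (Ck_eq (W := R) (f := fun x => (-1) *: ((f x)^-1 * (f x)^-1 * 'D_v f x)) oU).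
  move=> x Ux; rewrite [in RHS](@deriveV _ _ f)//; [|exact: f0|exact: (Ck_derivable _ Cf Ux)].
  by rewrite -exprVn expr2 scaleNr scale1r scaleNr.
apply: Ck_scale => //; apply: Ck_mul => //; first exact: Ck_mul.
exact: Ck_derive.
Qed.

End CkScalar.

(** * Linear maps and matrix coordinates *)

Section Linear.
Variables (R : realType) (m n : nat).

Lemma mx_norm_coord_le (x : 'M[R]_(m, n)) i j : `|x i j| <= `|x|.
Proof.
rewrite [leRHS]/Num.Def.normr /= mx_normrE.
by apply: (le_bigmax _ (fun ij => `|x ij.1 ij.2|) (i, j)).
Qed.

Lemma mx_norm_le (x : 'M[R]_(m, n)) e : 0 <= e ->
  (forall i j, `|x i j| <= e) -> `|x| <= e.
Proof.
move=> e0 H; rewrite [leLHS]/Num.Def.normr /= mx_normrE.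
by apply: bigmax_le => // -[i j] _; exact: H.
Qed.

Lemma mx_norm_lt (x : 'M[R]_(m, n)) e : 0 < e ->
  (forall i j, `|x i j| < e) -> `|x| < e.
Proof.
move=> e0 H; rewrite [ltLHS]/Num.Def.normr /= mx_normrE.
by apply: bigmax_lt => // -[i j] _; exact: H.
Qed.

Lemma Ck_linear (V W : normedModType R) k U (f : {linear V -> W}) :
  continuous f -> Ck k U f.
Proof.
move=> cf; case: k => [|k]; first by split=> // x _; exact: cf.
split=> [x _|v]; first exact: cf.
have df x : differentiable f x by exact: linear_differentiable.
split=> [x _|]; first exact: diff_derivable.
rewrite (_ : 'D_v f = fun=> f v); first exact: Ck_cst.
by apply/funext => x; rewrite deriveE// diff_lin.
Qed.

End Linear.

Section Coord.
Variables (R : realType) (m n : nat).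

Lemma Ck_coord k U (i : 'I_m) (j : 'I_n) :
  Ck k U (fun x : 'M[R]_(m, n) => x i j).
Proof.
pose f : 'M[R]_(m, n) -> R := fun x => x i j.
have lf : linear f by move=> a x y; rewrite /f !mxE.
pose fL := GRing.isLinear.Build _ _ _ _ f lf.
pose g : {linear 'M[R]_(m, n) -> R} := HB.pack f fL.
exact: (@Ck_linear _ _ _ k U g (@coord_continuous _ _ _ i j)).
Qed.

Variable V : normedModType R.

Lemma cvg_mxP (F : set_system V) (FF : Filter F) (f : V -> 'M[R]_(m, n)) (l : 'M[R]_(m, n)) :
  (f @ F --> l) <-> (forall i j, (fun x => f x i j) @ F --> l i j).
Proof.
split=> [fl i j|H].
  apply: (cvg_comp f (fun M : 'M[R]_(m, n) => M i j) fl).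
  exact: coord_continuous.
apply/cvgrPdist_lt => e e0.
have : \forall x \near F, forall ij : 'I_m * 'I_n, `|l ij.1 ij.2 - f x ij.1 ij.2| < e.
  by apply: filter_forall => -[i j]; exact: ((cvgrPdist_lt _ _).1 (H i j)).
apply: filterS => x Hx; apply: mx_norm_lt => // i j.
by rewrite !mxE; exact: (Hx (i, j)).
Qed.

Lemma Ck_mxP k (U : set V) (f : V -> 'M[R]_(m, n)) : open U ->
  Ck k U f <-> (forall i j, Ck k U (fun x => f x i j)).
Proof.
move=> oU; elim: k f => [|k IH] f; split.
- by move=> [cf _] i j; split=> // x Ux; exact: (cvg_mxP _ _ _).1 (cf x Ux) i j.
- move=> H; split=> // x Ux; apply/cvg_mxP => i j.
  by have [+ _] := H i j; apply.
- move=> Cf i j; split=> [x Ux|v].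
    exact: ((cvg_mxP _ _ _).1 (Ck_continuous Cf Ux) i j).
  have dm x : U x -> derivable f x v by move=> Ux; exact: Ck_derivable Cf Ux.
  split=> [x Ux|]; first exact: ((derivable_mxP _ _ _).1 (dm x Ux) i j).
  apply: (Ck_eq oU) ((IH _).1 (Ck_derive v Cf) i j) => x Ux.
  by rewrite derive_mx ?mxE//; exact: dm.
- move=> H; split=> [x Ux|v].
    by apply/cvg_mxP => i j; exact: (Ck_continuous (H i j) Ux).
  have dm x : U x -> derivable f x v.
    by move=> Ux; apply/derivable_mxP => i j; exact: (Ck_derivable _ (H i j) Ux).
  split=> //; apply/IH => i j.
  apply: (Ck_eq oU) (Ck_derive v (H i j)) => x Ux.
  by rewrite derive_mx ?mxE//; exact: dm.
Qed.

End Coord.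

(** * Differentiability and the chain rule *)

Lemma differentiable_estimate (R : realType) (V W : normedModType R)
    (f : V -> W) (g : {linear V -> W}) x : continuous g ->
  (forall e : R, 0 < e ->
    \forall h \near (0 : V), `|f (x + h) - f x - g h| <= e * `|h|) ->
  differentiable f x /\ 'd f x = g :> (V -> W).
Proof.
move=> cg H.
have E : f \o shift x = cst (f x) + g +o_ 0 id.
  apply/eqaddoP => e e0; near=> h => /=.
  rewrite -![(_ + _ : _ -> _) _]/(_ + _) -![(- _ : _ -> _) _]/(- _) /=.
  rewrite opprD addrA [h + x]addrC; near: h.
  exact: H.
have dE := diff_unique cg E.
by split=> //; apply/diff_locallyP; rewrite dE.
Unshelve. all: by end_near. Qed.

Section MeanValue.
Variables (R : realType) (V : normedModType R).
Implicit Type f : V -> R.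

Lemma derive_along f x v (t : R) : derivable f (x + t *: v) v ->
  is_derive t 1 (fun s : R => f (x + s *: v)) ('D_v f (x + t *: v)).
Proof.
have E : (fun h : R => h^-1 *: (((fun s : R => f (x + s *: v)) \o shift t) (h *: 1) -
      f (x + t *: v)))
    = (fun h : R => h^-1 *: ((f \o shift (x + t *: v)) (h *: v) - f (x + t *: v))).
  apply/funext => h /=; congr (_ *: (f _ - _)).
  by rewrite [h *: 1]mulr1 scalerDl addrCA.
by move=> df; apply: DeriveDef; rewrite /derivable /derive E.
Qed.

Lemma partial_MVT f x v (a : R) :
  (forall t : R, `|t| <= `|a| -> derivable f (x + t *: v) v) ->
  exists2 c, `|c| <= `|a| & f (x + a *: v) - f x = a * 'D_v f (x + c *: v).
Proof.
move=> df; pose g s := f (x + s *: v).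
have dg (t : R) : `|t| <= `|a| -> is_derive t 1 g ('D_v f (x + t *: v)).
  by move=> /df; exact: derive_along.
have cg (t : R) : `|t| <= `|a| -> {for t, continuous g}.
  by move=> /dg dgt; apply: differentiable_continuous; apply/derivable1_diffP.
have [a0|a0] := leP 0 a.
  have le (t : R) : t \in `[0, a] -> `|t| <= `|a|.
    by rewrite in_itv/= => /andP[t0 ta]; rewrite !ger0_norm.
  have [||c c0a E] := @MVT_segment R g (fun t => 'D_v f (x + t *: v)) 0 a a0.
  - by move=> t /subset_itv_oo_cc /le /dg.
  - by apply: continuous_in_subspaceT => t /[!inE]/= /le /cg.
  - exists c; first exact: le.
    by move: E; rewrite /g scale0r addr0 subr0 mulrC.
have le (t : R) : t \in `[a, 0] -> `|t| <= `|a|.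
  rewrite in_itv/= => /andP[t0 ta].
  by rewrite !ler0_norm// ?lerN2// ltW.
have [||c c0a E] := @MVT_segment R g (fun t => 'D_v f (x + t *: v)) a 0 (ltW a0).
- by move=> t /subset_itv_oo_cc /le /dg.
- by apply: continuous_in_subspaceT => t /[!inE]/= /le /cg.
- exists c; first exact: le.
  by move: E; rewrite /g scale0r addr0 sub0r mulrN => E; rewrite -opprB E opprK mulrC.
Qed.

End MeanValue.

Section Differentiability.
Variables (R : realType) (n : nat).
Implicit Types (f : 'rV[R]_n -> R) (U : set 'rV[R]_n) (x h v : 'rV[R]_n).

Local Notation e_ i := (delta_mx 0 i : 'rV[R]_n).

Definition grad f x : 'rV[R]_n := \row_i 'D_(e_ i) f x.

Lemma dotE (u v : 'rV[R]_n) : (u *m v^T) 0 0 = \sum_i u 0 i * v 0 i.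
Proof. by rewrite mxE; apply: eq_bigr => i _; rewrite mxE. Qed.

(** The point x + h is reached from x along the coordinate directions, one at a time, through the
    corners x + [hk k]; the mean value theorem applies to each step, and continuity of the partial
    derivatives bounds each error. *)
Lemma C1_estimate U f x : open U -> Ck 1 U f -> U x ->
  forall e : R, 0 < e -> \forall h \near (0 : 'rV[R]_n),
    `|f (x + h) - f x - (h *m (grad f x)^T) 0 0| <= e * `|h|.
Proof.
move=> oU Cf Ux e e0.
(* Each of the n steps contributes at most e' |h|; the extra 1 keeps the denominator positive when n
   = 0. *)
pose e' := e / (n%:R + 1).
have n1 : 0 < n%:R + 1 :> R by rewrite ltr_wpDl.
have e'0 : 0 < e' by rewrite divr_gt0.
have : \forall y \near x, U y /\
    forall i : 'I_n, `|'D_(e_ i) f x - 'D_(e_ i) f y| < e'.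
  near=> y; split; first by near: y; apply: open_nbhs_nbhs; split.
  near: y; apply: filter_forall => i.
  have := Ck_continuous (Ck_derive (e_ i) Cf) Ux.
  by move/cvgrPdist_lt => /(_ e' e'0).
rewrite -nbhs_nearE => /nbhs_ballP[d /= d0 Hd].
apply/nbhs_ballP; exists d => //= h; rewrite -ball_normE/= sub0r normrN => hd.
have bx z : `|z| < d -> ball x d (x + z).
  by rewrite -ball_normE/= opprD addrA subrr sub0r normrN.
pose hk k : 'rV[R]_n := \row_j (if (j < k)%N then h 0 j else 0).
have hk0 : hk 0%N = 0 by apply/rowP => j; rewrite !mxE.
have hkn : hk n = h by apply/rowP => j; rewrite !mxE ltn_ord.
have hkS (k : 'I_n) : hk k.+1 = hk k + h 0 k *: e_ k.
  apply/rowP => j; rewrite !mxE ltnS eqxx/=.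
  case: (ltngtP j k) => [jk|jk|/val_inj ->]; rewrite ?eqxx ?mulr1 ?add0r//.
    by rewrite (negPf (_ : j != k)) ?mulr0 ?addr0// -val_eqE neq_ltn jk.
  by rewrite (negPf (_ : j != k)) ?mulr0 ?addr0// -val_eqE neq_ltn jk orbT.
have near_x k (c : R) : `|c| <= `|h 0 k| -> `|hk k + c *: e_ k| < d.
  move=> ch; apply: le_lt_trans hd; apply: mx_norm_le => // i j.
  rewrite !mxE (ord1 i) eqxx/=; case: (ltngtP j k) => [jk|jk|/val_inj ->].
  - by rewrite (negPf (_ : j != k)) ?mulr0 ?addr0 ?mx_norm_coord_le// -val_eqE neq_ltn jk.
  - by rewrite (negPf (_ : j != k)) ?mulr0 ?addr0 ?normr0// -val_eqE neq_ltn jk orbT.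
  - by rewrite eqxx mulr1 add0r (le_trans ch)// mx_norm_coord_le.
have -> : f (x + h) - f x = \sum_(k < n) (f (x + hk k.+1) - f (x + hk k)).
  rewrite -(big_mkord xpredT (fun k => f (x + hk k.+1) - f (x + hk k))).
  by rewrite telescope_sumr// hkn hk0 addr0.
rewrite dotE -sumrB; apply: le_trans (ler_norm_sum _ _ _) _.
have -> : e * `|h| = e' * `|h| *+ n + e' * `|h|.
  by rewrite -mulrSr -mulr_natr -natr1 /e'; field; rewrite gt_eqF.
rewrite ler_wpDr ?(mulr_ge0 (ltW e'0))//.
have -> : e' * `|h| *+ n = \sum_(k < n) e' * `|h| by rewrite sumr_const card_ord.
apply: ler_sum => k _.
have [|c ch E] := @partial_MVT R _ f (x + hk k) (e_ k) (h 0 k).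
  move=> t th; apply: (Ck_derivable _ Cf).
  have [|//] := Hd (x + hk k + t *: e_ k).
  by rewrite -addrA; apply/bx/near_x.
rewrite hkS addrA E mxE -mulrBr normrM mulrC ler_pM//; last exact: mx_norm_coord_le.
have [|_ /(_ k)/ltW] := Hd (x + hk k + c *: e_ k).
  by rewrite -addrA; apply/bx/near_x.
by rewrite distrC.
Unshelve. all: by end_near. Qed.

Lemma dot_linear (u : 'rV[R]_n) : linear (fun h => (h *m u^T) 0 0).
Proof. by move=> a x y; rewrite mulmxDl -scalemxAl !mxE. Qed.

Lemma dot_continuous (u : 'rV[R]_n) : continuous (fun h => (h *m u^T) 0 0).
Proof.
rewrite (_ : (fun h => _) = fun h => \sum_i h 0 i * u 0 i); last first.
  by apply/funext => h; rewrite dotE.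
suff [+ _] : Ck 0 setT (fun h : 'rV[R]_n => \sum_i h 0 i * u 0 i).
  by move=> H h; exact: H.
by apply: Ck_sum => [|i _]; [exact: openT|apply: Ck_mul; [exact: openT|exact: Ck_coord|exact: Ck_cst]].
Qed.

(** [Ck] only speaks of directional derivatives, whereas composition needs a total derivative; the
    estimate supplies it, and with it the linearity of ['D_v f x] in v. *)
Lemma C1_differentiable U f x : open U -> Ck 1 U f -> U x ->
  differentiable f x /\ (forall v, 'D_v f x = (v *m (grad f x)^T) 0 0).
Proof.
move=> oU Cf Ux.
pose L := GRing.isLinear.Build _ _ _ _ (fun h => (h *m (grad f x)^T) 0 0) (dot_linear (grad f x)).
pose g : {linear 'rV[R]_n -> R} := HB.pack (fun h => (h *m (grad f x)^T) 0 0) L.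
have cg : continuous g by exact: dot_continuous.
have [df dE] := differentiable_estimate cg (C1_estimate oU Cf Ux).
by split=> // v; rewrite deriveE// dE.
Qed.

End Differentiability.

Section ChainRule.
Variables (R : realType).

(** G is only derivable along v, so the chain rule is applied to the curve [h |-> G (h *: v + x)] at
    0, for which derivability is differentiability. *)
Lemma derive_comp (V W W' : normedModType R) (F : W -> W') (G : V -> W) x v :
  differentiable F (G x) -> derivable G x v ->
  derivable (F \o G) x v /\ 'D_v (F \o G) x = 'd F (G x) ('D_v G x).
Proof.
move=> dF dG.
pose g (h : R) := G (h *: v + x).
have g0 : g 0 = G x by rewrite /g scale0r add0r.
have dg : differentiable g 0 by apply/derivable1_diffP; exact: (derivable1P _ _ _).1 dG.
have dFg : differentiable F (g 0) by rewrite g0.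
have dFG : differentiable (F \o g) 0 by exact: differentiable_comp.
have Dg (W0 : normedModType R) (k : V -> W0) : 'D_1 (fun h : R => k (h *: v + x)) 0 = 'D_v k x.
  rewrite /derive; set g1 := fun h => h^-1 *: _; set g2 := fun h => h^-1 *: _.
  suff -> : g1 = g2 by [].
  by apply/funext => h; rewrite /g1 /g2 /= addr0 scale0r add0r [h *: 1]mulr1.
split; first by apply/(derivable1P (F \o G) x v).2/derivable1_diffP.
rewrite -Dg -[LHS]/('D_1 (F \o g) 0) deriveE// diff_comp// /= g0; congr ('d F _ _).
by rewrite -Dg deriveE.
Qed.

(** Induction on k: the derivative along v is the sum over j of the derivative of G_j times the j-th
    partial derivative of F composed with G, and the latter is covered by the induction
    hypothesis. *)
Lemma Ck_comp (V : normedModType R) m k (O : set 'rV[R]_m) (U : set V)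
    (F : 'rV[R]_m -> R) (G : V -> 'rV[R]_m) :
  open O -> open U -> (forall x, U x -> O (G x)) ->
  Ck k O F -> Ck k U G -> Ck k U (F \o G).
Proof.
move=> oO oU OG; elim: k F => [|k IH] F CF CG.
  split=> // x Ux; apply: continuous_comp (Ck_continuous CG Ux) _.
  exact: (Ck_continuous CF (OG _ Ux)).
have C1 j (f : 'rV[R]_m -> R) : Ck j.+1 O f -> Ck 1 O f.
  by elim: j f => // j IHj f /CkW/IHj.
have [cG dG] := CG.
have dF x : U x -> differentiable F (G x) /\ forall v,
    'D_v F (G x) = (v *m (grad F (G x))^T) 0 0.
  by move=> Ux; apply: C1_differentiable oO (C1 _ _ CF) (OG _ Ux).
split=> [x Ux|v].
  apply: continuous_comp (Ck_continuous CG Ux) _.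
  exact: (Ck_continuous CF (OG _ Ux)).
have [dGv CGv] := dG v.
split=> [x Ux|]; first exact: (derive_comp (dF x Ux).1 (dGv x Ux)).1.
apply: (Ck_eq (W := R) (f := fun x => \sum_j 'D_v G x 0 j *
    ('D_(delta_mx 0 j) F \o G) x) oU).
  move=> x Ux; rewrite (derive_comp (dF x Ux).1 (dGv x Ux)).2.
  rewrite -deriveE ?(dF x Ux).2 ?dotE; last exact: (dF x Ux).1.
  by apply: eq_bigr => j _; rewrite mxE.
apply: Ck_sum => // j _; apply: Ck_mul => //.
  exact: (Ck_mxP _ _ oU).1 CGv 0 j.
by apply: IH; [exact: Ck_derive|exact: CkW].
Qed.

Lemma derive_comp_C1 (V : normedModType R) m (O : set 'rV[R]_m) (U : set V)
    (F : 'rV[R]_m -> R) (G : V -> 'rV[R]_m) x v :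
  open O -> open U -> (forall x, U x -> O (G x)) ->
  Ck 1 O F -> Ck 1 U G -> U x ->
  'D_v (F \o G) x = ('D_v G x *m (grad F (G x))^T) 0 0.
Proof.
move=> oO oU OG CF CG Ux.
have [dF DF] := C1_differentiable oO CF (OG _ Ux).
by rewrite (derive_comp dF (Ck_derivable v CG Ux)).2 -deriveE.
Qed.

End ChainRule.

(** * Symmetry of second derivatives *)

Lemma no_half_way (R : realFieldType) (a b p q : R) : p = q ->
  `|a - p| < `|a - b| / 2 -> `|b - q| < `|a - b| / 2 -> False.
Proof.
move=> -> A B; have := ltrD A B; rewrite -splitr ltNge => /negP; apply.
by rewrite [`|b - q|]distrC -(subrKA q) ler_normD.
Qed.

Section Schwarz.
Variables (R : realType) (V : normedModType R).
Implicit Types (f : V -> R) (U : set V).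

Lemma derive_shift_arg f w x v :
  derivable f (x + w) v ->
  derivable (fun y => f (y + w)) x v /\
  'D_v (fun y => f (y + w)) x = 'D_v f (x + w).
Proof.
have E : (fun h : R => h^-1 *: (((fun y => f (y + w)) \o shift x) (h *: v) - f (x + w)))
    = (fun h => h^-1 *: ((f \o shift (x + w)) (h *: v) - f (x + w))).
  by apply/funext => h /=; rewrite addrA.
by rewrite /derivable/derive E.
Qed.

(** The mean value theorem is applied in the direction u to the increment [phi], then in the
    direction v to ['D_u f]. *)
Lemma second_difference U f x u v (h : R) : 0 <= h -> Ck 2 U f ->
  (forall s t : R, `|s| <= h -> `|t| <= h -> U (x + s *: u + t *: v)) ->
  exists s t : R, [/\ `|s| <= h, `|t| <= h &
    f (x + h *: u + h *: v) - f (x + h *: u) - (f (x + h *: v) - f x) =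
    h * (h * 'D_v ('D_u f) (x + s *: u + t *: v))].
Proof.
move=> h0 Cf HU; have hh : `|h| = h by rewrite ger0_norm.
have U0 (s : R) : `|s| <= h -> U (x + s *: u).
  by move=> sh; have := HU s 0 sh; rewrite scale0r addr0 normr0; exact.
pose phi y := f (y + h *: v) - f y.
have dphi (s : R) : `|s| <= h -> derivable phi (x + s *: u) u /\
    'D_u phi (x + s *: u) = 'D_u f (x + s *: u + h *: v) - 'D_u f (x + s *: u).
  move=> sh.
  have [d1 D1] : derivable (fun y => f (y + h *: v)) (x + s *: u) u /\
      'D_u (fun y => f (y + h *: v)) (x + s *: u) = 'D_u f (x + s *: u + h *: v).
    by apply: derive_shift_arg; apply: (Ck_derivable _ Cf); apply: HU; rewrite ?hh.
  have d2 : derivable f (x + s *: u) u by apply: (Ck_derivable _ Cf); exact: U0.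
  by split; [exact: (derivableB d1 d2)|rewrite -D1; exact: (deriveB d1 d2)].
have [|s sh E] := @partial_MVT R V phi x u h.
  by move=> t; rewrite hh => /dphi[].
rewrite hh in sh.
have [|t th E'] := @partial_MVT R V ('D_u f) (x + s *: u) v h.
  by move=> t; rewrite hh => th; apply: (Ck_derivable _ (Ck_derive u Cf)); exact: HU.
exists s, t; rewrite hh in th; split=> //.
rewrite -E' -(dphi s sh).2 -E /phi.
by rewrite !opprB; ring.
Qed.

(** The second difference over a small parallelogram is symmetric in u and v, so the two mixed
    derivatives take a common value, possibly at two different points, arbitrarily close to x. By
    continuity they cannot differ at x. *)
Lemma derive_comm U f x u v : open U -> Ck 2 U f -> U x ->
  'D_v ('D_u f) x = 'D_u ('D_v f) x.
Proof.
move=> oU Cf Ux; apply/eqP; rewrite -subr_eq0 -normr_le0 leNgt; apply/negP.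
set d := `|_| => d0.
have d20 : 0 < d / 2 by rewrite divr_gt0.
have A : \forall y \near x, U y by apply: open_nbhs_nbhs; split.
have /cvgrPdist_lt/(_ _ d20) B := Ck_continuous (Ck_derive v (Ck_derive u Cf)) Ux.
have /cvgrPdist_lt/(_ _ d20) C := Ck_continuous (Ck_derive u (Ck_derive v Cf)) Ux.
have /nbhs_ballP[r /= r0 Hr] : nbhs x (U `&`
    ([set y | `|'D_v ('D_u f) x - 'D_v ('D_u f) y| < d / 2] `&`
     [set y | `|'D_u ('D_v f) x - 'D_u ('D_v f) y| < d / 2])).
  by apply: filterI; [exact: A|apply: filterI; [exact: B|exact: C]].
(* This step keeps the parallelograms in the ball of radius r; the summand 1 covers u = v = 0. *)
pose h := r / (`|u| + `|v| + 1).
have n0 : 0 < `|u| + `|v| + 1 by rewrite ltr_wpDl// addr_ge0.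
have h0 : 0 < h by rewrite divr_gt0.
have br (s t : R) : `|s| <= h -> `|t| <= h -> ball x r (x + s *: u + t *: v).
  move=> sh th; rewrite -ball_normE/= -addrA opprD addrA subrr sub0r normrN.
  apply: le_lt_trans (ler_normD _ _) _; rewrite !normrZ.
  apply: (@le_lt_trans _ _ (h * `|u| + h * `|v|)).
    by apply: lerD; exact: ler_wpM2r.
  rewrite -mulrDr /h -mulrA -[ltRHS]mulr1 ltr_pM2l// mulrC ltr_pdivrMr// mul1r.
  by rewrite ltrDl.
have HU (s t : R) : `|s| <= h -> `|t| <= h -> U (x + s *: u + t *: v).
  by move=> sh th; have [] := Hr _ (br s t sh th).
have HU' (s t : R) : `|s| <= h -> `|t| <= h -> U (x + s *: v + t *: u).
  by move=> sh th; rewrite addrAC; exact: HU.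
have [s [t [sh th E]]] := second_difference (ltW h0) Cf HU.
have [s' [t' [sh' th' E']]] := second_difference (ltW h0) Cf HU'.
have EE : 'D_v ('D_u f) (x + s *: u + t *: v) = 'D_u ('D_v f) (x + s' *: v + t' *: u).
  apply: (mulfI (lt0r_neq0 h0)); apply: (mulfI (lt0r_neq0 h0)).
  apply: (etrans (esym E)); apply: (etrans _ E').
  have -> : x + h *: v + h *: u = x + h *: u + h *: v by rewrite addrAC.
  move: (f (x + h *: u + h *: v)) (f (x + h *: u)) (f (x + h *: v)) (f x).
  by move=> a b c e; ring.
have [_ [A' _]] := Hr _ (br s t sh th).
have := br t' s' th' sh'; rewrite addrAC => /Hr[_ [_ B']].
exact: no_half_way EE A' B'.
Qed.

End Schwarz.

(** * Lattice sums *)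

Section LatticeSums.
Variables (R : realType) (d : nat).
Implicit Types (F G Z : 'rV[R]_d -> R) (N : nat) (x : 'rV[R]_d).

Local Notation idx N := 'I_((N.+1 ^ 2).*2.+1).

(** One parameter both refines the mesh and enlarges the box, so any compact support is eventually
    inside; the index (N+1)^2 is the origin. *)
Definition lattice_coord N (i : nat) : R := (i%:R - (N.+1 ^ 2)%:R) / N.+1%:R.

Definition lattice_point N (k : {ffun 'I_d -> idx N}) : 'rV[R]_d :=
  \row_i lattice_coord N (k i).

(* Riemann sum of F over the points of (1/(N+1)) Z^d in [-(N+1), N+1]^d; [null F]
   plays the role of "the integral of F is 0". *)
Definition lattice_sum N F : R :=
  N.+1%:R^-1 ^+ d * \sum_(k : {ffun 'I_d -> idx N}) F (lattice_point k).

Definition null F : Prop := (fun N => lattice_sum N F) @ \oo --> (0 : R).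

Definition supported (L : nat) F : Prop := forall x, L%:R < `|x| -> F x = 0.

Lemma lattice_sumD N F G :
  lattice_sum N (fun x => F x + G x) = lattice_sum N F + lattice_sum N G.
Proof. by rewrite /lattice_sum big_split/= mulrDr. Qed.

Lemma lattice_sumZ N (a : R) F :
  lattice_sum N (fun x => a * F x) = a * lattice_sum N F.
Proof. by rewrite /lattice_sum -big_distrr/= mulrCA. Qed.

Lemma lattice_sumB N F G :
  lattice_sum N (fun x => F x - G x) = lattice_sum N F - lattice_sum N G.
Proof. by rewrite /lattice_sum sumrB mulrBr. Qed.

Lemma lattice_sum_sum N (I : Type) (r : seq I) (P : pred I) (F : I -> 'rV[R]_d -> R) :
  lattice_sum N (fun x => \sum_(i <- r | P i) F i x)
  = \sum_(i <- r | P i) lattice_sum N (F i).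
Proof. by rewrite /lattice_sum exchange_big/= big_distrr. Qed.

Lemma null_add F G : null F -> null G -> null (fun x => F x + G x).
Proof.
move=> nF nG; rewrite /null -[0](addr0 (0 : R)).
rewrite (_ : (fun N => _) = fun N => lattice_sum N F + lattice_sum N G).
  exact: cvgD.
by apply/funext => N; rewrite lattice_sumD.
Qed.

Lemma null_scale (a : R) F : null F -> null (fun x => a * F x).
Proof.
move=> nF; rewrite /null -[0](mulr0 a).
rewrite (_ : (fun N => _) = fun N => a * lattice_sum N F).
  exact: cvgMl_tmp.
by apply/funext => N; rewrite lattice_sumZ.
Qed.

Lemma null0 : null (fun=> 0).
Proof.
rewrite /null (_ : (fun N => _) = fun=> 0); first exact: cvg_cst.
by apply/funext => N; rewrite /lattice_sum big1 ?mulr0.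
Qed.

Lemma null_sum (I : Type) (r : seq I) (P : pred I) (F : I -> 'rV[R]_d -> R) :
  (forall i, P i -> null (F i)) -> null (fun x => \sum_(i <- r | P i) F i x).
Proof.
move=> nF; elim: r => [|i r IH].
  rewrite (_ : (fun x => _) = fun=> 0); first exact: null0.
  by apply/funext => x; rewrite big_nil.
have [Pi|nPi] := boolP (P i).
  rewrite (_ : (fun x => _) = fun x => F i x + \sum_(j <- r | P j) F j x).
    by apply: null_add => //; exact: nF.
  by apply/funext => x; rewrite big_cons Pi.
rewrite (_ : (fun x => _) = fun x => \sum_(j <- r | P j) F j x) //.
by apply/funext => x; rewrite big_cons (negPf nPi).
Qed.

(** Nullity of a difference stands for equality of two integrals; transitivity is what chains
    changes of variables. *)
Lemma null_trans F G H : null (fun x => F x - G x) -> null (fun x => G x - H x) ->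
  null (fun x => F x - H x).
Proof.
move=> nFG nGH; rewrite (_ : (fun x => _) = fun x => (F x - G x) + (G x - H x)).
  exact: null_add.
by apply/funext => x; rewrite subrKA.
Qed.

Lemma null_ext F G : (forall x, F x = G x) -> null F -> null G.
Proof. by move=> /funext ->. Qed.

Lemma norm_lattice_coord N (i : nat) (L : nat) :
  `|lattice_coord N i| <= L%:R ->
  ((N.+1 ^ 2 - L * N.+1 <= i)%N /\ (i <= N.+1 ^ 2 + L * N.+1)%N).
Proof.
have M0 : 0 < N.+1%:R :> R by rewrite ltr0n.
rewrite /lattice_coord normrM normfV (gtr0_norm M0) ler_pdivrMr// -natrM.
rewrite ler_norml lerBlDr -natrD ler_nat lerBrDr addrC lerBlDr -natrD ler_nat.
by move=> /andP[A B]; split; [rewrite leq_subLR addnC|rewrite addnC].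
Qed.

(** At most 2L(N+1) + 1 indices qualify; the rounded bound is proportional to N+1, so that the cell
    volume in [lattice_sum] cancels it, uniformly in N. *)
Lemma card_lattice_coord N (L : nat) :
  (#|[pred i : idx N | (`|lattice_coord N i| <= L%:R)%R]| <= L.*2.+1 * N.+1)%N.
Proof.
set A := [pred i | _].
rewrite -[#|A|]/(#|mem A|) cardE -(size_map val).
apply: (@leq_trans (size (iota (N.+1 ^ 2 - L * N.+1) (L * N.+1).*2.+1))).
  apply: uniq_leq_size; first by rewrite (map_inj_uniq val_inj) enum_uniq.
  move=> j /mapP[i]; rewrite mem_enum inE => /norm_lattice_coord[A1 A2] ->.
  rewrite mem_iota A1 /= (leq_ltn_trans A2)//.
  by rewrite -addnn addnS ltnS addnA leq_add2r addnC -leq_subLR.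
by rewrite size_iota mulSn -doubleMl -addn1 addnC leq_add2r.
Qed.

Lemma sum_prod_bool N (P : 'I_d -> idx N -> bool) :
  \sum_(k : {ffun 'I_d -> idx N}) (\prod_i (P i (k i))%:R)
  = \prod_i (#|[pred j | P i j]|%:R : R).
Proof.
rewrite -(bigA_distr_bigA (fun i j => (P i j)%:R : R)).
apply: eq_bigr => i _; rewrite -sum1_card natr_sum big_mkcond/=.
by rewrite [RHS]big_mkcond/=; apply: eq_bigr => j _; rewrite inE; case: (P i j).
Qed.

Lemma lattice_sum_bound N (L : nat) (c : R) F : 0 <= c ->
  (forall x, `|F x| <= c) -> supported L F ->
  `|lattice_sum N F| <= c * (L.*2.+1)%:R ^+ d.
Proof.
move=> c0 Fc FL.
have M0 : 0 < N.+1%:R :> R by rewrite ltr0n.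
rewrite /lattice_sum normrM ger0_norm ?exprn_ge0 ?invr_ge0//.
rewrite exprVn mulrC ler_pdivrMr ?exprn_gt0//.
apply: le_trans (ler_norm_sum _ _ _) _.
(* The product of the [P i (k i)] is the indicator of the cube of radius L, and its sum over the
   lattice factors over the coordinates. *)
pose P (i : 'I_d) (j : idx N) := `|lattice_coord N j| <= L%:R.
apply: (@le_trans _ _ (c * \sum_(k : {ffun 'I_d -> idx N}) \prod_i (P i (k i))%:R)).
  rewrite big_distrr/=; apply: ler_sum => k _.
  have [/forallP Pk|/forallPn[i Pik]] := boolP [forall i, P i (k i)].
    by rewrite big1 ?mulr1// => i _; rewrite Pk.
  rewrite FL ?normr0 ?mulr_ge0 ?prodr_ge0//.
  rewrite ltNge; apply: contra Pik => le; rewrite /P.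
  by apply: le_trans le; have := mx_norm_coord_le (lattice_point k) 0 i; rewrite mxE.
rewrite sum_prod_bool -mulrA ler_wpM2l// -exprMn -natrM -[in leRHS](card_ord d).
rewrite -prodr_const; apply: ler_prod => i _.
by rewrite ler0n ler_nat card_lattice_coord.
Qed.

Lemma lattice_coord_rev N (i : idx N) :
  lattice_coord N (rev_ord i) = - lattice_coord N i.
Proof.
rewrite /lattice_coord /= subSS natrB; last by rewrite -ltnS.
move: (nat_of_ord i) => j.
by rewrite -mulNr -muln2 natrM; congr (_ / _); ring.
Qed.

Lemma lattice_sum_reflect N (s : {set 'I_d}) F :
  lattice_sum N (fun x => F (\row_i (if i \in s then - x 0 i else x 0 i)))
  = lattice_sum N F.
Proof.
rewrite /lattice_sum; congr (_ * _).
pose h (k : {ffun 'I_d -> idx N}) := [ffun i => if i \in s then rev_ord (k i) else k i].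
have hK : involutive h.
  move=> k; apply/ffunP => i; rewrite !ffunE.
  by case: (i \in s); rewrite ?rev_ordK.
rewrite [RHS](reindex_inj (inv_inj hK)) /=; apply: eq_bigr => k _; congr F.
by apply/rowP => i; rewrite !mxE ffunE; case: (i \in s); rewrite ?lattice_coord_rev.
Qed.

Lemma lattice_sum_perm N (s : 'S_d) F :
  lattice_sum N (fun x => F (x *m perm_mx s)) = lattice_sum N F.
Proof.
rewrite /lattice_sum; congr (_ * _).
pose h (k : {ffun 'I_d -> idx N}) := [ffun i => k ((s^-1)%g i)].
have hi : injective h.
  move=> k l /ffunP E; apply/ffunP => i.
  by have := E (s i); rewrite !ffunE permK.
rewrite [RHS](reindex_inj hi) /=; apply: eq_bigr => k _; congr F.
by rewrite -[s]invgK -col_permE; apply/rowP => i; rewrite !mxE ffunE.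
Qed.

Local Notation e_ b := (delta_mx 0 b : 'rV[R]_d).

(* The cyclic shift of the lattice in the direction b telescopes the
   difference quotients, and only points outside the support are wrapped. *)
Lemma lattice_sum_shift N (L : nat) b Z : (L <= N)%N -> supported L Z ->
  lattice_sum N (fun x => Z (x + N.+1%:R^-1 *: e_ b)) = lattice_sum N Z.
Proof.
move=> LN ZL; rewrite /lattice_sum; congr (_ * _).
have M0 : 0 < N.+1%:R :> R by rewrite ltr0n.
have LM : L%:R < N.+1%:R :> R by rewrite ltr_nat ltnS.
pose h (k : {ffun 'I_d -> idx N}) := [ffun i => if i == b then ordS (k i) else k i].
have hi : injective h.
  apply: (can_inj (g := fun k : {ffun 'I_d -> idx N} =>
    [ffun i => if i == b then ord_pred (k i) else k i])).
  by move=> k; apply/ffunP => i; rewrite !ffunE; case: (i == b); rewrite ?ordSK.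
rewrite [RHS](reindex_inj hi) /=; apply: eq_bigr => k _.
have far (x : 'rV[R]_d) : N.+1%:R <= `|x 0 b| -> Z x = 0.
  by move=> Mx; apply: ZL; rewrite (lt_le_trans LM)// (le_trans Mx)// mx_norm_coord_le.
(* At the last index [ordS] wraps around to 0. The shifted point and the wrapped one both have a
   coordinate of absolute value at least N+1 > L, so Z vanishes at both. *)
have [kb|kb] := eqVneq (k b : nat) (N.+1 ^ 2).*2.
  rewrite !far//.
    rewrite mxE ffunE eqxx /lattice_coord /= kb modnn sub0r.
    by rewrite normrM normrN normfV !normr_nat natrX expr2 mulfK ?gt_eqF.
  rewrite !mxE !eqxx mulr1 /lattice_coord kb -muln2 natrM.
  have -> : ((N.+1 ^ 2)%:R * 2%:R - (N.+1 ^ 2)%:R) / N.+1%:R + N.+1%:R^-1 =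
    N.+1%:R + N.+1%:R^-1 :> R by rewrite natrX; field; rewrite gt_eqF.
  by rewrite ger0_norm ?addr_ge0 ?invr_ge0// ler_wpDr ?invr_ge0.
congr Z; apply/rowP => i; rewrite !mxE ffunE eqxx/=.
have [->|_] := eqVneq i b; last by rewrite mulr0 addr0.
rewrite mulr1 /lattice_coord /= modn_small; last first.
  by rewrite ltnS ltn_neqAle kb -ltnS ltn_ord.
by rewrite -natr1; field; rewrite gt_eqF.
Qed.

Lemma open_norm_gt (r : R) : open [set y : 'rV[R]_d | r < `|y|].
Proof. by apply: open_comp (@open_gt R r) => x _; exact: norm_continuous. Qed.

Lemma derive_supported L Z v : supported L Z -> supported L ('D_v Z).
Proof.
move=> ZL x Lx; rewrite (near_eq_derive (g := fun=> 0)) ?derive_cst//.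
have : \forall y \near x, L%:R < `|y|.
  by apply: open_nbhs_nbhs; split; [exact: open_norm_gt|].
by apply: filterS => y; exact: ZL.
Qed.

(** The difference quotients sum to 0 by [lattice_sum_shift], so the derivative may be replaced by
    its deviation [W] from the quotient, which the mean value theorem bounds by an oscillation. The
    lattice step is at most 1, hence the support radius L+1. *)
Lemma lattice_sum_derive_bound N (L : nat) b Z (e : R) : 0 <= e -> (L <= N)%N ->
  supported L Z -> (forall x, derivable Z x (e_ b)) ->
  (forall x (c : R), `|c| <= N.+1%:R^-1 ->
    `|'D_(e_ b) Z x - 'D_(e_ b) Z (x + c *: e_ b)| <= e) ->
  `|lattice_sum N ('D_(e_ b) Z)| <= e * ((L.+1).*2.+1)%:R ^+ d.
Proof.
move=> e0 LN ZL dZ osc.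
have M0 : 0 < N.+1%:R :> R by rewrite ltr0n.
pose W x := 'D_(e_ b) Z x - N.+1%:R * (Z (x + N.+1%:R^-1 *: e_ b) - Z x).
have -> : lattice_sum N ('D_(e_ b) Z) = lattice_sum N W.
  rewrite lattice_sumB lattice_sumZ lattice_sumB (lattice_sum_shift _ LN)//.
  by rewrite subrr mulr0 subr0.
apply: lattice_sum_bound => //.
  move=> x; have [|c ch E] := @partial_MVT R _ Z x (e_ b) N.+1%:R^-1.
    by move=> t _; exact: dZ.
  rewrite /W E mulVKf ?gt_eqF//; apply: osc.
  by apply: le_trans ch _; rewrite ger0_norm ?invr_ge0.
move=> x Lx; have Lx' : L%:R < `|x| by rewrite (le_lt_trans _ Lx)// ler_nat.
rewrite /W (derive_supported _ ZL Lx') (ZL x Lx') ZL ?subrr ?mulr0 ?subr0//.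
apply: contraTlt Lx => xL; rewrite -leNgt.
  have -> : x = (x + N.+1%:R^-1 *: e_ b) - N.+1%:R^-1 *: e_ b by rewrite addrK.
  apply: le_trans (ler_normB _ _) _; rewrite -[L.+1%:R]natr1 lerD//.
  rewrite normrZ ger0_norm ?invr_ge0//.
  apply: (@le_trans _ _ (N.+1%:R^-1 * 1)).
    rewrite ler_wpM2l ?invr_ge0//; apply: mx_norm_le => // i j.
    by rewrite mxE; case: (_ && _); rewrite ?normr1 ?normr0.
  by rewrite mulr1 invf_le1// ler1n.
Qed.

Lemma card_lattice_coord_near N (y r : R) : 0 < r -> 2 / r <= N.+1%:R ->
  `|y| + r <= N.+1%:R ->
  r / 2 * N.+1%:R <= #|[pred i : idx N | `|lattice_coord N i - y| < r]|%:R.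
Proof.
move=> r0 Nr Ny.
have M0 : 0 < N.+1%:R :> R by rewrite ltr0n.
set M := N.+1%:R in M0 Nr Ny *.
have M2 : (N.+1 ^ 2)%:R = M ^+ 2 by rewrite natrX.
have rM2 : 2 <= r * M by rewrite mulrC -ler_pdivrMr.
have [yM My] : - M + r <= y /\ y <= M - r.
  by move: Ny; rewrite -lerBrDr ler_norml opprB => /andP[A B]; rewrite addrC.
(* z is the position of y measured in indices. The m = floor(r (N+1)) consecutive indices starting
   at a = floor z stay within r of y, and m is at least half of r (N+1) because r (N+1) >= 2. *)
set z := y * M + M ^+ 2.
have z0 : 0 <= z by rewrite /z; nra.
have := truncn_itv z0; set a := Num.truncn z => /andP[a1 a2].
have rM0 : 0 <= r * M by rewrite (le_trans _ rM2).
have := truncn_itv rM0; set m := Num.truncn (r * M) => /andP[m1 m2].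
have am : (a + m <= (N.+1 ^ 2).*2)%N.
  rewrite -(ler_nat R) natrD -muln2 natrM M2 (le_trans (lerD a1 m1))// /z.
  nra.
apply: (@le_trans _ _ m%:R).
  by move: m2; rewrite -natr1 => m2; lra.
rewrite ler_nat -[m]card_ord -(card_imset (f := fun j : 'I_m =>
   inord (a + j) : idx N)); last first.
  move=> i j /= /(congr1 (@nat_of_ord _)); rewrite !inordK; last 2 first.
  - by rewrite ltnS (leq_trans _ am)// leq_add2l ltnW.
  - by rewrite ltnS (leq_trans _ am)// leq_add2l ltnW.
  by move=> /addnI/val_inj.
apply: subset_leq_card; apply/fintype.subsetP => _ /imsetP[j _ ->].
rewrite inE /lattice_coord inordK; last first.
  by rewrite ltnS (leq_trans _ am)// leq_add2l ltnW.
have -> : ((a + j)%:R - (N.+1 ^ 2)%:R) / N.+1%:R - y = (a%:R - z + j%:R) / M.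
  by rewrite /z natrD M2 -/M; field; rewrite gt_eqF.
have jm : j%:R + 1 <= m%:R :> R by rewrite natr1 ler_nat.
have j0 : 0 <= j%:R :> R by [].
move: a2; rewrite -natr1 => a2.
rewrite normrM [X in _ * X]ger0_norm ?invr_ge0 ?ltW// ltr_pdivrMr//.
by rewrite ltr_norml; apply/andP; split; lra.
Qed.

(** The ball around x0 contains at least (r (N+1) / 2)^d lattice points, so for large N the sums
    stay above c (r / 2)^d. *)
Lemma lattice_sum_lower F x0 (r c : R) : 0 < r -> 0 < c ->
  (forall x, 0 <= F x) -> (forall x, `|x - x0| < r -> c <= F x) -> ~ null F.
Proof.
move=> r0 c0 F0 Fc nF.
have c'0 : 0 < c * (r / 2) ^+ d by rewrite mulr_gt0// exprn_gt0// divr_gt0.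
have /cvgrPdist_lt/(_ _ c'0)[N0 _ HN0] := nF.
pose A := Num.max (2 / r) (`|x0| + r).
pose N := maxn N0 (Num.truncn A).+1.
have := HN0 N (leq_maxl _ _); rewrite /= sub0r normrN ltNge => /negP; apply.
have A0 : 0 <= A by rewrite le_max divr_ge0// ltW.
have AN : A <= N.+1%:R.
  have /andP[_ /ltW/le_trans] := truncn_itv A0; apply.
  by rewrite ler_nat leqW// leq_maxr.
have M0 : 0 < N.+1%:R :> R by rewrite ltr0n.
apply: le_trans (ler_norm _).
rewrite /lattice_sum exprVn mulrC ler_pdivlMl ?exprn_gt0//.
pose P (i : 'I_d) (j : idx N) := `|lattice_coord N j - x0 0 i| < r.
apply: (@le_trans _ _ (c * \sum_(k : {ffun 'I_d -> idx N}) \prod_i (P i (k i))%:R)).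
  rewrite sum_prod_bool [leLHS]mulrA [leLHS]mulrC ler_pM2l// -exprMn.
  rewrite [X in X ^+ _]mulrC -[X in _ ^+ X](card_ord d).
  rewrite -prodr_const; apply: ler_prod => i _.
  rewrite mulr_ge0 ?divr_ge0 ?(ltW r0) ?(ltW M0)//=.
  apply: card_lattice_coord_near => //.
    by apply: le_trans AN; rewrite le_max lexx.
  apply: le_trans AN; rewrite le_max; apply/orP; right.
  by rewrite lerD2r mx_norm_coord_le.
rewrite big_distrr/=; apply: ler_sum => k _.
have [/forallP Pk|/forallPn[i /negPf Pik]] := boolP [forall i, P i (k i)].
  rewrite big1 ?mulr1; last by move=> i _; rewrite Pk.
  by apply: Fc; apply: mx_norm_lt => // i j; rewrite !mxE (ord1 i); exact: Pk.
by rewrite (bigD1 i)//= Pik mul0r mulr0.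
Qed.

End LatticeSums.

(** * Partial derivatives have null lattice sums *)

Section UniformContinuity.
Variables (R : realType) (n : nat).

(** Only x is confined to a ball while y ranges over the whole space; this is more than uniform
    continuity on a compact set, and comes from covering the ball by balls of half the radius of
    continuity. *)
Lemma uniform_continuity (W : 'rV[R]_n -> R) (L e : R) : continuous W -> 0 < e ->
  exists2 r : R, 0 < r &
    forall x y, `|x| <= L -> `|x - y| < r -> `|W x - W y| < e.
Proof.
move=> cW e0.
pose K := [set x : 'rV[R]_n | `|x| <= L].
have cK : compact K.
  apply: bounded_closed_compact.
    by exists L; split; [exact: num_real|move=> M LM x /le_trans; apply; exact: ltW].
  rewrite (_ : K = (fun x : 'rV[R]_n => `|x|) @^-1` [set r | r <= L]) //.
  by apply: preimage_closed (@closed_le R L) => x _; exact: norm_continuous.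
have e20 : 0 < e / 2 by rewrite divr_gt0.
have H : \forall r \near (0 : R)^'+, forall x, K x ->
    forall y, `|x - y| < r -> `|W x - W y| < e.
  move/compact_near_coveringP: cK; apply => x0 _.
  have /cvgrPdist_lt/(_ _ e20) := cW x0.
  rewrite -nbhs_nearE => /nbhs_ballP[r /= r0 Hr].
  have r20 : 0 < r / 2 by rewrite divr_gt0.
  exists (ball x0 (r / 2), [set s | s < r / 2]).
    by split=> /=; [exact: nbhsx_ballx|exact: nbhs_right_lt].
  move=> [x s]/= []; rewrite -ball_normE/= => xx0 sr y xy.
  rewrite (le_lt_trans (ler_distD (W x0) _ _))// (splitr e) ltrD//.
    rewrite distrC; apply: Hr; rewrite -ball_normE/= (lt_trans xx0)//.
    by rewrite ltr_pdivrMr// ltr_pMr// ltr1n.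
  apply: Hr; rewrite -ball_normE/= (le_lt_trans (ler_distD x _ _))//.
  by rewrite (splitr r) ltrD// (lt_trans xy).
near (0 : R)^'+ => r; exists r; first by near: r; exact: nbhs_right_gt.
move=> x y xL xy; have : forall x, K x -> forall y, `|x - y| < r -> `|W x - W y| < e.
  by near: r.
exact.
Unshelve. all: by end_near. Qed.

End UniformContinuity.

Section NullDerivatives.
Variables (R : realType) (d : nat).
Local Notation e_ b := (delta_mx 0 b : 'rV[R]_d).

Lemma norm_delta_le1 m (i : 'I_m) : `|delta_mx 0 i : 'rV[R]_m| <= 1.
Proof.
apply: mx_norm_le => // j k.
by rewrite mxE; case: (_ && _); rewrite ?normr1 ?normr0.
Qed.

(** Uniformity in s is the point: in the homotopy argument s is produced by the mean value theorem
    after N has been fixed. *)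
Lemma lattice_sum_derive_uniform (Z : 'rV[R]_(1 + d) -> R) (L : nat) (b : 'I_d) (e : R) :
  Ck 1 setT Z ->
  (forall s x, L%:R < `|x| -> Z (row_mx s%:M x) = 0) -> 0 < e ->
  exists N0, forall N, (N0 <= N)%N -> forall s : R, 0 <= s <= 1 ->
    `|lattice_sum N (fun x => 'D_(delta_mx 0 (rshift 1 b)) Z (row_mx s%:M x))| <= e.
Proof.
move=> CZ ZL e0; set v := delta_mx _ _.
have vE : v = row_mx 0 (e_ b).
  apply/rowP => i; rewrite !mxE eqxx /=; case: splitP => j ij; rewrite !mxE.
    by rewrite -val_eqE /= ij ltn_eqF// ltn_addr.
  by rewrite eqxx -val_eqE /= ij eqn_add2l.
have rowD (s c : R) x : row_mx s%:M x + c *: v = row_mx s%:M (x + c *: e_ b).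
  by rewrite vE scale_row_mx scaler0 add_row_mx addr0.
pose C := ((L.+1).*2.+1)%:R ^+ d : R.
have C0 : 0 < C by rewrite exprn_gt0.
have e'0 : 0 < e / C by rewrite divr_gt0.
have cW : continuous ('D_v Z).
  by move=> p; apply: (Ck_continuous (Ck_derive v CZ)).
have [r r0 Hr] := uniform_continuity (L%:R + 2) cW e'0.
pose N1 := (Num.truncn r^-1).+1.
exists (maxn L N1) => N; rewrite geq_max => /andP[LN N1N] s /andP[s0 s1].
have M0 : 0 < N.+1%:R :> R by rewrite ltr0n.
have Nr : N.+1%:R^-1 < r.
  rewrite invf_plt ?posrE//.
  have /andP[_ /lt_trans] : (Num.truncn r^-1)%:R <= r^-1 < (Num.truncn r^-1).+1%:R.
    by apply: truncn_itv; rewrite invr_ge0 ltW.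
  by apply; rewrite ltr_nat ltnS.
pose Zs x := Z (row_mx s%:M x).
have DZ x : derivable Zs x (e_ b) /\ 'D_(e_ b) Zs x = 'D_v Z (row_mx s%:M x).
  have dZ : derivable Z (row_mx s%:M x) v by exact: (Ck_derivable _ CZ).
  have E : (fun h : R => h^-1 *: ((Zs \o shift x) (h *: e_ b) - Zs x))
      = (fun h => h^-1 *: ((Z \o shift (row_mx s%:M x)) (h *: v) - Z (row_mx s%:M x))).
    by apply/funext => h /=; rewrite /Zs [h *: v + _]addrC rowD [x + _]addrC.
  by rewrite /derivable /derive E.
rewrite (_ : (fun x => _) = 'D_(e_ b) Zs); last first.
  by apply/funext => x; rewrite (DZ x).2.
have ZsL : supported L Zs by move=> x; exact: ZL.
apply: le_trans (lattice_sum_derive_bound (e := e / C) _ LN ZsL _ _) _.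
- exact: ltW.
- by move=> x; exact: (DZ x).1.
- move=> x c cN; have [xL|xL] := leP `|x| (L%:R + 1); last first.
    rewrite !(derive_supported _ ZsL) ?subr0 ?normr0 ?ltW//.
      rewrite -(ltrD2r 1) (lt_le_trans xL)//.
      have -> : x = (x + c *: e_ b) - c *: e_ b by rewrite addrK.
      apply: le_trans (ler_normB _ _) _; rewrite addrK lerD//.
      rewrite normrZ -[leRHS]mulr1 ler_pM// ?norm_delta_le1//.
      by rewrite (le_trans cN)// invf_le1// ler1n.
    by rewrite (lt_trans _ xL)// ltrDl.
  rewrite !(DZ _).2; apply/ltW/Hr.
    apply: mx_norm_le => [|i j]; first by rewrite addr_ge0.
    rewrite mxE; case: (fintype.split j) => k.
      rewrite !mxE (ord1 i) (ord1 k) eqxx mulr1n ger0_norm// (le_trans s1)//.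
      by rewrite -[leLHS]add0r lerD// ler1n.
    apply: (le_trans (mx_norm_coord_le x i k)); apply: (le_trans xL).
    by rewrite lerD2l ler1n.
  rewrite -rowD opprD addrA subrr sub0r normrN normrZ.
  apply: le_lt_trans Nr; rewrite -[leRHS]mulr1 ler_pM// norm_delta_le1//.
- by rewrite -/C divfK// gt_eqF.
Qed.

(** The uniform version is applied to a function that ignores the parameter. *)
Lemma null_derive (Z : 'rV[R]_d -> R) (L : nat) (b : 'I_d) :
  Ck 1 setT Z -> supported L Z -> null ('D_(e_ b) Z).
Proof.
move=> CZ ZL; apply/cvgrPdist_le => e e0.
have CZ' : Ck 1 setT (Z \o (rsubmx : 'rV[R]_(1 + d) -> 'rV[R]_d)).
  refine (@Ck_comp R _ d 1 setT setT Z _ openT openT (fun _ _ => I) CZ _).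
  apply/Ck_mxP => [|i j]; first exact: openT.
  rewrite (_ : (fun x => _) = fun x : 'rV[R]_(1 + d) => x i (rshift 1 j)).
    exact: Ck_coord.
  by apply/funext => x; rewrite mxE.
have [|N0 HN] := lattice_sum_derive_uniform b CZ' _ e0 (L := L).
  by move=> s x Lx; rewrite /= row_mxKr ZL.
exists N0 => // N /= /HN /(_ 0); rewrite lexx ler01 => /(_ isT).
rewrite sub0r normrN (_ : (fun x => _) = 'D_(e_ b) Z) //.
apply/funext => x.
rewrite /derive; set g1 := fun h => h^-1 *: _; set g2 := fun h => h^-1 *: _.
suff -> : g1 = g2 by [].
apply/funext => h; rewrite /g1 /g2 /= row_mxKr; congr (_ *: (Z _ - _)).
apply/rowP => i; rewrite !mxE; congr (_ * _ + _).
by rewrite -[rshift 1 i]/(unsplit (inr i)) unsplitK.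
Qed.

End NullDerivatives.

(** * Divergences of alternating sums *)

Section Sums.
Variables (R : realType) (V : normedModType R).

Lemma is_derive_sum_seq (I : Type) (r : seq I) (f : I -> V -> R) (df : I -> R) x v :
  (forall i, is_derive x v (f i) (df i)) ->
  is_derive x v (fun y => \sum_(i <- r) f i y) (\sum_(i <- r) df i).
Proof.
move=> H; elim: r => [|i r IH].
  rewrite big_nil (_ : (fun y => _) = fun=> 0); first exact: is_derive_cst.
  by apply/funext => y; rewrite big_nil.
rewrite big_cons (_ : (fun y => _) = f i + (fun y => \sum_(j <- r) f j y)).
  exact: is_deriveD.
by apply/funext => y; rewrite big_cons.
Qed.

Lemma is_derive_prod_seq (I : eqType) (r : seq I) (f : I -> V -> R) (df : I -> R) x v :
  uniq r -> (forall i, is_derive x v (f i) (df i)) ->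
  is_derive x v (fun y => \prod_(i <- r) f i y)
    (\sum_(j <- r) df j * \prod_(i <- r | i != j) f i x).
Proof.
move=> ur H; elim: r ur => [_|i r IH /= /andP[ir /IH{}IH]].
  rewrite big_nil (_ : (fun y => _) = fun=> 1); first exact: is_derive_cst.
  by apply/funext => y; rewrite big_nil.
rewrite (_ : (fun y => _) = f i * (fun y => \prod_(j <- r) f j y)); last first.
  by apply/funext => y; rewrite big_cons.
apply: is_derive_eq.
rewrite !big_cons eqxx /= addrC; congr (_ + _).
  rewrite mulrC; congr (_ * _); rewrite big_seq [RHS]big_seq_cond.
  by apply: eq_bigl => j; case: (eqVneq j i) => [->|]; rewrite ?(negPf ir)// andbT.
rewrite /GRing.scale/= big_distrr/= big_seq [RHS]big_seq.
apply: eq_bigr => j jr; rewrite big_cons.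
have -> : i != j by apply: contraNneq ir => ->.
by rewrite mulrCA.
Qed.

End Sums.

Section AlternatingDivergence.
Variables (R : realType) (n : nat).
Local Notation e_ a := (delta_mx 0 a : 'rV[R]_n).

(* d(y dH) = dy /\ dH when dH is a wedge product of closed forms: the group of
   permutations of the slot a0 with those of the factor j antisymmetrises the
   derivative of that factor, i.e. computes its exterior derivative. *)
Lemma alternating_divergence (J : finType) (a0 : 'I_n) (x : 'rV[R]_n)
    (y : 'rV[R]_n -> R) (w : J -> 'S_n -> 'rV[R]_n -> R) (P : J -> seq 'S_n) :
  (forall v, derivable y x v) -> (forall j s v, derivable (w j s) x v) ->
  (forall j, 0 < size (P j))%N ->
  (forall i j p s, p \in P j -> i != j -> w i (p * s)%g = w i s) ->
  (forall j s, \sum_(p <- P j) (-1) ^+ p *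
     'D_(e_ ((p * s)%g a0)) (w j (p * s)%g) x = 0) ->
  \sum_(s : 'S_n) (-1) ^+ s * 'D_(e_ (s a0)) (fun z => y z * \prod_j w j s z) x =
  \sum_(s : 'S_n) (-1) ^+ s * ('D_(e_ (s a0)) y x * \prod_j w j s x).
Proof.
move=> dy dw P0 Pw Pd.
pose dW s j := 'D_(e_ (s a0)) (w j s) x * \prod_(i | i != j) w i s x.
transitivity (\sum_(s : 'S_n) ((-1) ^+ s * ('D_(e_ (s a0)) y x * \prod_j w j s x) +
    (-1) ^+ s * (y x * \sum_j dW s j))).
  apply: eq_bigr => s _; rewrite -mulrDr; congr (_ * _).
  have dP : is_derive x (e_ (s a0)) (fun z => \prod_j w j s z) (\sum_j dW s j).
    apply: is_derive_prod_seq; first exact: index_enum_uniq.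
    by move=> j; apply: derivableP.
  have dy' := derivableP (dy (e_ (s a0))).
  have [_ ->] := is_deriveM dy' dP.
  by rewrite addrC /GRing.scale/= [X in X + _ = _]mulrC.
rewrite big_split/= [X in _ + X = _](_ : _ = 0) ?addr0//.
under eq_bigr do rewrite mulrCA.
rewrite -big_distrr/= (_ : \sum_s _ = 0) ?mulr0//.
under eq_bigr do rewrite big_distrr/=.
rewrite exchange_big/= big1// => j _.
set T := \sum_s _.
(* [T] is added once for each p and reindexed by s -> p s: the other factors do not change, the
   signs multiply, and the inner sum over p vanishes. As [P j] is nonempty, [T] itself is 0. *)
have : \sum_(p <- P j) T = 0.
  transitivity (\sum_(p <- P j) \sum_(s : 'S_n) (-1) ^+ s * (\prod_(i | i != j) w i s x) *
      ((-1) ^+ p * 'D_(e_ ((p * s)%g a0)) (w j (p * s)%g) x)).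
    rewrite big_seq [RHS]big_seq; apply: eq_bigr => p pP.
    rewrite /T (reindex_inj (mulgI p)) /=; apply: eq_bigr => s _.
    have E : \prod_(i | i != j) w i (p * s)%g x = \prod_(i | i != j) w i s x.
      by apply: eq_bigr => i ij; rewrite (Pw _ j).
    rewrite odd_permM signr_addb /dW E.
    by rewrite mulrACA mulrC.
  rewrite exchange_big/= big1// => s _.
  by rewrite -big_distrr/= Pd mulr0.
move/eqP; rewrite big_const_seq count_predT iter_addr_0 mulrn_eq0.
by rewrite eqn0Ngt P0 => /eqP.
Qed.

End AlternatingDivergence.

#[local] Opaque Ck derive.

Section ZeroExtension.
Variables (R : realType) (V : normedModType R).

(** Lattice sums need functions on the whole space, while expressions in charts are meaningful only
    on an open set. *)
Definition zero_ext (O : set V) (f : V -> R) : V -> R :=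
  fun x => if x \in O then f x else 0.

Lemma zero_extT (O : set V) f x : O x -> zero_ext O f x = f x.
Proof. by move=> Ox; rewrite /zero_ext mem_set. Qed.

Lemma zero_extF (O : set V) f x : ~ O x -> zero_ext O f x = 0.
Proof. by move=> Ox; rewrite /zero_ext memNset. Qed.

(** [O] and the complement of [K] are open and cover the space; on the first the extension is f, on
    the second it is 0. *)
Lemma Ck_zero_ext k (O K : set V) f : open O -> closed K -> K `<=` O ->
  (forall x, O x -> f x != 0 -> K x) -> Ck k O f -> Ck k setT (zero_ext O f).
Proof.
move=> oO cK KO fK Cf; apply: Ck_local => x _.
have [Ox|nOx] := pselect (O x).
  by exists O => //; apply: Ck_eq oO _ Cf => y Oy; rewrite zero_extT.
exists (~` K); first by move=> /KO.
apply: Ck_eq (closed_openC cK) _ (Ck_cst k _ (0 : R)) => y nKy.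
have [Oy|nOy] := pselect (O y); last by rewrite zero_extF.
rewrite zero_extT//; apply/esym/eqP; apply: contra_notT nKy; exact: fK.
Qed.

End ZeroExtension.

Section SlotSum.
Variables (R : realType) (n : nat) (J : finType) (a0 : 'I_n) (U : set 'rV[R]_n)
  (y : 'rV[R]_n -> R) (w : J -> 'S_n -> 'rV[R]_n -> R).
Hypotheses (oU : open U) (Cy : Ck 1 U y) (Cw : forall j s, Ck 1 U (w j s)).
Local Notation e_ a := (delta_mx 0 a : 'rV[R]_n).

(** The component a of the vector field dual to the (n-1)-form given by the product of the factors:
    the free slot [a0] receives the direction a. *)
Definition slot_sum a : 'rV[R]_n -> R :=
  fun p => \sum_(s : 'S_n | s a0 == a) (-1) ^+ s * \prod_j w j s p.

Lemma Ck_slot_sum a : Ck 1 U (slot_sum a).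
Proof.
refine (@Ck_sum R _ R 1 U _ _ _ (fun (s : 'S_n) p => (-1) ^+ s * \prod_j w j s p) oU _) => s _.
refine (@Ck_mul R _ 1 U (fun=> (-1) ^+ s) _ oU (Ck_cst _ _ _) _).
exact: (@Ck_prod R _ 1 U _ _ _ (fun j => w j s) oU (fun j _ => Cw j s)).
Qed.

Lemma sum_derive_slot p : U p ->
  \sum_a 'D_(e_ a) (zero_ext U (fun q => y q * slot_sum a q)) p =
  \sum_(s : 'S_n) (-1) ^+ s * 'D_(e_ (s a0)) (fun z => y z * \prod_j w j s z) p.
Proof.
move=> Up; rewrite [RHS](partition_big (fun s : 'S_n => s a0) xpredT)//=.
apply: eq_bigr => a _.
have D (s : 'S_n) : is_derive p (e_ a) (fun q => (-1) ^+ s * (y q * \prod_j w j s q))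
    ((-1) ^+ s * 'D_(e_ a) (fun q => y q * \prod_j w j s q) p).
  apply: (is_deriveZ (f := fun q => y q * \prod_j w j s q)).
  apply: derivableP.
  have CP : Ck 1 U (fun q => \prod_j w j s q).
    exact: (@Ck_prod R _ 1 U _ _ _ (fun j => w j s) oU (fun j _ => Cw j s)).
  exact: (Ck_derivable _ (Ck_mul oU Cy CP) Up).
rewrite (near_eq_derive (g := fun q => \sum_(s : 'S_n | s a0 == a)
    (-1) ^+ s * (y q * \prod_j w j s q))); last first.
  apply: near_open oU Up _ => q Uq; rewrite zero_extT// /slot_sum.
  by rewrite big_distrr/=; apply: eq_bigr => s _; rewrite mulrCA.
under eq_fun do rewrite -big_filter.
have DS (r : seq 'S_n) : 'D_(e_ a) (fun q => \sum_(s <- r) (-1) ^+ s * (y q * \prod_j w j s q)) p =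
    \sum_(s <- r) (-1) ^+ s * 'D_(e_ a) (fun q => y q * \prod_j w j s q) p.
  by case: (is_derive_sum_seq r D).
by rewrite DS big_filter; apply: eq_bigr => s /eqP ->.
Qed.

End SlotSum.

Lemma is_derive_lattice_sum (R : realType) d N (f : R -> 'rV[R]_d -> R) df (s : R) :
  (forall x, is_derive s 1 (f^~ x) (df x)) ->
  is_derive s 1 (fun t => lattice_sum N (f t)) (lattice_sum N df).
Proof.
move=> H.
have H' := is_derive_sum_seq
  (index_enum {ffun 'I_d -> 'I_((N.+1 ^ 2).*2.+1)}) (fun k => H (lattice_point R k)).
exact: (is_deriveZ (N.+1%:R^-1 ^+ d) H').
Qed.

(** * Change of variables *)

Section Homotopy.
Variables (R : realType) (d : nat).
Local Notation row s x := (row_mx (s%:M : 'M[R]_1) x : 'rV[R]_(1 + d)).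
Local Notation E_ a := (delta_mx 0 a : 'rV[R]_(1 + d)).

Lemma Ck_rsubmx k U : open U -> Ck k U (rsubmx : 'rV[R]_(1 + d) -> 'rV[R]_d).
Proof.
move=> oU; apply/(Ck_mxP _ _ oU) => i j.
apply: (Ck_eq oU) (Ck_coord k U i (rshift 1 j)) => x _.
by rewrite mxE.
Qed.

Lemma rsubmx_continuous : continuous (rsubmx : 'rV[R]_(1 + d) -> 'rV[R]_d).
Proof. by move=> p; exact: (Ck_continuous (Ck_rsubmx 0 openT)). Qed.

Lemma open_cylinder (O : set 'rV[R]_d) : open O ->
  open [set p : 'rV[R]_(1 + d) | O (rsubmx p)].
Proof. by move=> oO; apply: open_comp oO => p _; exact: rsubmx_continuous. Qed.

Lemma row_path (s t : R) (x : 'rV[R]_d) :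
  row s x + t *: E_ (lshift d ord0) = row (s + t) x.
Proof.
apply/rowP => i; rewrite !mxE eqxx /=; case: splitP => j ij; rewrite ?mxE.
  rewrite (ord1 j) (ord1 0) !eqxx (_ : i == _) ?mulr1 ?mulr1n//.
  by rewrite -val_eqE /= ij (ord1 j).
by rewrite (negPf (_ : i != _)) ?mulr0 ?addr0// -val_eqE /= ij.
Qed.

Definition space_jacobian (S : 'rV[R]_(1 + d) -> 'rV[R]_d) p : 'M[R]_d :=
  \matrix_(a, b) 'D_(E_ (rshift 1 a)) (fun q => S q 0 b) p.

Variables (O K : set 'rV[R]_d) (L : nat) (S : 'rV[R]_(1 + d) -> 'rV[R]_d)
  (F : 'rV[R]_d -> R).
Hypotheses (oO : open O) (cK : closed K) (KO : K `<=` O)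
  (KL : forall x, K x -> `|x| <= L%:R).
Let U := [set p : 'rV[R]_(1 + d) | O (rsubmx p)].
Hypotheses (CS : Ck 2 U S) (CF : Ck 1 setT F).
Hypothesis FK : forall p, U p -> F (S p) != 0 -> K (rsubmx p).

Let oU : open U := open_cylinder oO.

(** [Z] is the vector field on time and space dual to the d-form F(S) dS_1 /\ ... /\ dS_d. Its time
    component, of index [a0], is F(S) times the Jacobian determinant in space. *)
Let y : 'rV[R]_(1 + d) -> R := F \o S.
Let u j : 'rV[R]_(1 + d) -> R := fun q => S q 0 j.
Let a0 : 'I_(1 + d) := lshift d ord0.
Let w (j : 'I_d) (s : 'S_(1 + d)) : 'rV[R]_(1 + d) -> R := 'D_(E_ (s (rshift 1 j))) (u j).
Let cof := slot_sum a0 w.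
Let Z a : 'rV[R]_(1 + d) -> R := zero_ext U (fun p => y p * cof a p).

Let Cu j : Ck 2 U (u j). Proof. exact: (Ck_mxP _ _ oU).1. Qed.

Let Cy : Ck 1 U y.
Proof. exact: (Ck_comp openT oU (fun _ _ => I) CF (CkW CS)). Qed.

Let Cw j s : Ck 1 U (w j s). Proof. exact: Ck_derive (Cu j). Qed.

Let Ccof a : Ck 1 U (cof a). Proof. exact: Ck_slot_sum. Qed.

Let KU : closed [set p : 'rV[R]_(1 + d) | K (rsubmx p)].
Proof. by apply: preimage_closed cK => p _; exact: rsubmx_continuous. Qed.

Let CZ a : Ck 1 setT (Z a).
Proof.
apply: Ck_zero_ext oU KU _ _ _.
- by move=> p; exact: KO.
- by move=> p Up; rewrite mulf_eq0 negb_or => /andP[]; move=> /(FK Up).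
- exact: (Ck_mul oU Cy (Ccof a)).
Qed.

Let ZL a s x : L%:R < `|x| -> Z a (row s x) = 0.
Proof.
move=> Lx; have [Up|Up] := pselect (U (row s x)); last by rewrite /Z zero_extF.
rewrite /Z zero_extT//.
have [/eqP ->|/(FK Up)] := boolP (y (row s x) == 0); first by rewrite mul0r.
by rewrite row_mxKr => /KL; rewrite leNgt Lx.
Qed.

(** This is dy /\ dS_1 /\ ... /\ dS_d, and y = F o S makes dy a combination of the dS_j: the row
    with entries -1 and the gradient of F annihilates the matrix of differentials. *)
Let grad_det p : U p ->
  \sum_(s : 'S_(1 + d)) (-1) ^+ s * ('D_(E_ (s a0)) y p * \prod_j w j s p) = 0.
Proof.
move=> Up.
pose B : 'M[R]_(1 + d) := col_mx (\row_b 'D_(E_ b) y p)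
  (\matrix_(j < d, b < 1 + d) 'D_(E_ b) (u j) p).
transitivity (\det B).
  apply: eq_bigr => s _; congr (_ * _); rewrite big_split_ord /= big_ord1.
  rewrite col_mxEu mxE; congr (_ * _).
  by apply: eq_bigr => j _; rewrite col_mxEd mxE.
apply/eqP/det0P; exists (row_mx (-1)%:M (grad F (S p))).
  apply/eqP => /rowP /(_ (lshift d ord0)).
  rewrite row_mxEl !mxE eqxx mulr1n => /eqP; rewrite oppr_eq0; exact/negP/oner_neq0.
rewrite mul_row_col mul_scalar_mx scaleN1r; apply/eqP; rewrite addrC subr_eq0.
apply/eqP/rowP => b; rewrite !mxE.
have := derive_comp_C1 (F := F) (G := S) (E_ b) openT oU (fun _ _ => I) CF (CkW CS) Up.
rewrite -/y => ->; rewrite mxE; apply: eq_bigr => j _; rewrite !mxE mulrC.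
congr (_ * _); rewrite derive_mx ?mxE//.
exact: (Ck_derivable _ CS Up).
Qed.

(** Each factor dS_j is closed: exchanging the free slot with the slot of j produces two second
    derivatives that cancel by symmetry. Outside U the field vanishes near p, as K is closed. *)
Let divergence p : \sum_a 'D_(E_ a) (Z a) p = 0.
Proof.
have [Up|Up] := pselect (U p); last first.
  apply: big1 => a _; rewrite (near_eq_derive (g := fun=> 0)) ?derive_cst//.
  have : ~ K (rsubmx p) by move=> /KO.
  move=> nKp; have : nbhs p (~` [set q : 'rV[R]_(1 + d) | K (rsubmx q)]).
    by apply: open_nbhs_nbhs; split => //; exact: closed_openC.
  apply: filterS => q nKq.
  have [Uq|Uq] := pselect (U q); last by rewrite /Z zero_extF.
  rewrite /Z zero_extT//; apply/eqP; apply: contra_notT nKq.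
  by rewrite mulf_eq0 negb_or => /andP[]; move=> /(FK Uq).
rewrite -[RHS](grad_det Up) -(alternating_divergence (P := fun j =>
  [:: 1%g; tperm a0 (rshift 1 j)])).
- exact: (sum_derive_slot a0 oU Cy Cw Up).
- by move=> v; exact: (Ck_derivable _ Cy Up).
- by move=> j s v; exact: (Ck_derivable _ (Cw j s) Up).
- by [].
- move=> i j q s; rewrite !inE => /orP[] /eqP -> ij; first by rewrite mul1g.
  by rewrite /w permM tpermD// ?eq_rlshift// (inj_eq (@rshift_inj _ _)) eq_sym.
- move=> j s; pose f (q : 'S_(1 + d)) : R :=
    (-1) ^+ q * 'D_(E_ ((q * s)%g a0)) (w j (q * s)%g) p.
  transitivity (f 1%g + f (tperm a0 (rshift 1 j))); first by rewrite big_cons big_seq1.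
  have -> : f 1%g = 'D_(E_ (s a0)) ('D_(E_ (s (rshift 1 j))) (u j)) p.
    by rewrite /f mul1g odd_perm1 expr0 mul1r.
  have -> : f (tperm a0 (rshift 1 j)) =
      - 'D_(E_ (s (rshift 1 j))) ('D_(E_ (s a0)) (u j)) p.
    by rewrite /f odd_tperm eq_lrshift expr1 mulN1r /w !permM tpermL tpermR.
  by rewrite (derive_comm _ _ oU (Cu j) Up) subrr.
Qed.

Let cof0 p : cof a0 p = \det (space_jacobian S p).
Proof.
pose B : 'M[R]_(1 + d) := col_mx (0 : 'rV_(1 + d)) (\matrix_(j < d, b < 1 + d) 'D_(E_ b) (u j) p).
transitivity (cofactor B a0 a0).
  rewrite expand_cofactor; apply: eq_bigr => s _; congr (_ * _).
  rewrite [RHS]big_mkcond [RHS]big_split_ord /= big_ord1 eqxx mul1r.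
  by apply: eq_bigr => j _; rewrite col_mxEd mxE.
rewrite /cofactor -signr_odd oddD addbb expr0 mul1r -det_tr; congr (\det _).
apply/matrixP => i j; rewrite !mxE.
have E (k : 'I_d) : lift a0 k = rshift 1 k by apply/val_inj.
by rewrite [lift a0 j]E [lift a0 i]E -[rshift 1 j]/(unsplit (inr j)) unsplitK mxE.
Qed.

Let Z0_path N (s : R) :
  is_derive s 1 (fun t => lattice_sum N (fun x => Z a0 (row t x)))
    (lattice_sum N (fun x => 'D_(E_ a0) (Z a0) (row s x))).
Proof.
apply: (@is_derive_lattice_sum R d N (fun t x => Z a0 (row t x))) => x.
have := @derive_along R _ (Z a0) (row 0 x) (E_ a0) s.
rewrite row_path add0r (_ : (fun t => _) = fun t => Z a0 (row t x)).
  by apply; exact: (Ck_derivable _ (CZ a0)).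
by apply/funext => t; rewrite row_path add0r.
Qed.

(* Along the homotopy, F(S_s) det DS_s changes by the divergence of a
   compactly supported vector field, as F(S) dS_1 /\ ... /\ dS_d is closed. *)
Lemma homotopy_null :
  null (fun x => zero_ext O (fun z => F (S (row 1 z)) * \det (space_jacobian S (row 1 z))) x -
                 zero_ext O (fun z => F (S (row 0 z)) * \det (space_jacobian S (row 0 z))) x).
Proof.
have kE s x : zero_ext O (fun z => F (S (row s z)) * \det (space_jacobian S (row s z))) x
    = Z a0 (row s x).
  have [Ox|Ox] := pselect (O x).
    by rewrite zero_extT// /Z zero_extT ?cof0// /U/= row_mxKr.
  by rewrite zero_extF// /Z zero_extF// /U/= row_mxKr.
apply/cvgrPdist_le => e e0.
pose e' := e / (d%:R + 1).
have e'0 : 0 < e' by rewrite divr_gt0// ltr_wpDl.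
have : \forall N \near \oo, forall j : 'I_d, forall s : R, 0 <= s <= 1 ->
    `|lattice_sum N (fun x => 'D_(E_ (rshift 1 j)) (Z (rshift 1 j)) (row s x))| <= e'.
  apply: filter_forall => j.
  have [N0 HN0] := lattice_sum_derive_uniform j (CZ (rshift 1 j)) (ZL (rshift 1 j)) e'0.
  by exists N0 => // N /= /HN0.
apply: filterS => N HN.
under [X in lattice_sum _ X]eq_fun do rewrite !kE.
rewrite sub0r normrN lattice_sumB.
pose G t := lattice_sum N (fun x => Z a0 (row t x)).
have cG : {within `[0, 1], continuous G}.
  apply: continuous_subspaceT => t; apply: differentiable_continuous.
  by apply/derivable1_diffP; have [] := Z0_path N t.
(* The difference of the sums at times 1 and 0 is the time derivative at some s depending on N; the
   vanishing divergence turns it into minus the spatial derivatives, which are small uniformly in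
   s. *)
have [s s01 ->] := MVT (ltr01 : 0 < 1 :> R) (fun t _ => Z0_path N t) cG.
rewrite subr0 mulr1.
have -> : lattice_sum N (fun x => 'D_(E_ a0) (Z a0) (row s x)) =
    - \sum_(j < d) lattice_sum N (fun x => 'D_(E_ (rshift 1 j)) (Z (rshift 1 j)) (row s x)).
  rewrite -lattice_sum_sum; apply/eqP; rewrite -addr_eq0 -lattice_sumD.
  apply/eqP; rewrite /lattice_sum big1 ?mulr0// => k _.
  by rewrite -[RHS](divergence (row s (lattice_point R k))) big_split_ord /= big_ord1.
rewrite normrN (le_trans (ler_norm_sum _ _ _))//.
apply: (@le_trans _ _ (\sum_(j < d) e')).
  apply: ler_sum => j _; apply: HN; move: s01; rewrite in_itv/= => /andP[s0 s1].
  by rewrite !ltW.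
rewrite sumr_const card_ord -mulr_natr /e' -mulrA ger_pMr//.
by rewrite mulrC ler_pdivrMr ?mul1r ?lerDl ?ler01// ltr_wpDl.
Qed.

End Homotopy.

(** * Linear changes of variables *)

Lemma zero_ext_eq (R : realType) (V : normedModType R) (O : set V) (f g : V -> R) x :
  (O x -> f x = g x) -> zero_ext O f x = zero_ext O g x.
Proof.
move=> H; have [Ox|nOx] := pselect (O x); last by rewrite (zero_extF f nOx) (zero_extF g nOx).
by rewrite (zero_extT f Ox) (zero_extT g Ox) H.
Qed.

Section LinearChange.
Variables (R : realType) (d : nat).
Local Notation row s x := (row_mx (s%:M : 'M[R]_1) x : 'rV[R]_(1 + d)).
Implicit Types (F : 'rV[R]_d -> R) (A B : 'M[R]_d) (x v : 'rV[R]_d).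

Definition jac (T : 'rV[R]_d -> 'rV[R]_d) x : 'M[R]_d :=
  \matrix_(a, b) 'D_(delta_mx 0 a) (fun z => T z 0 b) x.

Lemma derive_row (f : 'rV[R]_(1 + d) -> R) (s : R) x (a : 'I_d) :
  'D_(delta_mx 0 (rshift 1 a)) f (row s x) = 'D_(delta_mx 0 a) (fun z => f (row s z)) x.
Proof.
have rowD (c : R) : c *: delta_mx 0 (rshift 1 a) + row s x =
    row s (c *: delta_mx 0 a + x).
  apply/rowP => i; rewrite !mxE eqxx /=; case: splitP => j ij; rewrite ?mxE.
    rewrite (negPf (_ : i != _)) ?mulr0 ?add0r// -val_eqE /= ij.
    by rewrite neq_ltn (leq_trans (ltn_ord j)).
  by congr (_ * _%:R + _); rewrite -!val_eqE /= ij eqn_add2l.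
Local Transparent derive.
rewrite /derive.
set g1 := fun h => h^-1 *: _; set g2 := fun h => h^-1 *: _.
suff -> : g1 = g2 by [].
by apply/funext => h; rewrite /g1 /g2 /= rowD.
Local Opaque derive.
Qed.

Lemma homotopy_affine (O K : set 'rV[R]_d) (L : nat) (P Q : 'rV[R]_d -> 'rV[R]_d) F :
  open O -> closed K -> K `<=` O -> (forall x, K x -> `|x| <= L%:R) ->
  Ck 2 O P -> Ck 2 O Q -> Ck 1 setT F ->
  (forall (s : R) x, 0 <= s <= 1 -> O x -> F (P x + s *: Q x) != 0 -> K x) ->
  null (fun x =>
    zero_ext O (fun z => F (P z + Q z) * \det (jac (fun z => P z + Q z) z)) x -
    zero_ext O (fun z => F (P z) * \det (jac P z)) x).
Proof.
move=> oO cK KO KL CP CQ CF FK.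
pose tau (p : 'rV[R]_(1 + d)) : R := p 0 (lshift d ord0).
(* The time of [homotopy_null] ranges over all of R, but the support is controlled only for s in
   [0, 1]. The reparametrization (2t / (1 + t^2))^2 is smooth, stays in [0, 1], and takes 0 to 0 and
   1 to 1. *)
pose q p := 2 * tau p * (1 + tau p * tau p)^-1.
pose sigma p : R := q p * q p.
pose U := [set p : 'rV[R]_(1 + d) | O (rsubmx p)].
have oU : open U by exact: open_cylinder.
have t0 p : 1 + tau p * tau p != 0.
  by rewrite gt_eqF// ltr_pwDl// -expr2 sqr_ge0.
have Ct k : Ck k U tau by exact: Ck_coord.
have Csigma k : Ck k U sigma.
  have Cq : Ck k U q.
    apply: (Ck_mul oU); first exact: (Ck_mul oU (Ck_cst _ _ _) (Ct k)).
    apply: (Ck_inv oU (fun p _ => t0 p)).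
    exact: (Ck_add oU (Ck_cst _ _ _) (Ck_mul oU (Ct k) (Ct k))).
  exact: (Ck_mul oU Cq Cq).
have sigma01 p : 0 <= sigma p <= 1.
  apply/andP; split; first by rewrite /sigma -expr2 sqr_ge0.
  rewrite /sigma /q mulrACA -invfM ler_pdivrMr ?mul1r.
    have := sqr_ge0 (1 - tau p * tau p); lra.
  by rewrite -expr2 exprn_gt0// ltr_pwDl// -expr2 sqr_ge0.
pose S p := P (rsubmx p) + sigma p *: Q (rsubmx p).
have Cr k : Ck k U (rsubmx : 'rV[R]_(1 + d) -> 'rV[R]_d) by exact: Ck_rsubmx.
have CS : Ck 2 U S.
  apply/(Ck_mxP _ _ oU) => i j.
  have Cc (G : 'rV[R]_d -> 'rV[R]_d) : Ck 2 O G -> Ck 2 U (fun p => G (rsubmx p) i j).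
    move=> CG; have CGij := (Ck_mxP 2 G oO).1 CG i j.
    exact: (Ck_comp oO oU (fun _ Up => Up) CGij (Cr 2)).
  apply: (Ck_eq (W := R) oU) (Ck_add oU (Cc P CP) (Ck_mul oU (Csigma 2) (Cc Q CQ))).
  by move=> p _; rewrite !mxE.
have FKS p : U p -> F (S p) != 0 -> K (rsubmx p).
  by move=> Up; exact: FK.
have sE (s : R) x : S (row s x) = P x + (2 * s / (1 + s * s)) ^+ 2 *: Q x.
  by rewrite /S /sigma /q /tau row_mxKr row_mxEl mxE eqxx mulr1n -expr2.
have S1 x : S (row 1 x) = P x + Q x.
  by rewrite sE (_ : _ ^+ 2 = 1) ?scale1r//; field.
have S0 x : S (row 0 x) = P x by rewrite sE mulr0 mul0r expr0n scale0r addr0.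
have J1 x : space_jacobian S (row 1 x) = jac (fun z => P z + Q z) x.
  apply/matrixP => a b; rewrite !mxE derive_row.
  have -> : (fun z => S (row 1 z) 0 b) = (fun z => (P z + Q z) 0 b) by apply/funext => z; rewrite S1.
  by [].
have J0 x : space_jacobian S (row 0 x) = jac P x.
  apply/matrixP => a b; rewrite !mxE derive_row.
  have -> : (fun z => S (row 0 z) 0 b) = (fun z => P z 0 b) by apply/funext => z; rewrite S0.
  by [].
apply: (null_ext _ (homotopy_null oO cK KO KL CS CF FKS)) => x.
refine (f_equal2 (fun a b : R => a - b) (zero_ext_eq (fun Ox => _)) (zero_ext_eq (fun Ox => _))).
  by rewrite S1 J1.
by rewrite S0 J0.
Qed.

Lemma norm_mulmx v B : `|v *m B| <= d%:R * `|v| * `|B|.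
Proof.
apply: mx_norm_le => [|i j]; first by rewrite !mulr_ge0.
rewrite mxE; apply: le_trans (ler_norm_sum _ _ _) _.
apply: (@le_trans _ _ (\sum_(k < d) `|v| * `|B|)).
  by apply: ler_sum => k _; rewrite normrM ler_pM// mx_norm_coord_le.
by rewrite sumr_const card_ord -mulrA mulr_natl.
Qed.

Lemma Ck_det (V : normedModType R) k (U : set V) n (M : V -> 'M[R]_n) : open U ->
  (forall i j, Ck k U (fun x : V => M x i j)) -> Ck k U (fun x : V => \det (M x)).
Proof.
move=> oU CM.
apply: (@Ck_sum R _ R k U _ _ _ (fun (s : 'S_n) (x : V) => (-1) ^+ s * \prod_i M x i (s i)) oU).
move=> s _; apply: (@Ck_mul R _ k U (fun=> (-1) ^+ s) _ oU (Ck_cst _ _ _)).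
exact: (@Ck_prod R _ k U _ _ _ (fun i (x : V) => M x i (s i)) oU (fun i _ => CM i (s i))).
Qed.

(** On [0, 1] the determinant stays away from 0 and the adjugate stays bounded, so the inverses are
    uniformly bounded. This confines the supports of all functions along a linear path to one
    ball. *)
Lemma path_bound A B : (forall s : R, 0 <= s <= 1 -> \det (A + s *: B) != 0) ->
  exists2 C : R, 0 <= C &
    forall (s : R) x, 0 <= s <= 1 -> `|x| <= C * `|x *m (A + s *: B)|.
Proof.
move=> det0; pose M s := A + s *: B.
have CM i j : Ck 0 setT (fun s : R => M s i j).
  have Cid : Ck 0 setT (fun s : R => s).
    exact: (Ck_linear _ _ (f := idfun) (fun s => @cvg_id _ (nbhs s))).
  apply: (Ck_eq (W := R) openT) (Ck_add openT (Ck_cst 0 setT (A i j))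
    (Ck_mul openT Cid (Ck_cst 0 setT (B i j)))).
  by move=> s _; rewrite !mxE.
have cdet : continuous (fun s => `|\det (M s)|).
  move=> s; apply: (@continuous_comp _ _ _ (fun s => \det (M s)) (fun z : R => `|z|)).
    exact: (Ck_continuous (Ck_det openT CM)).
  exact: norm_continuous.
have cadj : continuous (fun s => `|\adj (M s)|).
  move=> s; apply: (@continuous_comp _ _ _ (fun s => \adj (M s)) (fun z : 'M[R]_d => `|z|)).
    have CA : Ck 0 setT (fun s : R => \adj (M s)).
      apply/(Ck_mxP _ _ openT) => i j.
      apply: (Ck_eq (W := R) (f := fun s => (-1) ^+ (j + i) * \det (row' j (col' i (M s)))) openT).
        by move=> s' _; rewrite mxE.
      apply: (Ck_mul openT (Ck_cst _ _ _)); apply: Ck_det => [|i' j']; first exact: openT.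
      by apply: (Ck_eq (W := R) openT) (CM (lift j i') (lift i j')) => s' _; rewrite !mxE.
    exact: (Ck_continuous CA).
  exact: norm_continuous.
have [s0 s001 Hs0] := EVT_min (@ler01 R) (continuous_subspaceT cdet).
have [s1 s101 Hs1] := EVT_max (@ler01 R) (continuous_subspaceT cadj).
have m0 : 0 < `|\det (M s0)| by rewrite normr_gt0 det0// -in_itv.
exists (d%:R * `|\adj (M s1)| / `|\det (M s0)|); first by rewrite divr_ge0// mulr_ge0.
move=> s x s01; have s01' : s \in `[0, 1] by rewrite in_itv.
rewrite mulrAC ler_pdivlMr//.
apply: (@le_trans _ _ (`|x| * `|\det (M s)|)); first by rewrite ler_wpM2l// Hs0.
have -> : `|x| * `|\det (M s)| = `|x *m M s *m \adj (M s)|.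
  by rewrite -mulmxA mul_mx_adj mul_mx_scalar normrZ mulrC.
apply: le_trans (norm_mulmx _ _) _; rewrite -mulrA [leRHS]mulrAC -mulrA.
by rewrite ler_wpM2l// ler_wpM2l// Hs1.
Qed.

Definition compact_C1 F := Ck 1 setT F /\ exists L, supported L F.

Lemma derive_mulmx A x v b : 'D_v (fun z => (z *m A) 0 b) x = (v *m A) 0 b.
Proof.
pose f (z : 'rV[R]_d) : R := (z *m A) 0 b.
have Cf : Ck 1 setT f.
  apply: (Ck_eq (W := R) (f := fun z : 'rV[R]_d => \sum_k z 0 k * A k b) openT).
    by move=> z _; rewrite /f mxE.
  apply: (@Ck_sum R _ R 1 setT _ _ _ (fun k (z : 'rV[R]_d) => z 0 k * A k b) openT) => k _.
  exact: (Ck_mul openT (Ck_coord _ _ _ _) (Ck_cst _ _ _)).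
have lf : linear f by move=> a y z; rewrite /f mulmxDl -scalemxAl !mxE.
pose fL := GRing.isLinear.Build _ _ _ _ f lf.
pose g : {linear 'rV[R]_d -> R} := HB.pack f fL.
have df : differentiable g x := (C1_differentiable openT Cf I).1.
rewrite deriveE// (diff_lin (f := g))//.
by move=> z; exact: (Ck_continuous Cf).
Qed.

Lemma jac_mulmx A x : jac (fun z => z *m A) x = A.
Proof.
apply/matrixP => a b; rewrite mxE derive_mulmx.
by rewrite -rowE mxE.
Qed.

Lemma Ck_mulmx k U A : open U -> Ck k U (fun z : 'rV[R]_d => z *m A).
Proof.
move=> oU; apply/(Ck_mxP _ _ oU) => i j.
apply: (Ck_eq (W := R) (f := fun z : 'rV[R]_d => \sum_k z i k * A k j) oU).
  by move=> z _; rewrite mxE.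
apply: (@Ck_sum R _ R k U _ _ _ (fun k (z : 'rV[R]_d) => z i k * A k j) oU) => l _.
exact: (Ck_mul oU (Ck_coord _ _ _ _) (Ck_cst _ _ _)).
Qed.

Lemma linear_path A B F : compact_C1 F ->
  (forall s : R, 0 <= s <= 1 -> \det (A + s *: B) != 0) ->
  null (fun x => F (x *m (A + B)) * \det (A + B) - F (x *m A) * \det A).
Proof.
move=> [CF [L FL]] det0; have [C C0 HC] := path_bound det0.
pose L' := (Num.truncn (C * L%:R)).+1.
have HL' : C * L%:R <= L'%:R.
  have : 0 <= C * L%:R by rewrite mulr_ge0.
  by move=> /truncn_itv/andP[_ /ltW].
pose K := [set x : 'rV[R]_d | `|x| <= L'%:R].
have cK : closed K.
  rewrite (_ : K = (fun x : 'rV[R]_d => `|x|) @^-1` [set r | r <= L'%:R]) //.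
  by apply: preimage_closed (@closed_le R L'%:R) => x _; exact: norm_continuous.
have FK (s : R) x : 0 <= s <= 1 -> [set: 'rV[R]_d] x ->
    F (x *m A + s *: (x *m B)) != 0 -> K x.
  move=> s01 _ F0; rewrite /K/= (le_trans _ HL')// (le_trans (HC s x s01))//.
  rewrite ler_wpM2l// leNgt; apply: contra F0 => Lx.
  by rewrite scalemxAr -mulmxDr FL.
apply: null_ext (homotopy_affine openT cK (fun _ _ => I) (fun _ Kx => Kx)
  (Ck_mulmx 2 A openT) (Ck_mulmx 2 B openT) CF FK) => x.
rewrite !zero_extT// jac_mulmx -mulmxDr.
rewrite (_ : (fun z => _) = (fun z => z *m (A + B))) ?jac_mulmx//.
by apply/funext => z; rewrite mulmxDr.
Qed.

Lemma compact_C1_mulmx A c F : A \in unitmx -> compact_C1 F ->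
  compact_C1 (fun x => F (x *m A) * c).
Proof.
move=> uA [CF [L FL]]; split.
  apply: (Ck_mul openT _ (Ck_cst _ _ _)).
  exact: (Ck_comp openT openT (fun _ _ => I) CF (Ck_mulmx 1 A openT)).
pose C := d%:R * `|invmx A|.
have C0 : 0 <= C * L%:R by rewrite !mulr_ge0.
exists (Num.truncn (C * L%:R)).+1 => x.
have /andP[_ /lt_trans/[apply] Lx] := truncn_itv C0.
rewrite FL ?mul0r// ltNge; apply/negP => xA; move: Lx.
rewrite ltNge => /negP; apply.
rewrite -[in leLHS](mulmxK uA x) (le_trans (norm_mulmx _ _))//.
by rewrite mulrAC ler_wpM2l// mulr_ge0.
Qed.

Definition scales_volume A := forall F, compact_C1 F ->
  null (fun x => F (x *m A) * `|\det A| - F x).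

Lemma scales_volume_mul A B : B \in unitmx -> scales_volume A -> scales_volume B -> scales_volume (A *m B).
Proof.
move=> uB gA gB F cF; have cF' := compact_C1_mulmx `|\det B| uB cF.
apply: null_ext (null_trans (gA _ cF') (gB _ cF)) => x.
by rewrite det_mulmx normrM mulmxA -mulrA [`|\det B| * _]mulrC.
Qed.

(** A path of invertible matrices gives the formula with signed determinants; both ends have the
    same sign, and multiplying by it yields absolute values. *)
Lemma scales_volume_path A B : (forall s : R, 0 <= s <= 1 -> \det (A + s *: (B - A)) != 0) ->
  0 < \det A * \det B -> scales_volume A -> scales_volume B.
Proof.
move=> det0 AB gA F cF.
have H := linear_path cF det0; rewrite addrC subrK in H.
have sg : Num.sg (\det A) = Num.sg (\det B).
  have A0 : \det A != 0 by apply: contraTneq AB => ->; rewrite mul0r ltxx.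
  have : Num.sg (\det A * \det B) = 1 by rewrite gtr0_sg.
  rewrite sgrM => E; rewrite -[LHS]mulr1 -E mulrA -expr2.
  by rewrite sqr_sg A0 mul1r.
apply: null_trans (gA _ cF).
apply: null_ext (null_scale (Num.sg (\det A)) H) => x.
rewrite mulrBr mulrCA [in RHS]normrEsg -sg; congr (_ - _).
by rewrite mulrCA [in RHS]normrEsg.
Qed.

Lemma null_of_eq F G : (forall N, lattice_sum N F = lattice_sum N G) ->
  null (fun x => F x - G x).
Proof.
move=> E; rewrite /null (_ : (fun N => _) = fun=> 0); first exact: cvg_cst.
by apply/funext => N; rewrite lattice_sumB E subrr.
Qed.

Lemma scales_volume1 : scales_volume 1%:M.
Proof.
move=> F _; apply: null_of_eq => N; rewrite det1 normr1; congr lattice_sum.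
by apply/funext => x; rewrite mulmx1 mulr1.
Qed.

Lemma scales_volume_perm (s : 'S_d) : scales_volume (perm_mx s).
Proof.
move=> F _; rewrite det_perm normrX normrN1 expr1n.
by apply: null_of_eq => N; under eq_fun do rewrite mulr1; exact: lattice_sum_perm.
Qed.

Lemma scales_volume_sign (D : 'rV[R]_d) : (forall i, D 0 i != 0) ->
  scales_volume (diag_mx (\row_i Num.sg (D 0 i))).
Proof.
move=> D0 F _; rewrite det_diag normr_prod big1 ?mulr1; last first.
  by move=> i _; rewrite mxE normr_sg D0.
apply: null_of_eq => N; under eq_fun do rewrite mulr1.
rewrite -[RHS](lattice_sum_reflect N [set i | D 0 i < 0]%SET).
congr lattice_sum; apply/funext => x; congr F; apply/rowP => i.
rewrite mul_mx_diag !mxE inE; case: ltrgtP (D0 i) => // Di _.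
  by rewrite ltr0_sg// mulrN1.
by rewrite gtr0_sg// mulr1.
Qed.

Lemma scales_volume_lower A : (forall i j : 'I_d, (i <= j)%N -> A i j = (i == j)%:R) -> scales_volume A.
Proof.
move=> HA; apply: (scales_volume_path (A := 1%:M)) scales_volume1.
  move=> s _; rewrite det_trig.
    apply/prodf_neq0 => i _; rewrite !mxE eqxx HA// eqxx subrr mulr0 addr0.
    exact: oner_neq0.
  apply/is_trig_mxP => i j ij; rewrite !mxE HA ?(ltnW ij)//.
  by rewrite (negPf (_ : i != j)) ?subrr ?mulr0 ?addr0// neq_ltn ij.
rewrite det1 mul1r det_trig.
  by rewrite big1// => i _; rewrite HA// eqxx.
apply/is_trig_mxP => i j ij; rewrite HA ?(ltnW ij)//.
by rewrite (negPf (_ : i != j))// neq_ltn ij.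
Qed.

Lemma det_upper A : (forall i j : 'I_d, (j < i)%N -> A i j = 0) ->
  \det A = \prod_i A i i.
Proof.
move=> HA; rewrite -det_tr det_trig; first by apply: eq_bigr => i _; rewrite mxE.
by apply/is_trig_mxP => i j ij; rewrite mxE HA.
Qed.

(** A is joined linearly to the diagonal matrix of the signs of its diagonal, a reflection of the
    lattice: the path stays upper triangular and no diagonal entry crosses 0. *)
Lemma scales_volume_upper A : (forall i j : 'I_d, (j < i)%N -> A i j = 0) ->
  (forall i, A i i != 0) -> scales_volume A.
Proof.
move=> HA A0.
have A0' i : (\row_i A i i) 0 i != 0 by rewrite mxE.
pose D : 'M[R]_d := diag_mx (\row_i Num.sg ((\row_i A i i) 0 i)).
have uD (i j : 'I_d) : (j < i)%N -> D i j = 0.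
  by move=> ji; rewrite mxE (negPf (_ : i != j))// neq_ltn ji orbT.
apply: scales_volume_path (scales_volume_sign A0').
  move=> s /andP[s0 s1]; rewrite det_upper.
    apply/prodf_neq0 => i _; rewrite !mxE eqxx mulr1n.
    case: ltrgtP (A0 i) => // Ai _; rewrite ?(ltr0_sg Ai) ?(gtr0_sg Ai).
      by rewrite lt_eqF//; nra.
    by rewrite gt_eqF//; nra.
  move=> i j ji; rewrite mxE [X in _ + X]mxE [X in _ * X]mxE [X in _ * (_ + X)]mxE.
  by rewrite -/D (uD _ _ ji) (HA _ _ ji) oppr0 addr0 mulr0 addr0.
rewrite !det_upper// -big_split/=; apply: prodr_gt0 => i _.
by rewrite !mxE eqxx mulr1n -normrEsg normr_gt0.
Qed.

End LinearChange.

Lemma scales_volume_unitmx (R : realType) d (A : 'M[R]_d) : A \in unitmx -> scales_volume A.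
Proof.
(* The LUP decomposition is stated for positive size; in size 0 there is only the identity. *)
case: d A => [|n] A uA.
  have -> : A = 1%:M by apply/matrixP => -[].
  exact: scales_volume1.
have := cormen_lup_correct A; have := cormen_lup_perm A.
have := @cormen_lup_lower _ n A; have := @cormen_lup_upper _ n A.
case: (cormen_lup A) => [[P L] U] /= HU HL /is_perm_mxP[s Ps] E.
have gL : scales_volume L by exact: scales_volume_lower.
have dL : \det L = 1.
  rewrite det_trig; first by rewrite big1// => i _; rewrite HL// eqxx.
  apply/is_trig_mxP => i j ij; rewrite HL ?(ltnW ij)//.
  by rewrite (negPf (_ : i != j))// neq_ltn ij.
have uL : L \in unitmx by rewrite unitmxE dL unitr1.
have uP : P \in unitmx by rewrite Ps unitmx_perm.
have uU : U \in unitmx.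
  have : P *m A \in unitmx by rewrite unitmx_mul uP.
  by rewrite -[P *m A]/(P * A) E -[L * U]/(L *m U) unitmx_mul => /andP[].
have gU : scales_volume U.
  apply: scales_volume_upper => // i; move: uU; rewrite unitmxE det_upper// unitfE.
  by move/prodf_neq0 => /(_ i isT).
have -> : A = perm_mx s^-1 *m (L *m U).
  by rewrite -[L *m U]/(L * U) -E -[P * A]/(P *m A) Ps mulmxA -perm_mxM mulVg perm_mx1 mul1mx.
apply: scales_volume_mul; first by rewrite unitmx_mul uL.
  exact: scales_volume_perm.
exact: scales_volume_mul.
Qed.

(** * Local diffeomorphisms *)

Lemma sg_mul_near (R : realFieldType) (a b : R) : `|a - b| < `|a| -> Num.sg a * b = `|b|.
Proof.
have [a0|a0|->] := ltrgtP a 0; last by rewrite normr0 normr_lt0.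
  rewrite (ltr0_norm a0) (ltr0_sg a0) => /ltr_normlP[H1 H2].
  by rewrite mulN1r ltr0_norm//; lra.
rewrite (gtr0_norm a0) (gtr0_sg a0) => /ltr_normlP[H1 H2].
by rewrite mul1r gtr0_norm//; lra.
Qed.

Section LocalChange.
Variables (R : realType) (d : nat).
Implicit Types (F : 'rV[R]_d -> R) (A : 'M[R]_d) (x v : 'rV[R]_d).

Lemma jac_affine A v x : jac (fun z => z *m A + v) x = A.
Proof.
rewrite -[RHS](jac_mulmx A x); apply/matrixP => a b; rewrite !mxE.
have Cb : Ck 1 setT (fun z : 'rV[R]_d => (z *m A) 0 b).
  exact: (Ck_mxP _ _ openT).1 (Ck_mulmx 1 A openT) 0 b.
have -> : (fun z => (z *m A + v) 0 b) = (fun z => (z *m A) 0 b + v 0 b).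
  by apply/funext => z; rewrite mxE.
rewrite (@deriveD _ _ _ (fun z => (z *m A) 0 b) (fun=> v 0 b)).
- by rewrite derive_cst addr0.
- exact: (Ck_derivable _ Cb).
- exact: derivable_cst.
Qed.

Lemma Ck_affine k U A v : open U -> Ck k U (fun z : 'rV[R]_d => z *m A + v).
Proof. by move=> oU; exact: (Ck_add oU (Ck_mulmx k A oU) (Ck_cst _ _ _)). Qed.

Lemma supported_of_near (x0 : 'rV[R]_d) (r : R) F :
  (forall x, F x != 0 -> `|x - x0| <= r) -> exists L, supported L F.
Proof.
move=> H; exists (Num.truncn (`|x0| + `|r|)).+1 => x Lx.
apply/eqP; apply: contraTT Lx => /H xr; rewrite -leNgt.
have : 0 <= `|x0| + `|r| by rewrite addr_ge0.
move=> /truncn_itv/andP[_ /ltW]; apply: le_trans.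
by rewrite -(subrK x0 x) addrC (le_trans (ler_normD _ _))// lerD2l (le_trans xr)// ler_norm.
Qed.

Lemma closed_norm_le (x0 : 'rV[R]_d) (r : R) : closed [set x | `|x - x0| <= r].
Proof.
rewrite (_ : mkset _ = (fun x : 'rV[R]_d => `|x - x0|) @^-1` [set s | s <= r]) //.
apply: preimage_closed (@closed_le R r) => x _.
apply: (@continuous_comp _ _ _ (fun x => x - x0) (fun x : 'rV[R]_d => `|x|)).
  exact: (Ck_continuous (Ck_add openT
    (Ck_linear 0 setT (f := idfun) (fun s => @cvg_id _ (nbhs s))) (Ck_cst 0 setT (- x0)))).
exact: norm_continuous.
Qed.

Lemma open_norm_lt (x0 : 'rV[R]_d) (r : R) : open [set x | `|x - x0| < r].
Proof.
rewrite (_ : mkset _ = (fun x : 'rV[R]_d => `|x - x0|) @^-1` [set s | s < r]) //.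
apply: open_comp (@open_lt R r) => x _.
apply: (@continuous_comp _ _ _ (fun x => x - x0) (fun x : 'rV[R]_d => `|x|)).
  exact: (Ck_continuous (Ck_add openT
    (Ck_linear 0 setT (f := idfun) (fun s => @cvg_id _ (nbhs s))) (Ck_cst 0 setT (- x0)))).
exact: norm_continuous.
Qed.

Lemma null_translate v F : compact_C1 F -> null (fun x => F (x + v) - F x).
Proof.
move=> [CF [L FL]].
pose K := [set x : 'rV[R]_d | `|x - 0| <= (L + (Num.truncn `|v|).+1)%:R].
have KL x : K x -> `|x| <= (L + (Num.truncn `|v|).+1)%:R by rewrite /K/= subr0.
have FK (s : R) x : 0 <= s <= 1 -> [set: 'rV[R]_d] x ->
    F ((x *m 1%:M + 0) + s *: ((fun=> v) x)) != 0 -> K x.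
  move=> /andP[s0 s1] _; rewrite mulmx1 addr0 => F0.
  have xL : `|x + s *: v| <= L%:R by rewrite leNgt; apply: contra F0 => /FL ->.
  rewrite /K/= subr0 -(addrK (s *: v) x) (le_trans (ler_normB _ _))// natrD lerD//.
  have /truncn_itv/andP[_ /ltW] : 0 <= `|v| by [].
  by apply: le_trans; rewrite normrZ ger0_norm// ler_piMl.
have H := homotopy_affine openT (@closed_norm_le 0 _) (fun _ _ => I) KL
  (Ck_affine 2 1%:M 0 openT) (Ck_cst 2 setT v) CF FK.
apply: (null_ext _ H) => x; rewrite !zero_extT// jac_affine.
have -> : (fun z : 'rV[R]_d => z *m 1%:M + 0 + v) = (fun z => z *m 1%:M + v).
  by apply/funext => z; rewrite addr0.
by rewrite jac_affine det1 !mulr1 mulmx1 !addr0.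
Qed.

Lemma null_affine A v F : A \in unitmx -> compact_C1 F ->
  null (fun x => F (x *m A + v) * `|\det A| - F x).
Proof.
move=> uA cF; have [CF [L FL]] := cF.
have cFv : compact_C1 (fun x => F (x + v)).
  split.
    apply: (Ck_comp openT openT (fun _ _ => I) CF).
    by apply: (Ck_eq openT) (Ck_affine 1 1%:M v openT) => x _; rewrite mulmx1.
  apply: (@supported_of_near (- v) L%:R) => x F0.
  by rewrite opprK leNgt; apply: contra F0 => /FL ->.
exact: (null_trans (scales_volume_unitmx uA cFv) (null_translate v cF)).
Qed.

(** T is deformed to its affine approximation P along [P + s Q]. As A stretches by at least c and
    the error Q is at most c/2 times the distance to x0, points of [O] at distance more than r/2
    never reach the ball of radius e around T x0; the support of F along the deformation thus stays
    in a compact ball inside [O]. *)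
Lemma local_change (V : set 'rV[R]_d) (T : 'rV[R]_d -> 'rV[R]_d) x0 :
  open V -> Ck 2 V T -> V x0 -> \det (jac T x0) != 0 ->
  exists r e : R, [/\ 0 < r, 0 < e, forall x, `|x - x0| < r -> V x &
    forall F, Ck 1 setT F -> (forall y, F y != 0 -> `|y - T x0| < e) ->
      null (fun x => zero_ext [set x | `|x - x0| < r]
              (fun z => F (T z) * `|\det (jac T z)|) x - F x)].
Proof.
move=> oV CT Vx0 dA; set A := jac T x0 in dA *.
have uA : A \in unitmx by rewrite unitmxE unitfE.
pose c := (d%:R * `|invmx A| + 1)^-1.
have c0 : 0 < c by rewrite invr_gt0 ltr_wpDl// mulr_ge0.
have cA v : c * `|v| <= `|v *m A|.
  rewrite mulrC ler_pdivrMr ?ltr_wpDl ?mulr_ge0//.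
  rewrite -[in leLHS](mulmxK uA v) (le_trans (norm_mulmx _ _))//.
  by rewrite mulrAC mulrC ler_wpM2l// lerDl.
have c20 : 0 < c / 2 by rewrite divr_gt0.
have CTb (b : 'I_d) : Ck 2 V (fun z => T z 0 b) by exact: (Ck_mxP _ _ oV).1.
have estb (b : 'I_d) : nbhs (0 : 'rV[R]_d)
    [set h | `|T (x0 + h) 0 b - T x0 0 b - (h *m A) 0 b| <= c / 2 * `|h|].
  apply: filterS (C1_estimate oV (CkW (CTb b)) Vx0 c20) => h.
  have -> // : (h *m (grad (fun z => T z 0 b) x0)^T) 0 0 = (h *m A) 0 b.
  by rewrite !mxE; apply: eq_bigr => a _; rewrite !mxE.
have est : nbhs (0 : 'rV[R]_d) [set h | forall b : 'I_d,
    `|T (x0 + h) 0 b - T x0 0 b - (h *m A) 0 b| <= c / 2 * `|h|].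
  exact: (filter_forall _ estb).
have Cdet : Ck 1 V (fun z => \det (jac T z)).
  apply: (Ck_det oV) => a b.
  by apply: (Ck_eq (W := R) oV) (Ck_derive (delta_mx 0 a) (CTb b)) => z _; rewrite mxE.
have /(cvgrPdist_lt _ _).1/(_ `|\det A|) := Ck_continuous Cdet Vx0.
rewrite normr_gt0 => /(_ dA); rewrite -nbhs_nearE => /nbhs_ballP[r1 /= r10 Hr1].
have /nbhs_ballP[r2 /= r20 Hr2] := est.
have /nbhs_ballP[r3 /= r30 Hr3] : nbhs x0 V by apply: open_nbhs_nbhs.
(* The three radii secure the sign of the Jacobian determinant, the linear estimate and the domain
   V. *)
pose r := Num.min r1 (Num.min r2 r3).
have r0 : 0 < r by rewrite !lt_min r10 r20.
have Hr x : `|x - x0| < r -> [/\ V x, `|\det A - \det (jac T x)| < `|\det A| &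
    `|T x - T x0 - (x - x0) *m A| <= c / 2 * `|x - x0|].
  rewrite !lt_min => /and3P[x1 x2 x3]; split.
  - by apply: Hr3; rewrite -ball_normE/= distrC.
  - by apply: Hr1; rewrite -ball_normE/= distrC.
  apply: mx_norm_le => [|i b]; first by rewrite mulr_ge0// ltW.
  have := Hr2 (x - x0); rewrite -ball_normE/= sub0r normrN => /(_ x2)/(_ b).
  have -> : x0 + (x - x0) = x by rewrite addrC subrK.
  by rewrite (ord1 i) !mxE.
pose O := [set x | `|x - x0| < r].
pose K := [set x : 'rV[R]_d | `|x - x0| <= r / 2].
(* If the deformed map sends x0 + h into the ball of radius e, then c |h| < e + c |h| / 2, which for
   this e means |h| < r / 2. *)
pose e := c * r / 4.
have e0 : 0 < e by rewrite divr_gt0// mulr_gt0.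
exists r, e; split => // [x /Hr[]//|F CF Fe].
pose v := T x0 - x0 *m A.
pose P (x : 'rV[R]_d) := x *m A + v.
pose Q x := T x - P x.
have PE x : P x = T x0 + (x - x0) *m A.
  by rewrite /P /v mulmxBl addrCA addrA.
have oO : open O by exact: open_norm_lt.
have OV : O `<=` V by move=> x /Hr[].
have r2r : r / 2 < r by rewrite ltr_pdivrMr// ltr_pMr// ltr1n.
have KO : K `<=` O.
  by move=> x xr; exact: (le_lt_trans xr r2r).
have [L KL] : exists L : nat, forall x, K x -> `|x| <= L%:R.
  exists (Num.truncn (`|x0| + r)).+1 => x xr.
  have : 0 <= `|x0| + r by rewrite addr_ge0// ltW.
  move=> /truncn_itv/andP[_ /ltW]; apply: le_trans.
  rewrite -(subrK x0 x) addrC (le_trans (ler_normD _ _))// lerD2l.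
  exact: (le_trans xr (ltW r2r)).
have CP : Ck 2 O P by exact: Ck_affine.
have CTO : Ck 2 O T by exact: Ck_sub CT.
have CQ : Ck 2 O Q.
  apply/(Ck_mxP _ _ oO) => i b.
  have CTi := (Ck_mxP 2 T oO).1 CTO i b; have CPi := (Ck_mxP 2 P oO).1 CP i b.
  by apply: (Ck_eq (W := R) oO) (Ck_sub_fun oO CTi CPi) => z _; rewrite !mxE.
have FK (s : R) x : 0 <= s <= 1 -> O x -> F (P x + s *: Q x) != 0 -> K x.
  move=> /andP[s0 s1] /Hr[_ _ Ex] /Fe; rewrite /Q PE.
  set h := x - x0 in Ex *; set q := T x - _ => H.
  have qE : `|q| <= c / 2 * `|h| by rewrite /q opprD addrA.
  have : c * `|h| < e + c / 2 * `|h|.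
    apply: le_lt_trans (cA h) _.
    have -> : h *m A = (T x0 + h *m A + s *: q - T x0) - s *: q.
      by rewrite [RHS]addrAC addrK [T x0 + _]addrC addrK.
    apply: le_lt_trans (ler_normB _ _) _; rewrite ltr_leD// normrZ ger0_norm//.
    by apply: le_trans qE; rewrite ler_piMl.
  rewrite /K/= -/h /e => H'.
  have : c * `|h| < c * (r / 2) by lra.
  by rewrite ltr_pM2l// => /ltW.
have cF : compact_C1 F.
  by split=> //; apply: (@supported_of_near (T x0) e) => y /Fe/ltW.
have sgE x : O x -> Num.sg (\det A) * \det (jac T x) = `|\det (jac T x)|.
  by move=> /Hr[_ + _]; exact: sg_mul_near.
have PQ : (fun z => P z + Q z) = T by apply/funext => z; rewrite /Q addrC subrK.
have H := homotopy_affine oO (@closed_norm_le x0 (r / 2)) KO KL CP CQ CF FK.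
rewrite PQ in H.
apply: null_trans (null_affine v uA cF).
apply: (null_ext _ (null_scale (Num.sg (\det A)) H)) => x.
have [Ox|nOx] := pselect (O x).
  rewrite (zero_extT _ Ox) (zero_extT _ Ox) (zero_extT _ Ox) -/(P x) jac_affine -sgE//.
  rewrite [`|\det A|]normrEsg -[P x + Q x]/((fun z => P z + Q z) x) PQ.
  by rewrite mulrBr mulrCA [X in _ - X]mulrCA.
rewrite (zero_extF _ nOx) (zero_extF _ nOx) (zero_extF _ nOx) -/(P x).
have -> : F (P x) = 0; last by rewrite mul0r subrr mulr0.
apply/eqP; apply: contra_notT nOx => /Fe; rewrite PE addrC addKr => H'.
have : c * `|x - x0| < c * r.
  by apply: le_lt_trans (cA _) _; apply: lt_le_trans H' _; rewrite /e; nra.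
by rewrite ltr_pM2l.
Qed.

End LocalChange.

(** * Products of 2-forms *)

Section TopCoefficient.
Variables (R : realFieldType) (g : nat).
Local Notation n := (g + g)%N.

(* The coefficient of A_1 /\ ... /\ A_g on dx_1 /\ ... /\ dx_2g, up to a
   constant; the factor i occupies the slots lshift i and rshift i. *)
Definition wedge_top (A : 'I_g -> 'M[R]_n) : R :=
  \sum_(s : 'S_n) (-1) ^+ s * \prod_i A i (s (lshift g i)) (s (rshift g i)).

(** f chooses one entry of the matrix of each factor; [slot_fun] lists the chosen indices slot by
    slot. *)
Definition slot_fun e (f : {ffun 'I_g -> 'I_e * 'I_e}) (a : 'I_n) : 'I_e :=
  match fintype.split a with inl i => (f i).1 | inr i => (f i).2 end.

Definition slot_mx e (f : {ffun 'I_g -> 'I_e * 'I_e}) : 'M[R]_(n, e) :=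
  \matrix_(a, p) (slot_fun f a == p)%:R.

Lemma slot_funl e (f : {ffun 'I_g -> 'I_e * 'I_e}) i : slot_fun f (lshift g i) = (f i).1.
Proof. by rewrite /slot_fun -[lshift g i]/(unsplit (inl i)) unsplitK. Qed.

Lemma slot_funr e (f : {ffun 'I_g -> 'I_e * 'I_e}) i : slot_fun f (rshift g i) = (f i).2.
Proof. by rewrite /slot_fun -[rshift g i]/(unsplit (inr i)) unsplitK. Qed.

(** A Cauchy-Binet expansion: once an entry of every [W i] is chosen, the alternating sum over s is
    the determinant of the chosen columns of X. *)
Lemma wedge_top_pullback e (X : 'M[R]_(n, e)) (W : 'I_g -> 'M[R]_e) :
  wedge_top (fun i => X *m W i *m X^T) =
  \sum_(f : {ffun 'I_g -> 'I_e * 'I_e})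
     (\prod_i W i (f i).1 (f i).2) * \det (slot_mx f *m X^T).
Proof.
have XWX i a b : (X *m W i *m X^T) a b =
    \sum_(pq : 'I_e * 'I_e) W i pq.1 pq.2 * (X a pq.1 * X b pq.2).
  rewrite mxE -(pair_big xpredT xpredT (fun p q => W i p q * (X a p * X b q)))/=.
  rewrite exchange_big; apply: eq_bigr => q _; rewrite !mxE big_distrl/=.
  by apply: eq_bigr => p _; ring.
transitivity (\sum_(s : 'S_n) \sum_(f : {ffun 'I_g -> 'I_e * 'I_e})
   (-1) ^+ s * ((\prod_i W i (f i).1 (f i).2) *
     \prod_a X (s a) (slot_fun f a))).
  apply: eq_bigr => s _; rewrite -big_distrr/=; congr (_ * _).
  under eq_bigr do rewrite XWX.
  rewrite bigA_distr_bigA /=; apply: eq_bigr => f _.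
  rewrite big_split/=; congr (_ * _); rewrite big_split_ord/= -big_split/=.
  by apply: eq_bigr => i _; rewrite slot_funl slot_funr.
rewrite exchange_big/=; apply: eq_bigr => f _.
under eq_bigr do rewrite mulrCA.
rewrite -big_distrr/=; congr (_ * _); apply: eq_bigr => s _; congr (_ * _).
apply: eq_bigr => a _; rewrite mxE (bigD1 (slot_fun f a))//= !mxE eqxx mul1r.
by rewrite big1 ?addr0// => p /negPf; rewrite !mxE eq_sym => ->; rewrite mul0r.
Qed.

(** The determinants in the expansion factor through dimension e < 2g: a top form pulled back from a
    smaller space is 0. *)
Lemma wedge_top_degenerate e (X : 'M[R]_(n, e)) (W : 'I_g -> 'M[R]_e) :
  (e < n)%N -> wedge_top (fun i => X *m W i *m X^T) = 0.
Proof.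
move=> en; rewrite wedge_top_pullback big1// => f _.
have -> : \det (slot_mx f *m X^T) = 0; last by rewrite mulr0.
apply/eqP; apply: contraTT en => d0; rewrite -leqNgt.
have u : slot_mx f *m X^T \in unitmx by rewrite unitmxE unitfE.
rewrite -(mxrank_unit u) (leq_trans (mxrankM_maxl _ _))//.
exact: rank_leq_col.
Qed.

Lemma wedge_top_congr (X : 'M[R]_n) (W : 'I_g -> 'M[R]_n) :
  wedge_top (fun i => X *m W i *m X^T) = \det X * wedge_top W.
Proof.
have -> : wedge_top W = wedge_top (fun i => 1%:M *m W i *m (1%:M)^T).
  by apply: eq_bigr => s _; congr (_ * _); apply: eq_bigr => i _; rewrite trmx1 mulmx1 mul1mx.
rewrite !wedge_top_pullback big_distrr/=; apply: eq_bigr => f _.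
by rewrite trmx1 mulmx1 det_mulmx det_tr [LHS]mulrA [RHS]mulrC.
Qed.

Lemma eq_wedge_top (A B : 'I_g -> 'M[R]_n) : (forall i, A i = B i) ->
  wedge_top A = wedge_top B.
Proof. by move=> AB; congr wedge_top; apply/funext. Qed.

(** The telescoping A^g - B^g = sum_k A^k (A - B) B^(g-1-k). *)
Lemma wedge_top_sub (A B : 'M[R]_n) :
  wedge_top (fun=> A) - wedge_top (fun=> B) =
  \sum_(k < g) wedge_top (fun i => if (i < k)%N then A else if i == k then A - B else B).
Proof.
pose H k := wedge_top (fun i : 'I_g => if (i < k)%N then A else B).
have -> : wedge_top (fun=> A) = H g by apply: eq_wedge_top => i; rewrite ltn_ord.
have -> : wedge_top (fun=> B) = H 0%N by apply: eq_wedge_top => i.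
rewrite -telescope_sumr// big_mkord; apply: eq_bigr => k _.
rewrite /H /wedge_top -sumrB; apply: eq_bigr => s _; rewrite -mulrBr; congr (_ * _).
rewrite (bigD1 k)//= [X in _ - X](bigD1 k)//= [RHS](bigD1 k)//=.
rewrite ltnS leqnn ltnn eqxx mxE [X in _ = (_ + X) * _]mxE.
have E (P Q : 'I_g -> 'M[R]_n) : (forall i, i != k -> P i = Q i) ->
    \prod_(i < g | i != k) P i (s (lshift g i)) (s (rshift g i)) =
    \prod_(i < g | i != k) Q i (s (lshift g i)) (s (rshift g i)).
  by move=> PQ; apply: eq_bigr => i /PQ ->.
rewrite (E (fun i => if (i < k.+1)%N then A else B) (fun i => if (i < k)%N then A else B)).
  rewrite [in RHS](E _ (fun i => if (i < k)%N then A else B)) ?mulrBl//.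
  by move=> i /negPf ->.
by move=> i /negPf ik; rewrite ltnS leq_eqVlt val_eqE ik.
Qed.

Lemma wedge_top_split (k : 'I_g) (I : Type) (r : seq I) (C : I -> 'M[R]_n)
    (A : 'I_g -> 'M[R]_n) :
  wedge_top (fun i => if i == k then \sum_(j <- r) C j else A i) =
  \sum_(j <- r) wedge_top (fun i => if i == k then C j else A i).
Proof.
rewrite /wedge_top exchange_big/=; apply: eq_bigr => s _.
rewrite -big_distrr/=; congr (_ * _).
rewrite (bigD1 k)//= eqxx summxE big_distrl/=; apply: eq_bigr => j _.
rewrite [RHS](bigD1 k)//= eqxx; congr (_ * _).
by apply: eq_bigr => i /negPf ->.
Qed.

Definition std_mx m : 'M[R]_(m + m) := block_mx 0 1%:M (- 1%:M) 0.

(** The index (j, false) stands for the term dx_j (x) dy_j and (j, true) for - dy_j (x) dx_j; powers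
    of the form then expand over choices of such indices. *)
Lemma std_mxE (a b : 'I_n) : std_mx g a b =
  \sum_(jb : 'I_g * bool) (-1) ^+ jb.2 *
    ((a == if jb.2 then rshift g jb.1 else lshift g jb.1) &&
     (b == if jb.2 then lshift g jb.1 else rshift g jb.1))%:R.
Proof.
rewrite -(pair_big xpredT xpredT (fun (j : 'I_g) (t : bool) => (-1) ^+ t *
    ((a == if t then rshift g j else lshift g j) &&
     (b == if t then lshift g j else rshift g j))%:R : R))/=.
under eq_bigr do rewrite big_bool/= expr1 expr0 mul1r mulN1r.
rewrite -[a]splitK -[b]splitK; case: (fintype.split a) => i; case: (fintype.split b) => j /=.
- rewrite block_mxEul mxE big1// => k _.
  by rewrite !eq_lrshift andbF oppr0 addr0.
- rewrite block_mxEur mxE (bigD1 i)//= !eq_lrshift !eq_lshift !eq_rshift eqxx oppr0 add0r.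
  rewrite big1 ?addr0 1?eq_sym// => k /negPf ki.
  by rewrite !eq_lrshift !eq_lshift [i == k]eq_sym ki oppr0 addr0.
- rewrite block_mxEdl !mxE (bigD1 i)//= !eq_rlshift !eq_lshift !eq_rshift eqxx addr0.
  rewrite big1 ?addr0 1?eq_sym// => k /negPf ki.
  by rewrite !eq_rlshift !eq_rshift [i == k]eq_sym ki oppr0 addr0.
- rewrite block_mxEdr mxE big1// => k _.
  by rewrite !eq_rlshift andbF oppr0 addr0.
Qed.

Lemma det_flip (D0 D1 : 'M[R]_g) :
  \det (block_mx D0 D1 D1 D0) = \det (D0 + D1) * \det (D0 - D1).
Proof.
pose P : 'M[R]_n := block_mx 1%:M 1%:M 0 1%:M.
pose Q : 'M[R]_n := block_mx 1%:M (- 1%:M) 0 1%:M.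
have dP : \det P = 1 by rewrite det_ublock !det1 mulr1.
have dQ : \det Q = 1 by rewrite det_ublock !det1 mulr1.
rewrite -[LHS]mul1r -dP -det_mulmx -[LHS]mulr1 -dQ -det_mulmx.
rewrite /P /Q !mulmx_block !mul1mx !mul0mx !mulmx1 !mulmx0 !addr0 !add0r.
rewrite !mulmxN !mulmx1.
have -> : - (D0 + D1) + (D1 + D0) = 0 by rewrite addrC [D1 + D0]addrC subrr.
by rewrite det_lblock [- D1 + D0]addrC.
Qed.

(** Exchanging the two indices of a pair changes the sign of both the coefficient and the
    determinant, so every term of the expansion is a square, and the choice f i = (i, false)
    contributes 1. Positivity replaces an exact evaluation. *)
Lemma wedge_top_std : wedge_top (fun=> std_mx g) != 0.
Proof.
pose pt (jb : 'I_g * bool) := if jb.2 then rshift g jb.1 else lshift g jb.1.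
pose pt' (jb : 'I_g * bool) := if jb.2 then lshift g jb.1 else rshift g jb.1.
pose E (f : {ffun 'I_g -> 'I_g * bool}) : R :=
  \sum_(s : 'S_n) (-1) ^+ s *
    \prod_i (((s (lshift g i) == pt (f i)) && (s (rshift g i) == pt' (f i)))%:R : R).
have -> : wedge_top (fun=> std_mx g) =
    \sum_(f : {ffun 'I_g -> 'I_g * bool}) (\prod_i (-1) ^+ (f i).2) * E f.
  transitivity (\sum_(s : 'S_n) \sum_(f : {ffun 'I_g -> 'I_g * bool})
    (-1) ^+ s * ((\prod_i (-1) ^+ (f i).2) *
     \prod_i (((s (lshift g i) == pt (f i)) && (s (rshift g i) == pt' (f i)))%:R : R))).
    apply: eq_bigr => s _; rewrite -big_distrr/=; congr (_ * _).
    under eq_bigr do rewrite std_mxE.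
    by rewrite bigA_distr_bigA /=; apply: eq_bigr => f _; rewrite big_split.
  rewrite exchange_big/=; apply: eq_bigr => f _.
  under eq_bigr do rewrite mulrCA.
  by rewrite -big_distrr.
have EE (f : {ffun 'I_g -> 'I_g * bool}) : (\prod_i (-1) ^+ (f i).2) * E f =
    \det (\matrix_(i, j) ((f i).1 == j)%:R : 'M[R]_g) ^+ 2.
  set K : 'M[R]_g := \matrix_(i, j) _.
  pose D0 : 'M[R]_g := diag_mx (\row_i (~~ (f i).2)%:R).
  pose D1 : 'M[R]_g := diag_mx (\row_i ((f i).2)%:R).
  (* [K] records which coordinate pair each factor uses, [D0] and [D1] whether its two slots are in
     order or exchanged. *)
  have -> : E f = \det (block_mx D0 D1 D1 D0 *m block_mx K 0 0 K).
    apply: eq_bigr => s _; congr (_ * _); rewrite big_split_ord/= -big_split/=.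
    apply: eq_bigr => i _; rewrite mulmx_block !mulmx0 !addr0 !add0r.
    rewrite -[s (lshift g i)]splitK -[s (rshift g i)]splitK /pt /pt'.
    case: (fintype.split (s (lshift g i))) => a; case: (fintype.split (s (rshift g i))) => b /=;
      rewrite ?block_mxEul ?block_mxEur ?block_mxEdl ?block_mxEdr !mul_diag_mx !mxE;
      case: (f i).2; rewrite ?eq_lrshift ?eq_rlshift ?eq_lshift ?eq_rshift /= ?mul0r ?mul1r ?mulr0 ?andbF//;
      by rewrite -natrM mulnb; congr (_%:R); congr (_ && _); rewrite eq_sym.
  rewrite det_mulmx det_flip det_ublock -expr2 mulrA.
  have -> : D0 + D1 = 1%:M.
    apply/matrixP => i j; rewrite !mxE -mulrnDl; congr (_ *+ _).
    by case: (f i).2; rewrite ?add0r ?addr0.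
  have -> : \det (D0 - D1) = \prod_i (-1) ^+ (f i).2.
    have -> : D0 - D1 = diag_mx (\row_i (-1) ^+ (f i).2).
      apply/matrixP => i j; rewrite !mxE -mulrnBl; congr (_ *+ _).
      by case: (f i).2; rewrite ?sub0r ?subr0.
    by rewrite det_diag; apply: eq_bigr => i _; rewrite mxE.
  rewrite det1 mul1r -expr2 -prodrXl (_ : \prod_i _ = 1) ?mul1r//.
  by rewrite big1// => i _; rewrite sqrr_sign.
rewrite (eq_bigr _ (fun f _ => EE f)) gt_eqF//.
rewrite (bigD1 [ffun i => (i, false)])//= ltr_pwDl ?sumr_ge0//; last first.
  by move=> f _; rewrite sqr_ge0.
rewrite (_ : \matrix_(i, j) _ = 1%:M) ?det1 ?expr1n ?ltr01//.
by apply/matrixP => i j; rewrite !mxE ffunE.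
Qed.

Lemma ltn_add_self (a b : nat) : (a < b)%N -> (a + a < b + b)%N.
Proof. by rewrite !addnn ltn_double. Qed.

(** Symplectic Gram-Schmidt: the rows of U and V form k pairs of a partial symplectic basis,
    extended by a pair (w, y) that is A-orthogonal to them. *)
Lemma symplectic_basis (A : 'M[R]_n) : A^T = - A -> A \in unitmx ->
  exists Q : 'M[R]_n, Q *m A *m Q^T = std_mx g.
Proof.
move=> skA uA.
have sk p q (X : 'M[R]_(p, n)) (Y : 'M[R]_(q, n)) : (X *m A *m Y^T)^T = - (Y *m A *m X^T).
  by rewrite !trmx_mul trmxK skA mulNmx mulmxN mulmxA.
suff [U [V [UU VV UV]]] : exists U V : 'M[R]_(g, n),
    [/\ U *m A *m U^T = 0, V *m A *m V^T = 0 & U *m A *m V^T = 1%:M].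
  exists (col_mx U V); rewrite tr_col_mx mul_col_mx mul_col_row UU VV UV.
  by rewrite -[V *m A *m U^T]opprK -sk UV trmx1.
have : forall k, (k <= g)%N -> exists U V : 'M[R]_(k, n),
    [/\ U *m A *m U^T = 0, V *m A *m V^T = 0 & U *m A *m V^T = 1%:M]; last exact.
elim=> [_|k IH kg].
  by exists 0, 0; split; rewrite ?mul0mx//; apply/matrixP => -[].
have [U [V [UU VV UV]]] := IH (ltnW kg).
have VU : V *m A *m U^T = - 1%:M by rewrite -[LHS]opprK -sk UV trmx1.
(* Z has 2k < 2g columns, so some nonzero w is A-orthogonal to all rows of U and V. *)
pose Z := A *m (col_mx U V)^T.
have : kermx Z != 0.
  rewrite -mxrank_eq0 mxrank_ker subn_eq0 -ltnNge.
  exact: (leq_ltn_trans (rank_leq_col _) (ltn_add_self kg)).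
move=> /rowV0Pn[w /sub_kermxP wZ w0].
have {wZ} : w *m A *m (row_mx U^T V^T) = 0 by rewrite -mulmxA -tr_col_mx.
rewrite mul_mx_row => /eqP; rewrite row_mx_eq0 => /andP[/eqP wU /eqP wV].
have wA : w *m A != 0 by apply: contraNneq w0 => wA; rewrite -(mulmxK uA w) wA mul0mx.
have /rV0Pn[j wj] := wA.
pose y0 : 'rV[R]_n := ((w *m A) 0 j)^-1 *: delta_mx 0 j.
have wy0 : w *m A *m y0^T = 1%:M.
  rewrite /y0; move: (w *m A) wj => z zj.
  rewrite linearZ/= -scalemxAr trmx_delta -colE; apply/matrixP => a b.
  by rewrite !mxE (ord1 a) (ord1 b) eqxx mulVf.
(* The components of y0 along U and V are removed; the signs differ because U A V^T = 1 while V A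
   U^T = -1. *)
pose y := y0 - (y0 *m A *m V^T) *m U + (y0 *m A *m U^T) *m V.
have as4 p q (z : 'rV[R]_q) (Y : 'M[R]_(q, n)) (X : 'M[R]_(p, n)) :
    z *m Y *m A *m X^T = z *m (Y *m A *m X^T) by rewrite !mulmxA.
have yU : y *m A *m U^T = 0.
  by rewrite /y !mulmxDl !mulNmx !as4 UU VU mulmx0 subr0 mulmxN mulmx1 subrr.
have yV : y *m A *m V^T = 0.
  by rewrite /y !mulmxDl !mulNmx !as4 VV UV mulmx0 addr0 mulmx1 subrr.
have wy : w *m A *m y^T = 1%:M.
  have -> : y^T = y0^T - U^T *m (y0 *m A *m V^T)^T + V^T *m (y0 *m A *m U^T)^T.
    by rewrite /y [LHS]linearD/= [X in X + _]linearB/= !(trmx_mul _ U) !(trmx_mul _ V).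
  rewrite !mulmxDr mulmxN (mulmxA _ U^T) (mulmxA _ V^T).
  by rewrite wU wV !mul0mx subr0 addr0 wy0.
have self (z : 'rV[R]_n) : z *m A *m z^T = 0.
  apply/matrixP => a b; rewrite (ord1 a) (ord1 b).
  have := congr1 (fun M : 'M[R]_1 => M 0 0) (sk _ _ z z); rewrite mxE [RHS]mxE => /eqP.
  move=> /eqP E; rewrite [RHS]mxE; move: E.
  by move: ((z *m A *m z^T) 0 0) => c E; lra.
have tr0 p q (X : 'M[R]_(p, n)) (Y : 'M[R]_(q, n)) :
    X *m A *m Y^T = 0 -> Y *m A *m X^T = 0.
  by move=> XY; rewrite -[LHS]opprK -sk XY trmx0 oppr0.
rewrite -addn1; exists (col_mx U w), (col_mx V y); split.
- rewrite tr_col_mx mul_col_mx mul_col_row UU wU (self w) (tr0 _ _ _ _ wU).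
  exact: block_mx0.
- rewrite tr_col_mx mul_col_mx mul_col_row VV yV (self y) (tr0 _ _ _ _ yV).
  exact: block_mx0.
- rewrite tr_col_mx mul_col_mx mul_col_row UV wV wy (tr0 _ _ _ _ yU).
  by rewrite -scalar_mx_block.
Qed.

Lemma wedge_top_neq0 (A : 'M[R]_n) : A^T = - A -> A \in unitmx ->
  wedge_top (fun=> A) != 0.
Proof.
move=> skA uA; have [Q QA] := symplectic_basis skA uA.
have := wedge_top_std; rewrite (eq_wedge_top (B := fun=> Q *m A *m Q^T)).
  by rewrite wedge_top_congr mulf_eq0 negb_or => /andP[].
by move=> i; rewrite QA.
Qed.

End TopCoefficient.

(** * Stokes theorem in a chart *)

Section ExactForms.
Variables (R : realType).

(** Stokes for y times a product of closed forms: the differential is the divergence of the field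
    with components y [slot_sum], which inherits the compact support of y. *)
Lemma alternating_null n (J : finType) (a0 : 'I_n) (U K : set 'rV[R]_n) (L : nat)
    (y : 'rV[R]_n -> R) (w : J -> 'S_n -> 'rV[R]_n -> R) (P : J -> seq 'S_n) :
  open U -> closed K -> K `<=` U -> (forall x, K x -> `|x| <= L%:R) ->
  Ck 1 U y -> (forall j s, Ck 1 U (w j s)) -> (forall x, U x -> y x != 0 -> K x) ->
  (forall j, 0 < size (P j))%N ->
  (forall i j p s, p \in P j -> i != j -> w i (p * s)%g = w i s) ->
  (forall x, U x -> forall j s, \sum_(p <- P j) (-1) ^+ p *
     'D_(delta_mx 0 ((p * s)%g a0)) (w j (p * s)%g) x = 0) ->
  null (zero_ext U (fun x =>
    \sum_(s : 'S_n) (-1) ^+ s * ('D_(delta_mx 0 (s a0)) y x * \prod_j w j s x))).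
Proof.
move=> oU cK KU KL Cy Cw yK P0 Pw Pd.
pose Z a := zero_ext U (fun p => y p * slot_sum a0 w a p).
have CZ a : Ck 1 setT (Z a).
  apply: (Ck_zero_ext oU cK KU _ _).
    by move=> p Up; rewrite mulf_eq0 negb_or => /andP[]; move=> /(yK p Up).
  exact: (Ck_mul oU Cy (Ck_slot_sum a0 oU Cw a)).
have ZL a : supported L (Z a).
  move=> x Lx; have [Ux|nUx] := pselect (U x); last by rewrite /Z zero_extF.
  rewrite /Z zero_extT//; have [/eqP ->|/(yK x Ux)/KL] := boolP (y x == 0).
    by rewrite mul0r.
  by rewrite leNgt Lx.
have H : null (fun x => \sum_a 'D_(delta_mx 0 a) (Z a) x).
  apply: (@null_sum R n _ _ _ (fun a => 'D_(delta_mx 0 a) (Z a))) => a _.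
  exact: null_derive.
apply: (null_ext _ H) => x.
have [Ux|nUx] := pselect (U x); last first.
  rewrite (zero_extF _ nUx); apply: big1 => a _.
  rewrite (near_eq_derive (g := fun=> 0)) ?derive_cst//.
  have : nbhs x (~` K) by apply: open_nbhs_nbhs; split; [exact: closed_openC|move=> /KU].
  apply: filterS => q nKq.
  have [Uq|nUq] := pselect (U q); last by rewrite /Z zero_extF.
  rewrite /Z zero_extT//; apply/eqP; apply: contra_notT nKq.
  by rewrite mulf_eq0 negb_or => /andP[]; move=> /(yK q Uq).
rewrite (zero_extT _ Ux) -(alternating_divergence (P := P))//.
- exact: (sum_derive_slot a0 oU Cy Cw Ux).
- by move=> v; exact: (Ck_derivable _ Cy Ux).
- by move=> j s v; exact: (Ck_derivable _ (Cw j s) Ux).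
- exact: Pd.
Qed.

Variable g : nat.
Local Notation n := (g + g)%N.

Definition closed_form (U : set 'rV[R]_n) (A : 'rV[R]_n -> 'M[R]_n) :=
  forall x, U x -> forall a b c,
    'D_(delta_mx 0 a) (fun y => A y b c) x + 'D_(delta_mx 0 b) (fun y => A y c a) x
    + 'D_(delta_mx 0 c) (fun y => A y a b) x = 0.

(* The coefficient of A_1 /\ ... /\ du /\ dy /\ ... /\ A_g, the factor k being
   replaced; wedge_top antisymmetrizes du (x) dy. *)
Definition with_exact (k : 'I_g) (u y : 'rV[R]_n -> R) (A : 'I_g -> 'rV[R]_n -> 'M[R]_n) x :=
  wedge_top (fun i => if i == k then (grad u x)^T *m grad y x else A i x).

(** Up to sign, du /\ dy /\ rest is the differential of y du /\ rest, the rest being closed. The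
    slot of dy serves as the free slot [a0], so the factor k keeps only du. *)
Lemma exact_null (k : 'I_g) (U K : set 'rV[R]_n) (L : nat) u y
    (A : 'I_g -> 'rV[R]_n -> 'M[R]_n) :
  open U -> closed K -> K `<=` U -> (forall x, K x -> `|x| <= L%:R) ->
  Ck 2 U u -> Ck 1 U y -> (forall x, U x -> y x != 0 -> K x) ->
  (forall i, i != k -> Ck 1 U (A i) /\ closed_form U (A i)) ->
  null (zero_ext U (with_exact k u y A)).
Proof.
move=> oU cK KU KL Cu Cy yK HA.
pose a0 : 'I_n := rshift g k.
pose l (i : 'I_g) : 'I_n := lshift g i; pose r (i : 'I_g) : 'I_n := rshift g i.
pose w (j : 'I_g) (s : 'S_n) : 'rV[R]_n -> R :=
  if j == k then 'D_(delta_mx 0 (s (l k))) u else fun x => A j x (s (l j)) (s (r j)).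
(* For the 1-form du a transposition antisymmetrizes; for a 2-form [A j] the three cyclic
   permutations of the slots [a0], [l j], [r j] give exactly the three terms of its exterior
   derivative. *)
pose P (j : 'I_g) : seq 'S_n := if j == k then [:: 1%g; tperm a0 (l k)] else
  [:: 1%g; (tperm a0 (l j) * tperm a0 (r j))%g; (tperm a0 (r j) * tperm a0 (l j))%g].
have lr i j : (l i == r j) = false by rewrite /l /r eq_lrshift.
have rl i j : (r i == l j) = false by rewrite /l /r eq_rlshift.
have Cw j s : Ck 1 U (w j s).
  rewrite /w; case: (eqVneq j k) => [_|jk]; first exact: Ck_derive.
  exact: (Ck_mxP _ _ oU).1 (HA j jk).1 _ _.
apply: (null_ext _ (alternating_null (a0 := a0) (P := P) oU cK KU KL Cy Cw yK _ _ _)).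
- move=> x; apply: zero_ext_eq => _; rewrite /with_exact /wedge_top.
  apply: eq_bigr => s _; congr (_ * _).
  rewrite (bigD1 k)//= [RHS](bigD1 k)//= /w eqxx mulrA; congr (_ * _).
    by rewrite mxE big_ord1 !mxE mulrC.
  by apply: eq_bigr => j /negPf ->.
- by move=> j; rewrite /P; case: (j == k).
- move=> i j p s; rewrite /P /w.
  case: (eqVneq j k) => [->|jk].
    rewrite !inE => /orP[] /eqP -> ik; first by rewrite mul1g.
    rewrite (negPf ik) !permM !tpermD ?lr ?rl//.
    + by rewrite eq_rshift eq_sym.
    + by rewrite eq_lshift eq_sym.
  move=> pP ij.
  have fixp q : a0 != q -> l j != q -> r j != q -> p q = q.
    by move: pP; rewrite !inE => /or3P[] /eqP -> q1 q2 q3; rewrite ?perm1 ?permM ?tpermD.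
  have pl : p (l i) = l i by rewrite fixp ?rl// eq_lshift eq_sym.
  case: (eqVneq i k) => [ik|ik]; first by rewrite permM -ik pl.
  have pr : p (r i) = r i by rewrite fixp ?lr// eq_rshift eq_sym.
  by rewrite !permM pl pr.
- move=> x Ux j s.
  pose f (q : 'S_n) : R := (-1) ^+ q * 'D_(delta_mx 0 ((q * s)%g a0)) (w j (q * s)%g) x.
  have f1 : f 1%g = 'D_(delta_mx 0 (s a0)) (w j s) x.
    by rewrite /f mul1g odd_perm1 expr0 mul1r.
  rewrite /P; case: (eqVneq j k) => [jk|jk].
    transitivity (f 1%g + f (tperm a0 (l k))); first by rewrite big_cons big_seq1.
    rewrite f1 /f odd_tperm rl expr1 mulN1r /w jk eqxx !permM tpermL tpermR.
    by rewrite (derive_comm _ _ oU Cu Ux) subrr.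
  transitivity (f 1%g + (f (tperm a0 (l j) * tperm a0 (r j))%g +
    f (tperm a0 (r j) * tperm a0 (l j))%g)); first by rewrite !big_cons big_nil addr0.
  have rk : (a0 == r j) = false by rewrite /a0 /r eq_rshift eq_sym (negPf jk).
  have kr : (r j == a0) = false by rewrite eq_sym rk.
  have al : (a0 == l j) = false by exact: rl.
  have la : (l j == a0) = false by exact: lr.
  rewrite f1 /f !odd_permM !odd_tperm al rk /= expr0 !mul1r /w (negPf jk) !permM.
  have t1r : tperm a0 (l j) (r j) = r j by rewrite tpermD ?rk ?lr.
  have t2l : tperm a0 (r j) (l j) = l j by rewrite tpermD ?al ?rl.
  rewrite !tpermL t1r t2l !tpermR !tpermL -/(l j) -/(r j).
  have := (HA j jk).2 x Ux (s a0) (s (l j)) (s (r j)); rewrite -addrA.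
  by [].
Qed.

End ExactForms.

(** * Partitions of unity *)

Section Bump.
Variable R : realType.

Lemma is_derive_norm_mul (t : R) : is_derive t (1 : R) (fun s : R => `|s| * s) (2 * `|t|).
Proof.
have [t0|t0|->] := ltrgtP t 0.
- have E : \near t, t * - t = `|t| * t.
    have : \forall s \near t, s < 0 by apply: lt_nbhsl.
    by apply: filterS => s s0; rewrite ltr0_norm// mulrC.
  apply: near_eq_is_derive E _.
  have H : is_derive t 1 (fun s : R => s * - s) (t *: - 1 + - t *: 1).
    exact: (is_deriveM (f := id) (g := -%R)).
  apply: is_derive_eq; rewrite ltr0_norm// /GRing.scale/=; ring.
- have E : \near t, t * t = `|t| * t.
    have : \forall s \near t, 0 < s by apply: lt_nbhsr.
    by apply: filterS => s s0; rewrite gtr0_norm.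
  apply: near_eq_is_derive E _.
  have H : is_derive t 1 (fun s : R => s * s) (t *: 1 + t *: 1).
    exact: (is_deriveM (f := id) (g := id)).
  apply: is_derive_eq; rewrite gtr0_norm// /GRing.scale/=; ring.
- rewrite normr0 mulr0.
  set F := fun s : R => `|s| * s.
  have E (e : R) : e^-1 *: ((F \o shift 0) (e *: (1 : R)) - F 0) = e^-1 * (`|e| * e).
    by rewrite /F /= addr0 mulr0 subr0 [e *: 1]mulr1.
  have L : (fun e : R => e^-1 *: ((F \o shift 0) (e *: (1 : R)) - F 0)) @ (0 : R)^' --> (0 : R).
    apply/cvgrPdist_lt => e e0; near=> d.
    have d0 : d != 0 by near: d; exact: nbhs_dnbhs_neq.
    rewrite E mulrCA mulVf// mulr1 sub0r normrN normr_id.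
    by near: d; exact: dnbhs0_lt.
  apply: DeriveDef; last exact: cvg_lim L.
  by rewrite /derivable; apply/cvg_ex; exists 0.
Unshelve. all: by end_near. Qed.

Lemma derive_scalar (F : R -> R) (l : R) (v t : R) :
  is_derive t (1 : R) F l -> derivable F t v /\ 'D_v F t = v * l.
Proof.
move=> [D E]; have d := (derivable1_diffP _ _).1 D.
split; first exact: diff_derivable.
rewrite deriveE// -E deriveE//.
by rewrite -[v in LHS]mulr1 -[v * 1]/(v *: (1 : R)) linearZ.
Qed.

Lemma Ck_scalar k (F dF : R -> R) :
  (forall t, is_derive t (1 : R) F (dF t)) -> Ck k setT dF -> Ck k.+1 setT F.
Proof.
move=> D C; split.
  move=> x _; apply: differentiable_continuous; apply/derivable1_diffP.
  by case: (D x).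
move=> v; split; first by move=> x _; have [] := derive_scalar v (D x).
apply: (Ck_eq (W := R) openT _ (Ck_mul openT (Ck_cst _ _ v) C)).
by move=> x _; have [_ ->] := derive_scalar v (D x).
Qed.

(** This is 2 t^3 for t >= 0 and 0 for t <= 0, of class C^2, as required of a cutoff inside a
    differential. *)
Definition cubic_ramp (t : R) : R := (t + `|t|) * (t * t).

Lemma Ck_cubic_ramp : Ck 2 setT cubic_ramp.
Proof.
have C0 : Ck 0 setT (fun t : R => 2 * `|t|).
  by split=> // x _; apply: cvgMl_tmp; exact: norm_continuous.
have C1 : Ck 1 setT (fun t : R => 3 * (`|t| * t)).
  exact: (Ck_mul openT (Ck_cst _ _ _) (Ck_scalar (fun t => is_derive_norm_mul t) C0)).
have C2 : Ck 2 setT (fun t : R => (`|t| * t) * t).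
  apply: Ck_scalar C1 => t.
  have H1 := is_derive_norm_mul t.
  have H : is_derive t 1 (fun s : R => (`|s| * s) * s) ((`|t| * t) *: (1 : R) + t *: (2 * `|t|)).
    exact: (is_deriveM (f := fun s : R => `|s| * s) (g := id)).
  by apply: is_derive_eq; rewrite /GRing.scale/=; ring.
have C3 : Ck 2 setT (id : R -> R).
  by apply: (Ck_scalar (fun t => is_derive_id t 1)); exact: Ck_cst.
apply: (Ck_eq (W := R) openT _ (Ck_add (W := R) openT C2 (Ck_mul openT C3 (Ck_mul openT C3 C3)))).
by move=> t _; rewrite /cubic_ramp; ring.
Qed.

Lemma cubic_ramp_ge0 t : 0 <= cubic_ramp t.
Proof.
rewrite /cubic_ramp mulr_ge0//; last by rewrite -expr2 sqr_ge0.
by rewrite addrC -lerBlDr sub0r -normrN ler_norm.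
Qed.

Lemma cubic_ramp_gt0 t : 0 < t -> 0 < cubic_ramp t.
Proof.
by move=> t0; rewrite /cubic_ramp gtr0_norm// !mulr_gt0// addr_gt0.
Qed.

Lemma cubic_ramp_eq0 t : t <= 0 -> cubic_ramp t = 0.
Proof. by move=> t0; rewrite /cubic_ramp ler0_norm// subrr mul0r. Qed.

(** [F \o i] along v has the same difference quotients as F along [i v], so the derivatives agree
    identically, even where F is not derivable. *)
Lemma Ck_precomp (V V' W : normedModType R) k (D : set V') (F : V' -> W) (i : V -> V') :
  linear i -> continuous i -> Ck k D F ->
  (forall x v, 'D_v (F \o i) x = 'D_(i v) F (i x)) /\ Ck k (i @^-1` D) (F \o i).
Proof.
move=> li ci CF.
have Q (G : V' -> W) x v : (fun e : R => e^-1 *: (((G \o i) \o shift x) (e *: v) - (G \o i) x)) =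
    (fun e : R => e^-1 *: ((G \o shift (i x)) (e *: i v) - G (i x))).
  by apply/funext => e /=; rewrite li.
have DE (G : V' -> W) x v : 'D_v (G \o i) x = 'D_(i v) G (i x).
  by with_strategy transparent [derive] rewrite /derive; rewrite Q.
split; first exact: DE.
elim: k F CF => [|k IH] F CF.
  by split=> // x Dx; apply: continuous_comp (ci x) (Ck_continuous CF Dx).
split=> [x Dx|v]; first by apply: continuous_comp (ci x) (Ck_continuous CF Dx).
split=> [x Dx|]; first by rewrite /derivable Q; exact: (Ck_derivable (i v) CF Dx).
rewrite (_ : 'D_v (F \o i) = 'D_(i v) F \o i); last by apply/funext => x; exact: DE.
exact: IH (Ck_derive (i v) CF).
Qed.

Lemma Ck_scalar_comp (V : normedModType R) k (U : set V) (F : R -> R) (G : V -> R) :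
  open U -> Ck k setT F -> Ck k U G -> Ck k U (F \o G).
Proof.
move=> oU CF CG.
have CF' : Ck k setT (fun z : 'rV[R]_1 => F (z 0 0)).
  by apply: (Ck_precomp (i := fun z : 'rV[R]_1 => z 0 0) _ _ CF).2 => [a x y|];
    [rewrite !mxE|exact: coord_continuous].
have CG' : Ck k U (fun x => const_mx (G x) : 'rV[R]_1).
  apply/(Ck_mxP _ _ oU) => i j.
  by apply: (Ck_eq (W := R) oU _ CG) => x _; rewrite mxE.
apply: (Ck_eq (W := R) oU _ (Ck_comp openT oU _ CF' CG')) => // x _.
by rewrite /= mxE.
Qed.

Lemma open_Ck_preimage (V : normedModType R) k (U : set V) (f : V -> R) (A : set R) :
  open U -> Ck k U f -> open A -> open (U `&` f @^-1` A).
Proof.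
move=> oU Cf oA; rewrite openE => x [Ux Ax]; apply: filterI; first exact: open_nbhs_nbhs.
by have := Ck_continuous Cf Ux; apply; exact: open_nbhs_nbhs.
Qed.

Lemma Ck_norm (V : normedModType R) k (U : set V) (f : V -> R) :
  open U -> (forall x, U x -> f x != 0) -> Ck k U f -> Ck k U (fun x => `|f x|).
Proof.
move=> oU f0 Cf.
have oS (A : set R) : open A -> open (U `&` f @^-1` A) := open_Ck_preimage oU Cf.
apply: Ck_local => x Ux.
have [fx|fx|fx] := ltrgtP (f x) 0; last by move: (f0 _ Ux); rewrite fx eqxx.
- exists (U `&` f @^-1` [set z | z < 0]) => //.
  apply: (Ck_eq (W := R) (oS _ (@open_lt _ 0)) _ (Ck_opp (oS _ (@open_lt _ 0)) (Ck_sub _ Cf))).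
    by move=> z [_ /= /ltr0_norm].
  by move=> z [].
- exists (U `&` f @^-1` [set z | 0 < z]) => //.
  apply: (Ck_eq (W := R) (oS _ (@open_gt _ 0)) _ (Ck_sub _ Cf)).
    by move=> z [_ /= /gtr0_norm].
  by move=> z [].
Qed.

End Bump.

(** * Functions on manifolds and partitions of unity *)

Section Charts.
Variables (R : realType) (d : nat) (M : mfd R d) (MP : is_manifold M).

Definition chart_range i : set 'rV[R]_d := cmap (@chart_at R d M i) @` cdom (chart_at i).
Local Notation dom i := (cdom (@chart_at R d M i)).
Local Notation co i := (cmap (@chart_at R d M i)).
Local Notation pt i := (cinv (@chart_at R d M i)).

Lemma open_cdom i : open (dom i).
Proof. by case: MP => _ _ /(_ i)[[]]. Qed.

Lemma open_range i : open (chart_range i).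
Proof. by case: MP => _ _ /(_ i)[[]]. Qed.

Arguments open_cdom : clear implicits.
Arguments open_range : clear implicits.

Lemma cmapK i p : dom i p -> pt i (co i p) = p.
Proof. by case: MP => _ _ /(_ i)[_ + _ _] _ _; apply. Qed.

Lemma cinv_dom i x : chart_range i x -> dom i (pt i x).
Proof. by move=> [p Up <-]; rewrite cmapK. Qed.

Lemma cinvK i x : chart_range i x -> co i (pt i x) = x.
Proof. by move=> [p Up <-]; rewrite cmapK. Qed.

Lemma range_cmap i p : dom i p -> chart_range i (co i p).
Proof. by move=> Up; exists p. Qed.

Lemma cmap_continuous i p : dom i p -> {for p, continuous (co i)}.
Proof. by case: MP => _ _ /(_ i)[_ _ + _] _ _; apply. Qed.

Lemma cinv_continuous i x : chart_range i x -> {for x, continuous (pt i)}.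
Proof. by case: MP => _ _ /(_ i)[_ _ _ +] _ _; apply. Qed.

Lemma open_cinv_preimage i (O : set M) : open O -> open [set x | chart_range i x /\ O (pt i x)].
Proof.
move=> oO; rewrite openE => x [Vx Ox]; apply: filterI.
  by apply: open_nbhs_nbhs; split=> //; exact: open_range.
by have := cinv_continuous Vx; apply; exact: open_nbhs_nbhs.
Qed.

Lemma open_cmap_preimage i (O : set 'rV[R]_d) : open O -> open [set p | dom i p /\ O (co i p)].
Proof.
move=> oO; rewrite openE => p [Vp Op]; apply: filterI.
  by apply: open_nbhs_nbhs; split=> //; exact: open_cdom.
by have := cmap_continuous Vp; apply; exact: open_nbhs_nbhs.
Qed.

Arguments open_cinv_preimage i [ O ] _.
Arguments open_cmap_preimage i [ O ] _.

Lemma in_chart p : exists i, dom i p.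
Proof. by case: MP => _ _ _ /(_ p). Qed.

Lemma local_domE d' (N : mfd R d') (f : M -> N) i j x :
  local_dom f i j x <-> chart_range i x /\ cdom (chart_at j) (f (pt i x)).
Proof.
split=> [[p [Up fp] <-]|[Vx fx]]; first by rewrite cmapK//; split=> //; exists p.
by exists (pt i x); [split=> //; exact: cinv_dom|exact: cinvK].
Qed.

Lemma open_local_dom d' (N : mfd R d') (f : M -> N) i j :
  open (cdom (@chart_at R d' N j)) -> continuous f -> open (local_dom f i j).
Proof.
move=> oU cf.
have -> : local_dom f i j = [set x | chart_range i x /\ (f @^-1` cdom (chart_at j)) (pt i x)].
  by apply/seteqP; split=> x /local_domE.
apply: open_cinv_preimage; rewrite /preimage.
by apply: (open_comp (f := f)) => // p _; exact: cf.
Qed.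

Definition transition i j := @local_rep R d d M M idfun i j.
Definition overlap i j := @local_dom R d d M M idfun i j.

Lemma overlapE i j x : overlap i j x <-> chart_range i x /\ dom j (pt i x).
Proof. exact: (@local_domE d M idfun). Qed.

Lemma open_overlap i j : open (overlap i j).
Proof. by apply: open_local_dom; [exact: open_cdom|move=> p; exact: id]. Qed.

Arguments open_overlap : clear implicits.

Lemma smooth_transition i j k : Ck k (overlap i j) (transition i j).
Proof. by case: MP => _ _ _ _ [_ /(_ i j k)]. Qed.

Arguments smooth_transition : clear implicits.

Lemma transition_range i j x : overlap i j x -> chart_range j (transition i j x).
Proof. by move=> /overlapE[_ Ux]; exact: range_cmap. Qed.

Lemma transitionK i j x : overlap i j x -> pt j (transition i j x) = pt i x.
Proof. by move=> /overlapE[_ Ux]; rewrite /transition/local_rep/= cmapK. Qed.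

Definition CkM k (u : M -> R) := forall i, Ck k (chart_range i) (u \o pt i).

Lemma CkM_continuous k u : CkM k u -> continuous u.
Proof.
move=> Cu p; have [i Up] := in_chart p.
have E : \forall q \near p, (u \o pt i \o co i) q = u q.
  have : nbhs p (dom i) by apply: open_nbhs_nbhs; split=> //; exact: open_cdom.
  by apply: filterS => q Uq /=; rewrite cmapK.
apply: cvg_trans (near_eq_cvg E) _.
have := @continuous_comp _ _ _ (co i) (u \o pt i) p (cmap_continuous Up).
have Vp := range_cmap Up.
by move=> /(_ (Ck_continuous (Cu i) Vp)); rewrite /prop_for/continuous_at/= cmapK.
Qed.

Lemma CkM_mul k u v : CkM k u -> CkM k v -> CkM k (fun p => u p * v p).
Proof. by move=> Cu Cv i; exact: (Ck_mul (open_range i) (Cu i) (Cv i)). Qed.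

Lemma CkM_sum k (I : Type) (r : seq I) (u : I -> M -> R) :
  (forall j, CkM k (u j)) -> CkM k (fun p => \sum_(j <- r) u j p).
Proof.
move=> Cu i.
exact: (@Ck_sum _ _ R k _ _ _ (fun _ => true) (fun j => u j \o pt i) (open_range i) (fun j _ => Cu j i)).
Qed.

Lemma CkM_inv k u : (forall p, u p != 0) -> CkM k u -> CkM k (fun p => (u p)^-1).
Proof. by move=> u0 Cu i; exact: (Ck_inv (open_range i) (fun x _ => u0 _) (Cu i)). Qed.

Lemma CkMW k u : CkM k.+1 u -> CkM k u.
Proof. by move=> Cu i; exact: CkW. Qed.

Definition supp_in (O : set M) (b : M -> R) :=
  exists K, [/\ closed K, K `<=` O & forall q, ~ K q -> b q = 0].

(** M is covered by the domain of the chart i and the complement of K. Read in another chart, the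
    function is F composed with a transition map over the first, and 0 over the second. *)
Lemma CkM_extend k i (F : 'rV[R]_d -> R) (K : set M) :
  Ck k (chart_range i) F -> closed K -> K `<=` dom i ->
  (forall x, chart_range i x -> ~ K (pt i x) -> F x = 0) ->
  CkM k (fun q => if pselect (dom i q) then F (co i q) else 0).
Proof.
move=> CF cK KU F0 j; apply: Ck_local => x Vx.
have [Ux|nUx] := pselect (dom i (pt j x)).
  exists (overlap j i); first exact/overlapE.
  have CT := smooth_transition j i k.
  apply: (Ck_eq (W := R) (open_overlap j i) _
    (Ck_comp (open_range i) (open_overlap j i) (fun y => @transition_range j i y) CF CT)).
  move=> y /overlapE[Vy Uy] /=.
  by case: pselect => // Uy'; rewrite /= /transition/local_rep/=.
have oC : open (~` K) by rewrite openC.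
exists [set y | chart_range j y /\ (~` K) (pt j y)]; first by split=> // /KU.
apply: (Ck_eq (W := R) (open_cinv_preimage j oC) _ (Ck_cst _ _ (0 : R))).
move=> y [Vy Ky] /=; case: pselect => // Uy; rewrite F0 ?cmapK//; exact: range_cmap.
Qed.

(* The charts are Euclidean, so closed balls in them are compact, hence closed in the Hausdorff M. *)
Lemma bump_function (O : set M) p : open O -> O p -> exists b : M -> R,
  [/\ CkM 2 b, forall q, 0 <= b q, 0 < b p & supp_in O b].
Proof.
move=> oO Op; have [i Up] := in_chart p; set x0 := co i p.
have Vx0 : chart_range i x0 := range_cmap Up.
have /nbhs_ballP[r /= r0 Hr] : nbhs x0 [set x | chart_range i x /\ O (pt i x)].
  by apply: open_nbhs_nbhs; split; [exact: open_cinv_preimage|split=> //; rewrite /x0 cmapK].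
pose s := r / 2; have s0 : 0 < s by rewrite divr_gt0.
have sr x : `|x - x0| <= s -> chart_range i x /\ O (pt i x).
  move=> xs; apply: Hr; rewrite -ball_normE/= distrC (le_lt_trans xs)//.
  by rewrite /s ltr_pdivrMr// ltr_pMr// ltr1n.
(* Squares are summed because the norm of row vectors is the maximum norm, which is not
   differentiable; where F is not 0, that norm of x - x0 is still at most s. *)
pose F (x : 'rV[R]_d) : R := cubic_ramp (s ^+ 2 - \sum_a (x 0 a - x0 0 a) * (x 0 a - x0 0 a)).
have CF : Ck 2 (chart_range i) F.
  have oV := open_range i.
  have C1 a := Ck_sub_fun oV (Ck_coord 2 (chart_range i) (0 : 'I_1) a) (Ck_cst _ _ (x0 0 a : R)).
  have C2 := @Ck_sum R _ R 2 _ _ (index_enum 'I_d) (fun _ => true)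
    (fun a (x : 'rV[R]_d) => (x 0 a - x0 0 a) * (x 0 a - x0 0 a)) oV (fun a _ => Ck_mul oV (C1 a) (C1 a)).
  exact: (Ck_scalar_comp oV (Ck_cubic_ramp R) (Ck_sub_fun oV (Ck_cst _ _ (s ^+ 2)) C2)).
have Fs x : F x != 0 -> `|x - x0| <= s.
  apply: contra_neqT; rewrite -ltNge => xs; apply: cubic_ramp_eq0.
  rewrite subr_le0 leNgt; apply/negP => H; move: xs; apply/negP; rewrite -leNgt.
  apply: mx_norm_le (ltW s0) _ => u a; rewrite !mxE (ord1 u).
  rewrite -(@ler_pXn2r _ 2)// ?nnegrE ?(ltW s0)// real_normK ?num_real//.
  apply: le_trans (ltW H); rewrite (bigD1 a)//= expr2 lerDl sumr_ge0// => c _.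
  by rewrite -expr2 sqr_ge0.
pose K := pt i @` [set x | `|x - x0| <= s].
have cK : closed K.
  apply: compact_closed; first by case: MP.
  apply: continuous_compact.
    apply: continuous_in_subspaceT => x /set_mem/= /sr[Vx _]; exact: cinv_continuous.
  apply: bounded_closed_compact; last exact: (@closed_norm_le _ _ x0 s).
  exists (s + `|x0|); split; first exact: num_real.
  move=> L sL x /= xs; apply: le_trans (ltW sL).
  by rewrite -[x in `|x|](subrK x0) (le_trans (ler_normD _ _))// lerD2r.
have KU : K `<=` dom i by move=> _ [x /= /sr[Vx _] <-]; exact: cinv_dom.
have F0 x : chart_range i x -> ~ K (pt i x) -> F x = 0.
  by move=> Vx Kx; apply/eqP; apply: contra_notT Kx => /Fs xs; exists x.
exists (fun q => if pselect (dom i q) then F (co i q) else 0); split.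
- exact: CkM_extend CF cK KU F0.
- by move=> q; case: pselect => //= _; exact: cubic_ramp_ge0.
- case: pselect => //= _; rewrite -/x0 /F big1 ?subr0; last by move=> a _; rewrite subrr mul0r.
  by apply: cubic_ramp_gt0; rewrite exprn_gt0.
- exists K; split=> //; first by move=> _ [x /= /sr[_ Ox] <-].
  move=> q Kq; case: pselect => //= Uq; apply: F0; first exact: range_cmap.
  by rewrite cmapK.
Qed.

Lemma partition_of_unity (O : M -> set M) : compact [set: M] ->
  (forall p, open (O p)) -> (forall p, O p p) ->
  exists (s : seq M) (rho : M -> M -> R),
  [/\ forall p, CkM 2 (rho p), forall p q, 0 <= rho p q,
      forall p, supp_in (O p) (rho p) & forall q, \sum_(p <- s) rho p q = 1].
Proof.
move=> cM oO Op.
have [b Hb] := choice (fun p => bump_function (oO p) (Op p)).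
have b_ge0 p q : 0 <= b p q by case: (Hb p).
have Cb p : CkM 2 (b p) by case: (Hb p).
(* The properties shared by all lists that contain some given list form a filter; compactness along
   it yields one finite list of points whose bump functions have a positive sum everywhere. *)
pose F : set_system (seq M) := [set A | exists s : seq M, forall s' : seq M, {subset s <= s'} -> A s'].
have FF : Filter F.
  split; first by exists [::].
    move=> A B [s Hs] [t Ht]; exists (s ++ t) => s' sub; split; [apply: Hs|apply: Ht] => x xs;
    by apply: sub; rewrite mem_cat xs ?orbT.
  by move=> A B AB [s Hs]; exists s => s' /Hs/AB.
have [s Hs] : \forall s \near F, [set: M] `<=` (fun q => 0 < \sum_(p <- s) b p q).
  move/compact_near_coveringP: cM; apply=> p _.
  exists ([set q | 0 < b p q], [set s : seq M | p \in s]); last first.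
    move=> [q s] [/= pq ps]; rewrite (big_rem p)/= // ltr_wpDr//.
    by rewrite sumr_ge0.
  split=> /=; last by exists [:: p] => s'; apply; rewrite mem_head.
  have cb : {for p, continuous (b p)} by exact: (CkM_continuous (CkMW (CkMW (Cb p)))).
  apply: (cb [set z | 0 < z]); apply: open_nbhs_nbhs; split; first exact: open_gt.
  by case: (Hb p).
have {}Hs q : 0 < \sum_(p <- s) b p q by apply: (Hs s).
exists (s), (fun p q => b p q * (\sum_(p' <- s) b p' q)^-1); split.
- move=> p; apply: CkM_mul (Cb p) _; apply: CkM_inv; first by move=> q; rewrite gt_eqF.
  exact: CkM_sum.
- by move=> p q; rewrite mulr_ge0// invr_ge0 ltW.
- move=> p; have [_ _ _ [K [cK KO K0]]] := Hb p; exists K; split=> // q Kq.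
  by rewrite K0// mul0r.
- by move=> q; rewrite -mulr_suml mulfV// gt_eqF.
Qed.

End Charts.

Arguments open_cdom {R d M} MP i.
Arguments open_range {R d M} MP i.
Arguments open_overlap {R d M} MP i j.
Arguments smooth_transition {R d M} MP i j k.
Arguments open_cinv_preimage {R d M} MP i [ O ] _.
Arguments open_cmap_preimage {R d M} MP i [ O ] _.

(** * Volume forms on compact manifolds *)

Lemma row_mul_jac (R : realType) d e (T : 'rV[R]_d -> 'rV[R]_e) (A : 'M[R]_e) x a b :
  (forall v, derivable T x v) ->
  bform A ('D_(delta_mx 0 a) T x) ('D_(delta_mx 0 b) T x) =
  ((\matrix_(i, j) 'D_(delta_mx 0 i) (fun z => T z 0 j) x) *m A *m
   (\matrix_(i, j) 'D_(delta_mx 0 i) (fun z => T z 0 j) x)^T) a b.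
Proof.
move=> dT; rewrite /bform; set J := \matrix_(i, j) _.
have D c : 'D_(delta_mx 0 c) T x = row c J.
  by rewrite derive_mx//; apply/rowP => j; rewrite !mxE.
by rewrite !D tr_row -!row_mul mxE colE mulmxA -colE mxE.
Qed.

Lemma bform_delta (R : realType) d (A : 'M[R]_d) a b :
  bform A (delta_mx 0 a) (delta_mx 0 b) = A a b.
Proof. by rewrite /bform -rowE trmx_delta -colE 2!mxE. Qed.

Section Densities.
Variables (R : realType) (g : nat).
Local Notation n := (g + g)%N.
Variables (M : mfd R n) (MP : is_manifold M) (cM : compact [set: M]).
Local Notation dom i := (cdom (@chart_at R n M i)).
Local Notation co i := (cmap (@chart_at R n M i)).
Local Notation pt i := (cinv (@chart_at R n M i)).
Local Notation V i := (@chart_range R n M i).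

Definition transforms (A : form2 M) := forall i j x, overlap i j x ->
  A i x = jac (@transition R n M i j) x *m A j (transition i j x) *m (jac (@transition R n M i j) x)^T.

Lemma transforms_pulls_back (A : form2 M) : pulls_back (idfun : M -> M) A A -> transforms A.
Proof.
move=> pA i j x ox; apply/matrixP => a b.
rewrite -bform_delta -(pA i j x ox) row_mul_jac// => v.
exact: (Ck_derivable v (smooth_transition MP i j 1) ox).
Qed.

Variable w : form2 M.
Hypothesis w_smooth : forall i, Ck 2 (V i) (w i).
Hypothesis w_trans : transforms w.
Hypothesis w_top : forall i x, V i x -> wedge_top (fun=> w i x) != 0.

Definition volume i x := wedge_top (fun=> w i x).

Lemma Ck_wedge_top k (U : set 'rV[R]_n) (A : 'I_g -> 'rV[R]_n -> 'M[R]_n) :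
  open U -> (forall i, Ck k U (A i)) -> Ck k U (fun x => wedge_top (fun i => A i x)).
Proof.
move=> oU CA.
apply: (@Ck_sum R _ R k U _ _ _ (fun (s : 'S_n) x =>
  (-1) ^+ s * \prod_i A i x (s (lshift g i)) (s (rshift g i))) oU).
move=> s _; apply: (@Ck_mul R _ k U (fun=> (-1) ^+ s) _ oU (Ck_cst _ _ _)).
apply: (@Ck_prod R _ k U _ _ _ (fun i x => A i x (s (lshift g i)) (s (rshift g i))) oU) => i _.
exact: (Ck_mxP _ _ oU).1 (CA i) _ _.
Qed.

Lemma volume_transition i j x : overlap i j x ->
  volume i x = \det (jac (@transition R n M i j) x) * volume j (transition i j x).
Proof.
move=> ox; rewrite /volume -wedge_top_congr; apply: eq_wedge_top => _; exact: w_trans.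
Qed.

Lemma det_transition i j x : overlap i j x -> \det (jac (@transition R n M i j) x) != 0.
Proof.
move=> ox; have [Vx _] := (overlapE MP _ _ _).1 ox.
by have := w_top Vx; rewrite -/(volume i x) (volume_transition ox) mulf_eq0 negb_or => /andP[].
Qed.

Lemma Ck_volume i : Ck 2 (V i) (volume i).
Proof. exact: (Ck_wedge_top (A := fun=> w i) (open_range MP i) (fun=> w_smooth i)). Qed.

(** The absolute value makes this a density rather than a form: it transforms by the absolute value
    of the Jacobian determinant, whatever the orientations of the charts. *)
Definition density i (v : M -> R) : 'rV[R]_n -> R :=
  zero_ext (V i) (fun x => v (pt i x) * `|volume i x|).

Lemma compact_cmap_image i (K : set M) : closed K -> K `<=` dom i -> compact (co i @` K).
Proof.
move=> cK KU; apply: continuous_compact.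
  by apply: continuous_in_subspaceT => x /set_mem/= /KU; exact: cmap_continuous.
exact: subclosed_compact cM _.
Qed.

Lemma closed_cmap_image i (K : set M) : closed K -> K `<=` dom i -> closed (co i @` K).
Proof.
by move=> cK KU; apply: compact_closed; [exact: norm_hausdorff|exact: compact_cmap_image].
Qed.

Lemma bounded_cmap_image i (K : set M) : closed K -> K `<=` dom i ->
  exists L, forall x, (co i @` K) x -> `|x| <= L%:R.
Proof.
move=> cK KU; have [L [_ HL]] := compact_bounded (compact_cmap_image cK KU).
exists (Num.truncn (Num.max L 0 + 1)).+1 => x Kx.
apply: (HL (Num.truncn (Num.max L 0 + 1)).+1%:R) Kx.
apply: lt_trans (truncnS_gt _).
by rewrite (@le_lt_trans _ _ (Num.max L 0))// ?ltrDl// le_max lexx.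
Qed.

Lemma Ck_density i (v : M -> R) : CkM 1 v -> supp_in (dom i) v -> Ck 1 setT (density i v).
Proof.
move=> Cv [K [cK KU K0]].
apply: (Ck_zero_ext (open_range MP i) (closed_cmap_image cK KU)).
- by move=> _ [q Kq <-]; exact: range_cmap (KU q Kq).
- move=> x Vx; rewrite mulf_eq0 negb_or => /andP[vx _]; exists (pt i x); last exact: cinvK.
  by apply: contra_neqP vx; exact: K0.
- exact: (Ck_mul (open_range MP i) (Cv i) (Ck_norm (open_range MP i) (@w_top i) (CkW (Ck_volume i)))).
Qed.

Lemma density_sum i (I : Type) (r : seq I) (v : I -> M -> R) x :
  density i (fun q => \sum_(k <- r) v k q) x = \sum_(k <- r) density i (v k) x.
Proof.
have [Vx|nVx] := pselect (V i x).
  rewrite /density zero_extT// mulr_suml; apply: eq_bigr => k _; by rewrite zero_extT.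
by rewrite /density zero_extF// big1// => k _; rewrite zero_extF.
Qed.

Lemma supp_inI (O : set M) (u v : M -> R) : supp_in O v -> supp_in O (fun q => u q * v q).
Proof. by move=> [K [cK KU K0]]; exists K; split=> // q /K0 ->; rewrite mulr0. Qed.

Lemma supp_in_sub (O O' : set M) (u : M -> R) : O `<=` O' -> supp_in O u -> supp_in O' u.
Proof. by move=> OO' [K [cK KU K0]]; exists K; split=> // q /KU/OO'. Qed.

(** [local_change] only covers small balls, so v is cut by a partition of unity into pieces that are
    either supported where it applies or zero, being cut off outside K. *)
Lemma density_change i j (v : M -> R) : CkM 1 v -> supp_in (dom i `&` dom j) v ->
  null (fun x => density i v x - density j v x).
Proof.
move=> Cv [K [cK KU K0]].
have vU k : K `<=` dom k -> supp_in (dom k) v by move=> Kk; exists K.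
have H p : exists O : set M, [/\ open O, O p & forall r, CkM 1 r -> supp_in O r ->
    null (fun x => density i (fun q => r q * v q) x - density j (fun q => r q * v q) x)].
  have [[Ui Uj]|nU] := pselect ((dom i `&` dom j) p); last first.
    exists (~` K); split; [by rewrite openC|by move=> /KU|].
    move=> r _ [K' [_ K'K r0]].
    have E k x : density k (fun q => r q * v q) x = 0.
      have [Vx|nVx] := pselect (V k x); last by rewrite /density zero_extF.
      rewrite /density zero_extT//; have [/K'K /K0 ->|/r0 ->] := pselect (K' (pt k x)).
        by rewrite mulr0 mul0r.
      by rewrite !mul0r.
    by apply: (@null_ext R n (fun=> 0)) => [x|]; [rewrite !E subrr|exact: null0].
  pose x0 := co i p; pose T := @transition R n M i j.
  have ox0 : overlap i j x0.
    by apply/(overlapE MP); split; [exact: range_cmap|rewrite /x0 (cmapK MP)].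
  have [r [e [r0 e0 rV Hre]]] := local_change (open_overlap MP i j)
    (smooth_transition MP i j 2) ox0 (det_transition ox0).
  have Tx0 : T x0 = co j p by rewrite /T /transition /local_rep/= /x0 (cmapK MP).
  exists ([set q | dom i q /\ [set x | `|x - x0| < r] (co i q)] `&`
          [set q | dom j q /\ [set x | `|x - T x0| < e] (co j q)]); split.
  - by apply: openI; apply: open_cmap_preimage => //; exact: open_norm_lt.
  - by rewrite /= Tx0 !subrr !normr0.
  - move=> rho Crho [K' [cK' K'O rho0]].
    pose u q := rho q * v q.
    have Cu : CkM 1 u by exact: CkM_mul.
    have uK q : u q != 0 -> K' q by apply: contra_neqP => /rho0; rewrite /u => ->; rewrite mul0r.
    have su : supp_in (dom j) u by apply: supp_inI; apply: vU => q /KU[].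
    have Fe y : density j u y != 0 -> `|y - T x0| < e.
      have [Vy|nVy] := pselect (V j y); last by rewrite /density zero_extF// eqxx.
      rewrite /density zero_extT// mulf_eq0 negb_or => /andP[/uK/K'O[_ [_ /=]] + _].
      by rewrite (cinvK MP).
    apply: (null_ext _ (Hre _ (Ck_density Cu su) Fe)) => x; f_equal.
    have [xr|xr] := pselect ([set x | `|x - x0| < r] x).
      have ox := rV x xr; have [Vx Ux] := (overlapE MP _ _ _).1 ox.
      rewrite (zero_extT _ xr) /density (zero_extT _ Vx) (zero_extT _ (transition_range MP ox)).
      by rewrite (transitionK MP ox) (volume_transition ox) normrM -mulrA [`|_| * `|_|]mulrC.
    rewrite (zero_extF _ xr) /density; have [Vx|nVx] := pselect (V i x); last by rewrite zero_extF.
    rewrite zero_extT//; apply/esym/eqP; apply: contra_notT xr.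
    rewrite mulf_eq0 negb_or => /andP[/uK/K'O[[_ /=]] + _ _].
    by rewrite (cinvK MP).
have [Q HQ] := choice H.
have [s [rho [Crho _ rhoO rho1]]] := partition_of_unity MP cM
   (fun p => let: And3 a _ _ := HQ p in a) (fun p => let: And3 _ a _ := HQ p in a).
have E k x : density k v x = \sum_(p <- s) density k (fun q => rho p q * v q) x.
  rewrite -density_sum; apply: zero_ext_eq => _; by rewrite -mulr_suml rho1 mul1r.
apply: (@null_ext _ _ (fun x => \sum_(p <- s)
  (density i (fun q => rho p q * v q) x - density j (fun q => rho p q * v q) x))).
  by move=> x; rewrite !E sumrB.
apply: (@null_sum _ _ _ _ _ (fun p x =>
  density i (fun q => rho p q * v q) x - density j (fun q => rho p q * v q) x)) => p _.
have [_ _ +] := HQ p; apply; [exact: CkMW|exact: rhoO].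
Qed.

End Densities.

Lemma grad_sum (R : realType) n (I : Type) (r : seq I) (f : I -> 'rV[R]_n -> R) x :
  (forall k v, derivable (f k) x v) ->
  grad (fun z => \sum_(k <- r) f k z) x = \sum_(k <- r) grad (f k) x.
Proof.
move=> df; apply/rowP => a; rewrite summxE mxE.
have H (k : I) : is_derive x (delta_mx 0 a) (f k) ('D_(delta_mx 0 a) (f k) x) by exact: derivableP.
rewrite (@derive_val _ _ _ _ _ _ _ (is_derive_sum_seq r H)).
by apply: eq_bigr => k _; rewrite mxE.
Qed.

(** * Exact terms divided by the volume form *)

Section ExactDifference.
Variables (R : realType) (g : nat).
Local Notation n := (g + g)%N.
Variables (M : mfd R n) (MP : is_manifold M) (cM : compact [set: M]).
Local Notation dom i := (cdom (@chart_at R n M i)).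
Local Notation co i := (cmap (@chart_at R n M i)).
Local Notation pt i := (cinv (@chart_at R n M i)).
Local Notation V i := (@chart_range R n M i).

Variables w al : form2 M.
Hypothesis w_smooth : forall i, Ck 2 (V i) (w i).
Hypothesis w_trans : transforms w.
Hypothesis w_closed : forall i, closed_form (V i) (w i).
Hypothesis w_top : forall i x, V i x -> wedge_top (fun=> w i x) != 0.
Hypothesis al_smooth : forall i, Ck 1 (V i) (al i).
Hypothesis al_trans : transforms al.
Hypothesis al_closed : forall i, closed_form (V i) (al i).

Lemma grad_transition (u : M -> R) i j x : CkM 1 u -> overlap i j x ->
  grad (u \o pt i) x = grad (u \o pt j) (transition i j x) *m (jac (@transition R n M i j) x)^T.
Proof.
move=> Cu ox; apply/rowP => a; rewrite mxE.
have oO := open_overlap MP i j.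
have E : \near x, (u \o pt i) x = ((u \o pt j) \o transition i j) x.
  by apply: near_open oO ox _ => z oz /=; rewrite (transitionK MP).
rewrite (near_eq_derive _ E).
have CT := smooth_transition MP i j 1.
rewrite (derive_comp_C1 _ (open_range MP j) oO (fun y => @transition_range _ _ _ MP i j y) (Cu j) CT ox).
rewrite derive_mx; last exact: (Ck_derivable _ CT ox).
by rewrite !mxE; apply: eq_bigr => b _; rewrite !mxE mulrC.
Qed.

Variable k : 'I_g.
(** The factors of the k-th telescoping term of [wedge_top_sub]; in [exact_top] the factor k itself
    is overridden by the exact one. *)
Definition slots i (l : 'I_g) (x : 'rV[R]_n) := if (l < k)%N then w i x else al i x.
Definition exact_top (u y : M -> R) i x := with_exact k (u \o pt i) (y \o pt i) (slots i) x.

Lemma exact_top_transition u y i j x : CkM 1 u -> CkM 1 y -> overlap i j x ->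
  exact_top u y i x = \det (jac (@transition R n M i j) x) * exact_top u y j (transition i j x).
Proof.
move=> Cu Cy ox; rewrite /exact_top /with_exact -wedge_top_congr; apply: eq_wedge_top => l.
case: eqP => _.
  by rewrite (grad_transition Cu ox) (grad_transition Cy ox) trmx_mul trmxK !mulmxA.
by rewrite /slots; case: ifP => _; [exact: w_trans|exact: al_trans].
Qed.

Lemma Ck_exact_top u y i : CkM 2 u -> CkM 2 y -> Ck 1 (V i) (exact_top u y i).
Proof.
move=> Cu Cy; have oV := open_range MP i.
apply: (Ck_wedge_top (A := fun l x => if l == k then (grad (u \o pt i) x)^T *m grad (y \o pt i) x
  else slots i l x) oV) => l.
case: eqP => _.
  apply/(Ck_mxP _ _ oV) => a b.
  apply: (Ck_eq (W := R) oV _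
    (Ck_mul oV (Ck_derive (delta_mx 0 a) (Cu i)) (Ck_derive (delta_mx 0 b) (Cy i)))).
  by move=> x _; rewrite mxE big_ord1 !mxE.
by rewrite /slots; case: (l < k)%N; [exact: (CkW (w_smooth i))|exact: al_smooth].
Qed.

Lemma exact_top_supp (K : set M) u y i x : closed K -> (forall q, ~ K q -> y q = 0) ->
  V i x -> ~ K (pt i x) -> exact_top u y i x = 0.
Proof.
move=> cK y0 Vx Kx; rewrite /exact_top /with_exact.
have gy : grad (y \o pt i) x = 0.
  apply/rowP => a; rewrite !mxE.
  have oC : open (~` K) by rewrite openC.
  have E : \near x, (y \o pt i) x = (fun=> 0) x.
    by apply: near_open (open_cinv_preimage MP i oC) _ _ => // z [_ /= /y0].
  by rewrite (near_eq_derive _ E) derive_cst.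
rewrite /wedge_top big1// => s _; rewrite (bigD1 k)//= eqxx gy mulmx0 mxE mul0r mulr0 //.
Qed.

Variable ch : M -> chart_index M.
Hypothesis ch_dom : forall q, dom (ch q) q.

(** Both coefficients are multiplied by the same Jacobian determinant under a change of chart, so
    the quotient is a function on M, independent of the chart [ch q]. *)
Definition exact_ratio u y q := exact_top u y (ch q) (co (ch q) q) / volume w (ch q) (co (ch q) q).

Lemma exact_ratioE u y i x : CkM 1 u -> CkM 1 y -> V i x ->
  exact_ratio u y (pt i x) = exact_top u y i x / volume w i x.
Proof.
move=> Cu Cy Vx; set j := ch (pt i x).
have ox : overlap i j x by apply/(overlapE MP); split=> //; exact: ch_dom.
rewrite (exact_top_transition Cu Cy ox) (volume_transition w_trans ox).
by rewrite -mulf_div mulfV ?mul1r// (det_transition MP w_trans w_top ox).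
Qed.

Lemma Ck_exact_ratio u y : CkM 2 u -> CkM 2 y -> CkM 1 (exact_ratio u y).
Proof.
move=> Cu Cy i; have oV := open_range MP i.
apply: (Ck_eq (W := R) oV _ (Ck_mul oV (Ck_exact_top i Cu Cy)
  (Ck_inv oV (@w_top i) (CkW (Ck_volume MP w_smooth i))))).
by move=> x Vx /=; rewrite (exact_ratioE (CkMW Cu) (CkMW Cy) Vx).
Qed.

Lemma exact_ratio_supp (K : set M) u y q : closed K -> (forall q, ~ K q -> y q = 0) ->
  ~ K q -> exact_ratio u y q = 0.
Proof.
move=> cK y0 Kq; rewrite /exact_ratio (exact_top_supp _ cK y0) ?mul0r//.
  exact: range_cmap.
by rewrite (cmapK MP).
Qed.

(** A chart domain may be disconnected, and the volume coefficient may change sign within it; here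
    it keeps the sign that it has at p. *)
Definition same_sign p : set M := [set q | dom (ch p) q /\
  (V (ch p) `&` (fun x => volume w (ch p) x * volume w (ch p) (co (ch p) p)) @^-1` [set t | 0 < t])
    (co (ch p) q)].

Lemma open_same_sign p : open (same_sign p).
Proof.
have oV := open_range MP (ch p).
apply: open_cmap_preimage => //; apply: (open_Ck_preimage oV _ (@open_gt _ 0)).
exact: (Ck_mul oV (Ck_volume MP w_smooth _) (Ck_cst _ _ (volume w (ch p) (co (ch p) p)))).
Qed.

Lemma same_sign_refl p : same_sign p p.
Proof.
have Vp : V (ch p) (co (ch p) p) by exact: range_cmap.
by split=> //; split=> //=; rewrite -expr2 lt_neqAle sqr_ge0 eq_sym sqrf_eq0 andbT w_top.
Qed.

(** On the support of y the sign of the volume coefficient is constant, so the density of the ratio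
    is the exact term up to that sign, and [exact_null] applies. *)
Lemma exact_density_null u y p : CkM 2 u -> CkM 2 y -> supp_in (same_sign p) y ->
  null (density w (ch p) (exact_ratio u y)).
Proof.
move=> Cu Cy [K [cK KS y0]]; set i := ch p.
have KU : K `<=` dom i by move=> q /KS[].
have [L HL] := bounded_cmap_image MP cM cK KU.
have N : null (zero_ext (V i) (exact_top u y i)).
  apply: (exact_null (open_range MP i) (closed_cmap_image MP cM cK KU) _ HL (Cu i) (CkW (Cy i))).
  - by move=> _ [q Kq <-]; exact: range_cmap (KU q Kq).
  - move=> x Vx yx; exists (pt i x); last exact: (cinvK MP).
    by apply: contra_neqP yx; exact: y0.
  - move=> l _; rewrite /slots; case: (l < k)%N; split.
    + exact: CkW.
    + exact: w_closed.
    + exact: al_smooth.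
    + exact: al_closed.
apply: (null_ext _ (null_scale (Num.sg (volume w i (co i p))) N)) => x.
have [Vx|nVx] := pselect (V i x); last by rewrite /density !zero_extF// mulr0.
rewrite /density !zero_extT// (exact_ratioE (CkMW Cu) (CkMW Cy) Vx).
have [Kx|nKx] := pselect (K (pt i x)); last by rewrite (exact_top_supp _ cK y0)// mulr0 !mul0r.
have [_ [_ /=]] := KS _ Kx; rewrite -/i (cinvK MP)// => s0.
have v0 : volume w i x != 0 by exact: w_top.
have -> : `|volume w i x| = Num.sg (volume w i (co i p)) * volume w i x.
  rewrite normrEsg; congr (_ * _).
  have c0 : volume w i (co i p) != 0 by apply: contraTneq s0 => ->; rewrite mulr0 ltxx.
  apply/eqP; rewrite -(inj_eq (mulIf (_ : Num.sg (volume w i (co i p)) != 0))) ?sgr_eq0//.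
  by rewrite -sgrM gtr0_sg// -expr2 sqr_sg c0.
by rewrite [RHS]mulrCA divfK.
Qed.

(** The sum over b expresses the integral of the ratio over M through the partition [rho]. As y is
    supported in the chart of p, [density_change] moves every piece to that chart, where the pieces
    reassemble. *)
Lemma exact_densities_null u y p (s : seq M) (rho : M -> M -> R) :
  CkM 2 u -> CkM 2 y -> supp_in (same_sign p) y ->
  (forall b, CkM 2 (rho b)) -> (forall b, supp_in (same_sign b) (rho b)) ->
  (forall q, \sum_(b <- s) rho b q = 1) ->
  null (fun x => \sum_(b <- s) density w (ch b) (fun q => rho b q * exact_ratio u y q) x).
Proof.
move=> Cu Cy sy Crho srho rho1; set e := exact_ratio u y.
have N1 : null (fun x => \sum_(b <- s)
    (density w (ch b) (fun q => rho b q * e q) x - density w (ch p) (fun q => rho b q * e q) x)).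
  apply: (@null_sum _ _ _ _ _ (fun b x => density w (ch b) (fun q => rho b q * e q) x
    - density w (ch p) (fun q => rho b q * e q) x)) => b _.
  apply: (density_change MP cM w_smooth w_trans w_top).
    exact: (CkM_mul MP (CkMW (Crho b)) (Ck_exact_ratio Cu Cy)).
  have [K [cK KS y0]] := sy; have [K' [cK' KS' rho0]] := srho b.
  exists (K' `&` K); split; first exact: closedI.
    by move=> q [/KS'[Ub _] /KS[Up _]].
  move=> q; have [K'q nK|/rho0 -> _] := pselect (K' q); last by rewrite mul0r.
  by rewrite /e (exact_ratio_supp _ cK y0) ?mulr0// => Kq; apply: nK.
apply: (null_ext _ (null_add N1 (exact_density_null Cu Cy sy))) => x.
rewrite sumrB -(density_sum w (ch p) s (fun b q => rho b q * e q)).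
rewrite [X in _ - X + _](_ : _ = density w (ch p) e x) ?subrK//.
by apply: zero_ext_eq => _; rewrite -mulr_suml rho1 mul1r.
Qed.

End ExactDifference.

(* A partition of unity localizes the exact terms, and each localized term is
   a total derivative in a chart; so the integral of the volume over M is 0. *)
Lemma exact_difference_absurd (R : realType) (g : nat) (M : mfd R (g + g)) (w al : form2 M)
    (p0 : M) (I : Type) (r : seq I) (u y : I -> M -> R) :
  is_manifold M -> compact [set: M] ->
  (forall i, Ck 2 (chart_range i) (w i)) -> transforms w ->
  (forall i, closed_form (chart_range i) (w i)) ->
  (forall i x, chart_range i x -> wedge_top (fun=> w i x) != 0) ->
  (forall i, Ck 1 (chart_range i) (al i)) -> transforms al ->
  (forall i, closed_form (chart_range i) (al i)) ->
  (forall i x, chart_range i x -> wedge_top (fun=> al i x) = 0) ->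
  (forall a, CkM 2 (u a)) -> (forall a, CkM 2 (y a)) ->
  (forall i x, chart_range i x -> w i x - al i x =
    \sum_(a <- r) (grad (u a \o cinv (chart_at i)) x)^T *m grad (y a \o cinv (chart_at i)) x) ->
  False.
Proof.
move=> MP cM Cw Tw Zw w0 Cal Tal Zal al0 Cu Cy E.
have [ch ch_dom] := choice (in_chart MP).
have [s [rho [Crho rho_ge0 rhoO rho1]]] := partition_of_unity MP cM
  (open_same_sign MP Cw ch) (same_sign_refl w0 ch_dom).
pose rs := [seq (a, b) | a <- r, b <- s].
pose ya (ab : I * M) q := rho ab.2 q * y ab.1 q.
have Cya ab : CkM 2 (ya ab) by exact: (CkM_mul MP (Crho ab.2) (Cy ab.1)).
have Sya ab : supp_in (same_sign w ch ab.2) (ya ab).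
  have [K [cK KO K0]] := rhoO ab.2; exists K; split=> // q /K0; rewrite /ya => ->.
  by rewrite mul0r.
pose e (k : 'I_g) ab q := exact_ratio w al k ch (u ab.1) (ya ab) q.
have E' i x : chart_range i x -> w i x - al i x = \sum_(ab <- rs)
    (grad (u ab.1 \o cinv (chart_at i)) x)^T *m grad (ya ab \o cinv (chart_at i)) x.
  move=> Vx; rewrite E// /rs big_allpairs; apply: eq_bigr => a _.
  have -> : grad (y a \o cinv (chart_at i)) x =
      \sum_(b <- s) grad (ya (a, b) \o cinv (chart_at i)) x.
    have D b v : derivable (ya (a, b) \o cinv (chart_at i)) x v.
      exact: (Ck_derivable v (Cya (a, b) i) Vx).
    rewrite -(grad_sum s D); f_equal; apply/funext => z /=.
    by rewrite /ya /= -mulr_suml rho1 mul1r.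
  by rewrite mulmx_sumr.
(* The telescoping identity for the g-th powers of w and al, divided by the volume coefficient; the
   power of al vanishes. *)
have one q : \sum_(k < g) \sum_(ab <- rs) e k ab q = 1.
  set i := ch q; set x := cmap (chart_at i) q.
  have Vx : chart_range i x := range_cmap (ch_dom q).
  have v0 : volume w i x != 0 by exact: w0.
  transitivity ((wedge_top (fun=> w i x) - wedge_top (fun=> al i x)) / volume w i x); last first.
    by rewrite al0// subr0 mulfV.
  rewrite wedge_top_sub mulr_suml; apply: eq_bigr => k _.
  rewrite (eq_wedge_top (B := fun l => if l == k then \sum_(ab <- rs)
      (grad (u ab.1 \o cinv (chart_at i)) x)^T *m grad (ya ab \o cinv (chart_at i)) x
      else slots w al k i l x)).
    by rewrite wedge_top_split mulr_suml.
  move=> l; rewrite /slots; have [->|//] := eqVneq l k.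
  by rewrite ltnn E'.
(* [H] represents the volume of M: it is null because the ratios sum to 1, yet it is nonnegative and
   bounded below near the image of p0 in a chart. *)
pose H x := \sum_(b <- s) density w (ch b) (rho b) x.
have d_ge0 b x : 0 <= density w (ch b) (rho b) x.
  rewrite /density; have [Vx|nVx] := pselect (chart_range (ch b) x).
    by rewrite zero_extT// mulr_ge0.
  by rewrite zero_extF.
have nH : null H.
  apply: (@null_ext _ _ (fun x => \sum_(k < g) \sum_(ab <- rs) \sum_(b <- s)
      density w (ch b) (fun q => rho b q * e k ab q) x)).
    move=> x; under eq_bigr do rewrite exchange_big/=.
    rewrite exchange_big/=; apply: eq_bigr => b _.
    under eq_bigr do rewrite -density_sum.
    rewrite -density_sum; apply: zero_ext_eq => _; congr (_ * _).
    under eq_bigr do rewrite -mulr_sumr.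
    by rewrite -mulr_sumr one mulr1.
  apply: (@null_sum _ _ _ _ _ (fun k x => \sum_(ab <- rs) \sum_(b <- s)
      density w (ch b) (fun q => rho b q * e k ab q) x)) => k _.
  apply: (@null_sum _ _ _ _ _ (fun ab x => \sum_(b <- s)
      density w (ch b) (fun q => rho b q * e k ab q) x)) => ab _.
  exact: (exact_densities_null MP cM Cw Tw Zw w0 Cal Tal Zal k ch_dom (Cu ab.1) (Cya ab) (Sya ab)
    Crho rhoO rho1).
have [b bs rb] : exists2 b, b \in s & 0 < rho b p0.
  apply/hasP; apply/negPn/negP => /hasPn hs.
  have := rho1 p0; rewrite big_seq big1 => [/esym/eqP|b /hs]; first by rewrite oner_eq0.
  by rewrite lt_neqAle rho_ge0 andbT negbK => /eqP.
have Ub : cdom (chart_at (ch b)) p0.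
  have [K [_ KO K0]] := rhoO b.
  have [Kp|/K0 r0] := pselect (K p0); first by have [] := KO _ Kp.
  by move: rb; rewrite r0 ltxx.
pose x0 := cmap (chart_at (ch b)) p0.
have Cd : Ck 1 setT (density w (ch b) (rho b)).
  apply: (Ck_density MP cM Cw w0 (CkMW (Crho b))).
  by apply: supp_in_sub (rhoO b) => q [].
have Vx0 : chart_range (ch b) x0 := range_cmap Ub.
have d0 : 0 < density w (ch b) (rho b) x0.
  by rewrite /density zero_extT// mulr_gt0 ?normr_gt0 ?w0// /x0 (cmapK MP).
have c0 : 0 < density w (ch b) (rho b) x0 / 2 by rewrite divr_gt0.
have /cvgrPdist_lt/(_ _ c0) := Ck_continuous Cd (Logic.I : setT x0).
rewrite -nbhs_nearE => /nbhs_ballP[eps /= eps0 Heps].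
apply: (lattice_sum_lower (x0 := x0) eps0 c0) nH.
  by move=> x; rewrite sumr_ge0.
move=> x xe; rewrite /H (big_rem b)//= ler_wpDr ?sumr_ge0//.
have /Heps/= : ball x0 eps x by rewrite -ball_normE/= distrC.
rewrite ltr_distlC => /andP[+ _] => /ltW; apply: le_trans.
by rewrite lerBrDr -splitr.
Qed.

(** * The slice M_G x {0} *)

Section PlanarPairs.
Variables (R : realType) (n e : nat).

(* The pairs (j, false) and (j, true) index the two terms of
   dx_j (x) dy_j - dy_j (x) dx_j. *)
Definition pair_left (bt : 'I_e * bool) : 'I_(e + e) :=
  if bt.2 then rshift e bt.1 else lshift e bt.1.
Definition pair_right (bt : 'I_e * bool) : 'I_(e + e) :=
  if bt.2 then lshift e bt.1 else rshift e bt.1.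

Lemma mul_std_mx (Y : 'M[R]_(n, e + e)) (a b : 'I_n) :
  (Y *m std_mx R e *m Y^T) a b =
  \sum_(bt : 'I_e * bool) (-1) ^+ bt.2 * (Y a (pair_left bt) * Y b (pair_right bt)).
Proof.
rewrite -[Y]hsubmxK; set L := lsubmx Y; set Q := rsubmx Y.
rewrite -(pair_big xpredT xpredT (fun (j : 'I_e) (t : bool) => (-1) ^+ t *
    (row_mx L Q a (pair_left (j, t)) * row_mx L Q b (pair_right (j, t)))))/=.
under eq_bigr do rewrite big_bool/= /pair_left /pair_right/= !row_mxEl !row_mxEr expr1 expr0 mulN1r mul1r.
rewrite /std_mx mul_row_block !mulmx0 add0r addr0 mulmxN !mulmx1 tr_row_mx mul_row_col mulNmx.
rewrite mxE [X in X + _]mxE !mxE big_split/= sumrN; congr (- _ + _).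
  by apply: eq_bigr => j _; rewrite [X in _ * X]mxE.
by apply: eq_bigr => j _; rewrite [X in _ * X]mxE.
Qed.

(** The derivative along v of the (a, b) coefficient of sum_j dx_j /\ dy_j, for functions x_j, y_j
    with first derivatives [D1] and second derivatives [D2]. *)
Definition pair_sum (D1 : 'I_n -> 'I_(e + e) -> R) (D2 : 'I_n -> 'I_n -> 'I_(e + e) -> R) v a b :=
  \sum_(bt : 'I_e * bool) (-1) ^+ bt.2 *
    (D1 a (pair_left bt) * D2 v b (pair_right bt) + D1 b (pair_right bt) * D2 v a (pair_left bt)).

(** In coordinates, d(dx /\ dy) = 0: by the symmetry of [D2] the two terms of each j cancel in the
    cyclic sum. *)
Lemma pair_sum_cyclic D1 D2 a b c : (forall u v k, D2 u v k = D2 v u k) ->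
  pair_sum D1 D2 a b c + pair_sum D1 D2 b c a + pair_sum D1 D2 c a b = 0.
Proof.
move=> D2C; pose F v a b (j : 'I_e) (t : bool) := (-1) ^+ t *
    (D1 a (pair_left (j, t)) * D2 v b (pair_right (j, t)) +
     D1 b (pair_right (j, t)) * D2 v a (pair_left (j, t))).
have E v u u' : pair_sum D1 D2 v u u' = \sum_j (F v u u' j true + F v u u' j false).
  rewrite (eq_bigr (fun j => \sum_t F v u u' j t)); last by move=> j _; rewrite big_bool.
  by rewrite (pair_big xpredT xpredT (F v u u'))/=; apply: eq_bigr => -[].
rewrite !E -!big_split big1// => j _; rewrite /F /pair_left /pair_right/= expr1 expr0.
rewrite [D2 b a _]D2C [D2 b a _]D2C [D2 c a _]D2C [D2 c a _]D2C [D2 c b _]D2C [D2 c b _]D2C; ring.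
Qed.

End PlanarPairs.

(** The pullback of the standard form by psi, as a sum of du (x) dy with the sign absorbed in y: the
    shape taken by [exact_difference_absurd]. *)
Definition pair_form (R : realType) n e (psi : 'I_(e + e) -> 'rV[R]_n -> R) x : 'M[R]_n :=
  \sum_(bt : 'I_e * bool) (grad (psi (pair_left bt)) x)^T *m
    grad (fun z => (-1) ^+ bt.2 * psi (pair_right bt) z) x.

Lemma pair_formE (R : realType) n e (psi : 'I_(e + e) -> 'rV[R]_n -> R) x
    (Y := \matrix_(a, b) 'D_(delta_mx 0 a) (psi b) x) :
  (forall b v, derivable (psi b) x v) -> pair_form psi x = Y *m std_mx R e *m Y^T.
Proof.
move=> dpsi; apply/matrixP => a b; rewrite mul_std_mx summxE; apply: eq_bigr => bt _.
rewrite mxE big_ord1 !mxE mulrCA; congr (_ * _).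
by have := @deriveZ R _ _ (psi (pair_right bt)) ((-1) ^+ bt.2) x (delta_mx 0 b) (dpsi _ _); exact.
Qed.

Lemma sum_exact_closed (R : realType) g (U : set 'rV[R]_(g + g)) e (psi : 'I_(e + e) -> 'rV[R]_(g + g) -> R)
    (w : 'rV[R]_(g + g) -> 'M[R]_(g + g)) :
  open U -> Ck 1 U w -> closed_form U w -> (forall b, Ck 2 U (psi b)) ->
  let al x := w x - pair_form psi x in
  Ck 1 U al /\ closed_form U al.
Proof.
move=> oU Cw Zw Cpsi al.
pose P (a b : 'I_(g + g)) (bt : 'I_e * bool) x : R :=
  (-1) ^+ bt.2 * ('D_(delta_mx 0 a) (psi (pair_left bt)) x *
   'D_(delta_mx 0 b) (psi (pair_right bt)) x).
have alE x a b : U x -> al x a b = w x a b - \sum_bt P a b bt x.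
  move=> Ux; rewrite /al pair_formE; last by move=> k v; exact: (Ck_derivable v (Cpsi k) Ux).
  rewrite 2!mxE mul_std_mx; congr (_ - _); apply: eq_bigr => bt _.
  by rewrite !mxE.
have CD b a : Ck 1 U ('D_(delta_mx 0 a) (psi b)) by exact: Ck_derive.
have CP a b bt : Ck 1 U (P a b bt).
  exact: (@Ck_mul R _ 1 U (fun=> _) _ oU (Ck_cst _ _ _) (Ck_mul oU (CD _ a) (CD _ b))).
have Cwab a b : Ck 1 U (fun x => w x a b) by exact: (Ck_mxP _ _ oU).1 Cw a b.
have CS a b : Ck 1 U (fun x => \sum_bt P a b bt x).
  exact: (@Ck_sum R _ R 1 U _ _ _ (fun bt x => P a b bt x) oU (fun bt _ => CP a b bt)).
split.
  apply/(Ck_mxP _ _ oU) => a b.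
  apply: (Ck_eq (W := R) oU _ (Ck_sub_fun oU (Cwab a b) (CS a b))) => x Ux.
  by rewrite alE.
move=> x Ux a b c.
pose D2 (a b : 'I_(g + g)) k : R := 'D_(delta_mx 0 a) ('D_(delta_mx 0 b) (psi k)) x.
have D2C a' b' k : D2 a' b' k = D2 b' a' k by exact: (derive_comm _ _ oU (Cpsi k) Ux).
pose D1 (a : 'I_(g + g)) k : R := 'D_(delta_mx 0 a) (psi k) x.
have DP v a' b' bt : is_derive x (delta_mx 0 v) (P a' b' bt)
    ((-1) ^+ bt.2 * (D1 a' (pair_left bt) * D2 v b' (pair_right bt) +
      D1 b' (pair_right bt) * D2 v a' (pair_left bt))).
  have H1 : is_derive x (delta_mx 0 v) ('D_(delta_mx 0 a') (psi (pair_left bt))) (D2 v a' (pair_left bt)).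
    exact/derivableP/(Ck_derivable _ (CD _ a') Ux).
  have H2 : is_derive x (delta_mx 0 v) ('D_(delta_mx 0 b') (psi (pair_right bt))) (D2 v b' (pair_right bt)).
    exact/derivableP/(Ck_derivable _ (CD _ b') Ux).
  exact: (@is_deriveZ R _ _ _ ((-1) ^+ bt.2) _ _ _ (is_deriveM H1 H2)).
have Dal v a' b' : 'D_(delta_mx 0 v) (fun y => al y a' b') x =
    'D_(delta_mx 0 v) (fun y => w y a' b') x - pair_sum D1 D2 v a' b'.
  have E : \forall y \near x, al y a' b' = w y a' b' - \sum_bt P a' b' bt y.
    by apply: near_open oU Ux _ => y Uy; exact: alE.
  rewrite (near_eq_derive _ E).
  have Hw : is_derive x (delta_mx 0 v) (fun y => w y a' b') ('D_(delta_mx 0 v) (fun y => w y a' b') x).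
    exact/derivableP/(Ck_derivable _ (Cwab a' b') Ux).
  have HS := is_derive_sum_seq (index_enum ('I_e * bool)%type) (DP v a' b').
  exact: (@derive_val _ _ _ _ _ _ _ (is_deriveB Hw HS)).
have C (p1 p2 p3 s1 s2 s3 : R) :
    p1 - s1 + (p2 - s2) + (p3 - s3) = p1 + p2 + p3 - (s1 + s2 + s3) by ring.
by rewrite !Dal C Zw// pair_sum_cyclic ?subr0.
Qed.

Lemma bform_block (R : realType) a b (A : 'M[R]_a) (B : 'M[R]_b) (u v : 'rV[R]_a) :
  bform (block_mx A 0 0 B) (row_mx u 0) (row_mx v 0) = bform A u v.
Proof.
by rewrite /bform tr_row_mx mul_row_block !mul0mx !mulmx0 !addr0 mul_row_col mul0mx addr0.
Qed.

Section Slice.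
Variables (R : realType) (g h m e : nat) (MG : mfd R (g + g)) (MH : mfd R (h + h)).
Variables (wG : form2 MG) (wH : form2 MH).
Variable f : prod_mfd MG (euclid R (m + m)) -> prod_mfd MH (euclid R (e + e)).
Hypotheses (MGP : is_manifold MG) (MHP : is_manifold MH) (f_smooth : smooth_map f).
Hypothesis f_pb : pulls_back f (prod_form wH (std_form R e)) (prod_form wG (std_form R m)).

Definition slice_base (q : MG) : MH := (f (q, 0)).1.
Definition slice_fiber (b : 'I_(e + e)) (q : MG) : R := (f (q, 0)).2 0 b.
Local Notation pt i := (cinv (@chart_at R (g + g) MG i)).
Local Notation iota := (fun x : 'rV[R]_(g + g) => row_mx x 0 : 'rV[R]_(g + g + (m + m))).
Local Notation rep i j := (@local_rep _ _ _ (prod_mfd MG (euclid R (m + m)))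
  (prod_mfd MH (euclid R (e + e))) f (i, tt) (j, tt)).

Lemma slice_base_continuous : continuous slice_base.
Proof.
have [cf _] := f_smooth; move=> q.
apply: (@continuous_comp _ _ _ (fun q : MG => f (q, 0)) fst); last exact: cvg_fst.
apply: (@continuous_comp _ _ _ (fun q : MG => (q, 0) : prod_mfd MG (euclid R (m + m))) f); last exact: cf.
have c0 (A B : topologicalType) (b : B) : continuous (fun a : A => (a, b)).
  by move=> a; apply: cvg_pair; [exact: cvg_id|exact: cvg_cst].
exact: c0.
Qed.

Lemma iota_linear : linear iota.
Proof. by move=> a x y; rewrite scale_row_mx add_row_mx scaler0 addr0. Qed.

Lemma iota_continuous : continuous iota.
Proof.
suff [+ _] : Ck 0 setT iota by move=> H x; exact: H.
apply/(Ck_mxP _ _ openT) => a b.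
case: (split_ordP b) => c ->.
  by apply: (Ck_eq (W := R) openT _ (Ck_coord 0 setT a c)) => x _; rewrite row_mxEl.
by apply: (Ck_eq (W := R) openT _ (Ck_cst _ _ 0)) => x _; rewrite row_mxEr mxE.
Qed.

Lemma rep_iota i j x : rep i j (iota x) =
  row_mx (cmap (chart_at j) (slice_base (pt i x))) (\row_b slice_fiber b (pt i x)).
Proof.
rewrite /local_rep/= row_mxKl row_mxKr; congr (row_mx _ _).
by apply/rowP => b; rewrite mxE.
Qed.

Definition slice_dom i j := [set x | chart_range i x /\
  (slice_base @^-1` cdom (@chart_at R _ MH j)) (pt i x)].

Lemma open_slice_dom i j : open (slice_dom i j).
Proof.
apply: open_cinv_preimage => //; apply: (open_comp (f := slice_base)) => [q _|].
  exact: slice_base_continuous.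
exact: open_cdom.
Qed.

Arguments open_slice_dom : clear implicits.

Lemma slice_local_dom i j x : slice_dom i j x ->
  @local_dom _ _ _ (prod_mfd MG (euclid R (m + m))) (prod_mfd MH (euclid R (e + e))) f
    (i, tt) (j, tt) (iota x).
Proof.
move=> [Vx Ux]; exists (pt i x, 0); last by rewrite /= (cinvK MGP).
by split; split=> //=; exact: cinv_dom.
Qed.

Lemma Ck_slice i j k : (forall x v, 'D_v (rep i j \o iota) x = 'D_(iota v) (rep i j) (iota x)) /\
  Ck k (slice_dom i j) (rep i j \o iota).
Proof.
have [_ /(_ (i, tt) (j, tt) k) C] := f_smooth.
have [D1 D2] := Ck_precomp iota_linear iota_continuous C.
by split=> //; apply: Ck_sub D2 => x /slice_local_dom.
Qed.

Lemma Ck_slice_fiber k b : CkM k (slice_fiber b).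
Proof.
move=> i; apply: Ck_local => x Vx.
have [j Uj] := in_chart MHP (slice_base (pt i x)).
exists (slice_dom i j) => //; have oU := open_slice_dom i j.
have := (Ck_mxP _ _ oU).1 (Ck_slice i j k).2 0 (rshift (h + h) b).
apply: (Ck_eq (W := R) oU) => z _.
by rewrite /comp rep_iota row_mxEr mxE.
Qed.

(** The standard form of R^2m vanishes on the slice, so the Jacobian J of f along it pulls the
    product form back to [wG]. Removing the contribution of the Euclidean columns of J leaves a form
    pulled back from dimension 2h < 2g. *)
Lemma slice_degenerate i x : (h < g)%N -> chart_range i x ->
  wedge_top (fun=> wG i x - pair_form (fun b => slice_fiber b \o pt i) x) = 0.
Proof.
move=> hg Vx.
have [j Uj] := in_chart MHP (slice_base (pt i x)).
have Dx : slice_dom i j x by [].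
have oU := open_slice_dom i j.
have [DE C1] := Ck_slice i j 1.
pose T := rep i j \o iota.
have dT v : derivable T x v := Ck_derivable v C1 Dx.
pose J := \matrix_(a, b) 'D_(delta_mx 0 a) (fun z => T z 0 b) x.
have JE : J *m prod_form wH (std_form R e) (j, tt) (T x) *m J^T = wG i x.
  apply/matrixP => a b; rewrite -(row_mul_jac (T := T))// /T !DE (f_pb (slice_local_dom Dx)).
  by rewrite /prod_form/= bform_block row_mxKl bform_delta.
have YE : rsubmx J = \matrix_(a, b) 'D_(delta_mx 0 a) (slice_fiber b \o pt i) x.
  apply/matrixP => a b; rewrite !mxE.
  refine (f_equal (fun F : 'rV[R]_(g + g) -> R => 'D_(delta_mx 0 a) F x) _); apply/funext => z.
  by rewrite /T /comp rep_iota row_mxEr mxE.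
rewrite pair_formE; last first.
  by move=> b v; exact: (Ck_derivable v (Ck_slice_fiber 1 b i) Vx).
rewrite -YE -JE -{1 2}[J]hsubmxK /prod_form/= mul_row_block !mulmx0 addr0 add0r.
rewrite tr_row_mx mul_row_col addrK.
by apply: wedge_top_degenerate; exact: ltn_add_self.
Qed.

End Slice.

Theorem corollary1p4 (R : realType) (T : finType) (G H : sgraph T)
    (G_conn : graph_connected G) (H_conn : graph_connected H)
    (HG : subgraph H G)
    (k : nat) (k_gt0 : (0 < k)%N) (card_H : #|vset H| = (#|vset G| - k)%N)
    (g h : nat)
    (labG : 'I_g.+1 -> T) (labGP : labelling G labG)
    (labH : 'I_h.+1 -> T) (labHP : labelling H labH)
    (MG : mfd R (g + g)) (wG : form2 MG)
    (MGP : symplectic_toric_manifold (graph_associahedron R G labG) wG)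
    (MH : mfd R (h + h)) (wH : form2 MH)
    (MHP : symplectic_toric_manifold (graph_associahedron R H labH) wH)
    (m : nat)
    (f : prod_mfd MG (euclid R (m + m)) ->
         prod_mfd MH (euclid R ((k + m) + (k + m))))
    (f_emb : smooth_embedding f) :
  ~ pulls_back f (prod_form wH (std_form R (k + m))) (prod_form wG (std_form R m)).
Proof.
move=> f_pb.
have card_lab n (K : sgraph T) (lab : 'I_n.+1 -> T) : labelling K lab -> #|vset K| = n.+1.
  by move=> [inj <-]; rewrite card_imset// card_ord.
have hg : (h < g)%N.
  by rewrite -ltnS -(card_lab _ _ _ labHP) card_H (card_lab _ _ _ labGP) ltn_subrL k_gt0.
have [[MGm wG_pb wG_smooth wG_nondeg wG_closed] cMG _ [rho [mu [_ _ rho_eff _ _]]]] := MGP.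
have [[MHm _ _ _ _] _ _ _] := MHP.
have [f_smooth _ _ _] := f_emb.
(* If M_G were empty, every t would act trivially, and effectiveness would make the vector with all
   entries 1/2 integral; it has an entry since h < g. *)
have [p0 _] : exists p : MG, True.
  apply: contrapT => noMG; have /rho_eff/(_ (Ordinal hg)) : forall p, rho (const_mx 2^-1) p = p.
    by move=> p; case: noMG; exists p.
  rewrite mxE => /intrP[z zE].
  have : 1 = (2 * z)%:~R :> R by rewrite intrM -zE mulfV.
  move=> /eqP; rewrite -[1]/(1%:~R) eqr_int => /eqP/(congr1 (odd \o absz)).
  by rewrite /= abszM oddM.
pose y (bt : 'I_(k + m) * bool) q := (-1) ^+ bt.2 * slice_fiber f (pair_right bt) q.
pose al : form2 MG := fun i x =>
  wG i x - pair_form (fun b => slice_fiber f b \o cinv (chart_at i)) x.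
have C2 b : CkM 2 (slice_fiber f b) by exact: Ck_slice_fiber.
have Z i : Ck 1 (chart_range i) (al i) /\ closed_form (chart_range i) (al i).
  apply: sum_exact_closed; [exact: open_range|exact: wG_smooth|exact: wG_closed|].
  by move=> b; exact: C2.
have Cy bt : CkM 2 (y bt).
  by move=> i; apply: (@Ck_mul R _ 2 _ (fun=> _) _ (open_range MGm i) (Ck_cst _ _ _) (C2 _ i)).
have TG := transforms_pulls_back MGm wG_pb.
apply: (@exact_difference_absurd R g MG wG al p0 _ (index_enum ('I_(k + m) * bool)%type)
  (fun bt => slice_fiber f (pair_left bt)) y MGm cMG).
- by move=> i; exact: wG_smooth.
- exact: TG.
- exact: wG_closed.
- by move=> i x /wG_nondeg[]; exact: wedge_top_neq0.
- by move=> i; case: (Z i).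
(* The subtracted part transforms like a 2-form because every gradient is multiplied by the
   transposed Jacobian matrix of the transition map. *)
- move=> i j x ox; rewrite /al (TG i j x ox) mulmxBr mulmxBl; congr (_ - _).
  rewrite /pair_form mulmx_sumr mulmx_suml; apply: eq_bigr => bt _.
  rewrite (grad_transition MGm (CkMW (C2 _)) ox).
  have := grad_transition MGm (CkMW (Cy bt)) ox; rewrite /y /comp => ->.
  by rewrite trmx_mul trmxK !mulmxA.
- by move=> i; case: (Z i).
- by move=> i x Vx; exact: slice_degenerate f_pb _ _ hg Vx.
- by move=> bt; exact: C2.
- exact: Cy.
- by move=> i x Vx; rewrite /al opprB addrC subrK.
Qed.
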